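(* Let $L$ be an algebraically closed field with $\mathrm{char}(L)=p\neq 0$. Let $D$ be a smooth projective algebraic curve over $L$, and let $F\subset D\times P^m$ be a smooth irreducible projective curve over $L$ such that the projection $pr:F\to D$ is a finite surjective morphism which is separable. Then for every point $(ab)\in F$, lying over $a\in D$, the Zariski multiplicity and the algebraic multiplicity of the cover coincide: $$Mult_{(ab)}(F/D)=mult^{alg}_{(ab)}(F/D).$$
   Context: All curves are over the algebraically closed field $L$; points are $L$-points unless stated otherwise. The cover $pr:F\to D$ is separable if the field extension $L(D)\subset L(F)$ induced by $pr$ is separable. Zariski multiplicity: let $K\supsetneq L$ be an algebraically closed field with a nontrivial valuation, trivial on $L$, whose residue field is $L$ (a ''nonstandard model'' of $L$; e.g. an algebraic closure of $L((\epsilon))$), and let $P^n(K)\to P^n(L)$ be the associated specialisation (reduction) maps. For a point $x$ of a projective variety over $L$, ${\mathcal V}_x$ denotes the infinitesimal neighbourhood of $x$, i.e. the set of $K$-points of the ambient projective space specialising to $x$. For $(ab)\in F$ with $a\in D$, choose $a'\in D(K)\cap {\mathcal V}_a$ generic in $D$ over $L$ (i.e. $a'\notin D(L)$). Then $$Mult_{(ab)}(F/D)=\mathrm{Card}\{b'\in{\mathcal V}_b : (a',b')\in F(K)\},$$ which does not depend on the choice of $a'$. Algebraic multiplicity: $mult^{alg}_{(ab)}(F/D)$ is the length of ${\mathcal O}_{(ab),F}/m_a{\mathcal O}_{(ab),F}$, where $m_a$ is the maximal ideal of ${\mathcal O}_{a,D}$; as $(ab)$ is a non-singular point, it equals $ord_{(ab)}(pr^*x)$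 for $x$ a local uniformiser of $D$ at $a$. *)

(* Defs.v *)
From Stdlib Require Import ClassicalEpsilon.
From HB Require Import structures.
From mathcomp Require Import all_boot all_order all_algebra all_field.
From mathcomp Require Import ring_quotient.
From mathcomp Require Import mpoly.

Set Implicit Arguments.
Unset Strict Implicit.
Unset Printing Implicit Defensive.
Import GRing.Theory.
Local Open Scope ring_scope.
Local Open Scope quotient_scope.

(* The quotient of a commutative ring by a prime ideal, as an integral domain.
   The library only provides its ring structure, since an idomainType has a
   decidable set of units; these are obtained here by classical choice. *)
Section PrimeQuotient.
Variables (R : comNzRingType) (I : prime_idealr R).

Definition prime_quot := {ideal_quot I}.

HB.instance Definition _ := GRing.ComNzRing.on prime_quot.

Definition prime_quot_unit (x : prime_quot) : bool :=
  if excluded_middle_informative (exists y, y * x = 1) then true else false.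

Definition prime_quot_inv (x : prime_quot) : prime_quot :=
  match excluded_middle_informative (exists y, y * x = 1) with
  | left h => proj1_sig (constructive_indefinite_description _ h)
  | right _ => x
  end.

Lemma prime_quot_mulVr : {in prime_quot_unit, left_inverse 1 prime_quot_inv *%R}.
Proof.
move=> x; rewrite unfold_in /prime_quot_unit /prime_quot_inv.
case: excluded_middle_informative => // h _.
by case: constructive_indefinite_description.
Qed.

Lemma prime_quot_unitP (x y : prime_quot) : y * x = 1 -> prime_quot_unit x.
Proof.
move=> yx1; rewrite /prime_quot_unit.
by case: excluded_middle_informative => // -[]; exists y.
Qed.

Lemma prime_quot_inv_out : {in [predC prime_quot_unit], prime_quot_inv =1 id}.
Proof.
move=> x; rewrite inE unfold_in /prime_quot_unit /prime_quot_inv.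
by case: excluded_middle_informative.
Qed.

HB.instance Definition _ := GRing.ComNzRing_hasMulInverse.Build prime_quot
  prime_quot_mulVr prime_quot_unitP prime_quot_inv_out.

HB.instance Definition _ := GRing.ComUnitRing_isIntegral.Build prime_quot
  (@Quotient.rquot_IdomainAxiom R I).

End PrimeQuotient.

(* Multiprojective spaces.  A map w : 'I_N -> G splits the N homogeneous
   coordinates into one block per g : G, and describes the product over g of
   the projective spaces with coordinates {x_i | w i = g}.  Its points over K
   are the x : 'rV[K]_N that are nonzero on each block, up to rescaling each
   block separately.  Only two instances matter: P^n (a single block) and
   P^n x P^m (two blocks). *)

Definition pn_block (n : nat) : 'I_n.+1 -> unit := fun=> tt.

Definition pnpm_block (n m : nat) : 'I_(n.+1 + m.+1) -> bool :=
  fun i => (i < n.+1)%N.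

Section Multiprojective.
Variables (N : nat) (G : finType) (w : 'I_N -> G).

Definition block_nonzero (K : fieldType) (x : 'rV[K]_N) :=
  forall g, exists2 i, w i = g & x 0 i != 0.

Definition same_point (K : fieldType) (x y : 'rV[K]_N) :=
  exists2 c : G -> K, forall g, c g != 0 & forall i, y 0 i = c (w i) * x 0 i.

Definition mnm_multideg (m : 'X_{1..N}) (g : G) : nat :=
  (\sum_(i < N | w i == g) m i)%N.

Section OverL.
Variable L : closedFieldType.
Local Notation poly := {mpoly L[N]}.

Definition multihomog (d : G -> nat) (p : poly) :=
  forall m, m \in msupp p -> forall g, mnm_multideg m g = d g.

Definition homog_component (d : G -> nat) (p : poly) : poly :=
  \sum_(m <- msupp p | [forall g, mnm_multideg m g == d g]) p@_m *: 'X_[m].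

(* An irreducible closed subvariety, given by its multihomogeneous prime ideal.
   Relevance (no block of coordinates lies in the ideal) makes it nonempty. *)
Record variety := Variety {
  videal :> prime_idealr poly;
  videalH : forall p d,
    p \in (videal : pred poly) -> homog_component d p \in (videal : pred poly);
  videalR : forall g, exists2 i, w i = g & 'X_i \notin (videal : pred poly)
}.

Definition mem_ideal (X : variety) : {pred poly} := (videal X : pred poly).

Definition on_variety (X : variety) (x : 'rV[L]_N) :=
  block_nonzero x /\ forall p, p \in mem_ideal X -> p.@[x 0] = 0.

Definition on_variety_over (K : fieldType) (iota : {rmorphism L -> K})
    (X : variety) (x : 'rV[K]_N) :=
  block_nonzero x /\
  forall p, p \in mem_ideal X -> (map_mpoly iota p).@[x 0] = 0.

(* Y is a proper subvariety of X *)
Definition proper_subvariety (Y X : variety) :=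
  {subset mem_ideal X <= mem_ideal Y} /\
  exists2 p, p \in mem_ideal Y & p \notin mem_ideal X.

Definition descending_chain (X : variety) (k : nat) (c : nat -> variety) :=
  c 0%N = X /\ forall i, (i < k)%N -> proper_subvariety (c i.+1) (c i).

Definition has_dim (X : variety) (d : nat) :=
  (exists c, descending_chain X d c) /\
  (forall k c, descending_chain X k c -> (k <= d)%N).

Definition curve (X : variety) := has_dim X 1.

Definition generate_ideal (X : variety) (k : nat) (f : 'I_k -> poly) :=
  forall p, p \in mem_ideal X <-> exists q : 'I_k -> poly,
    p = \sum_(j < k) q j * f j.

(* Jacobian criterion in (multi)homogeneous coordinates; the ambient space has
   dimension N - #|G|. *)
Definition smooth (X : variety) :=
  forall d, has_dim X d -> forall x, on_variety X x ->
  exists k (f : 'I_k -> poly), generate_ideal X f /\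
    \rank (\matrix_(j < k, i < N) (f j)^`M(i).@[x 0]) = (N - #|G| - d)%N.

(* The fraction field of the multihomogeneous coordinate ring.  It contains the
   function field of X, as the fractions g / h with g, h of equal multidegree. *)
Definition cone_field (X : variety) := {fraction (prime_quot (videal X))}.

Definition cone_class (X : variety) (p : poly) : cone_field X :=
  FracField.tofrac (\pi_{ideal_quot (videal X)} p : prime_quot (videal X)).

Definition rational_function (X : variety) (f : cone_field X) :=
  exists d g h, [/\ multihomog d g, multihomog d h, h \notin mem_ideal X
    & f = cone_class X g / cone_class X h].

(* f is regular at x, with value c *)
Definition has_value (X : variety) (x : 'rV[L]_N) (f : cone_field X) (c : L) :=
  exists d g h, [/\ multihomog d g, multihomog d h, h.@[x 0] != 0,
    f = cone_class X g / cone_class X h & c = g.@[x 0] / h.@[x 0]].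

Definition local_ring (X : variety) (x : 'rV[L]_N) (f : cone_field X) :=
  exists c, has_value x f c.

Definition maximal_ideal (X : variety) (x : 'rV[L]_N) (f : cone_field X) :=
  has_value x f 0.

Definition sections (X : variety) (U : 'rV[L]_N -> Prop) (f : cone_field X) :=
  rational_function f /\ forall x, U x -> local_ring x f.

Definition open_subset (X : variety) (U : 'rV[L]_N -> Prop) :=
  exists2 S : poly -> Prop,
    forall p, S p -> exists d, multihomog d p &
    forall x, U x <-> on_variety X x /\ exists2 p, S p & p.@[x 0] != 0.

Definition eval_cone (X : variety) (k : nat) (t : 'I_k -> cone_field X)
    (P : {mpoly L[k]}) : cone_field X :=
  mmap (fun c => cone_class X c%:MP) t P.

(* The open set U of X is an affine variety: for some regular functions t on U,
   the map t : U -> A^k is an isomorphism onto a closed subset of A^k, i.e. it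
   is a bijection onto it, inducing isomorphisms of local rings. *)
Definition affine (X : variety) (U : 'rV[L]_N -> Prop) :=
  exists k (t : 'I_k -> cone_field X),
  [/\ forall i, sections U (t i),
      forall x y, U x -> U y ->
        (forall i c, has_value x (t i) c <-> has_value y (t i) c) ->
        same_point x y,
      exists S : {mpoly L[k]} -> Prop, forall z : 'I_k -> L,
        (exists2 x, U x & forall i, has_value x (t i) (z i)) <->
        (forall P, S P -> P.@[z] = 0)
    & forall x f, U x -> local_ring x f -> exists P Q,
        (exists2 c, c != 0 & has_value x (eval_cone t Q) c) /\
        f = eval_cone t P / eval_cone t Q].

End OverL.
End Multiprojective.

Section Length.
Variable E : fieldType.

Definition ideal_of (O J : E -> Prop) :=
  [/\ forall x, J x -> O x, J 0, forall x y, J x -> J y -> J (x + y)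
    & forall r x, O r -> J x -> J (r * x)].

Definition generated_ideal (O S : E -> Prop) (x : E) :=
  exists k (r s : 'I_k -> E),
    [/\ forall i, O (r i), forall i, S (s i) & x = \sum_(i < k) r i * s i].

(* O-submodules of O / J correspond to ideals of O containing J *)
Definition quotient_chain (O J : E -> Prop) (k : nat) :=
  exists c : nat -> E -> Prop,
  [/\ forall x, c 0%N x <-> J x, forall x, c k x <-> O x,
      forall i, (i <= k)%N -> ideal_of O (c i)
    & forall i, (i < k)%N ->
        (forall x, c i x -> c i.+1 x) /\ exists2 x, c i.+1 x & ~ c i x].

Definition quotient_length (O J : E -> Prop) (e : nat) :=
  quotient_chain O J e /\ forall k, quotient_chain O J k -> (k <= e)%N.

End Length.

Section Cover.
Variables (L : closedFieldType) (n m : nat).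
Variables (D : variety (@pn_block n) L) (F : variety (@pnpm_block n m) L).

Definition pr_poly (p : {mpoly L[n.+1]}) : {mpoly L[n.+1 + m.+1]} :=
  p \mPo [tuple 'X_(lshift m.+1 i) | i < n.+1].

(* F is contained in D x P^m *)
Definition lies_over := forall p, p \in mem_ideal D -> pr_poly p \in mem_ideal F.

Definition pr_surjective :=
  forall a : 'rV[L]_n.+1, on_variety D a ->
  exists b : 'rV[L]_m.+1, on_variety F (row_mx a b).

Definition pr_preimage (U : 'rV[L]_n.+1 -> Prop) (z : 'rV[L]_(n.+1 + m.+1)) :=
  on_variety F z /\ U (lsubmx z).

(* The image under pr^* of a set A of rational functions on D *)
Definition pr_pullback (A : cone_field D -> Prop) (psi : cone_field F) :=
  exists d g h,
    [/\ multihomog (@pn_block n) d g, multihomog (@pn_block n) d h,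
        h \notin mem_ideal D, A (cone_class D g / cone_class D h)
      & psi = cone_class F (pr_poly g) / cone_class F (pr_poly h)].

Definition pr_finite :=
  forall a, on_variety D a ->
  exists U, [/\ open_subset D U, U a, affine D U, affine F (pr_preimage U)
    & exists r (s : 'I_r -> cone_field F),
        (forall i, sections (pr_preimage U) (s i)) /\
        forall f, sections (pr_preimage U) f ->
        exists2 c : 'I_r -> cone_field F,
          forall i, pr_pullback (sections U) (c i) &
          f = \sum_(i < r) c i * s i].

Definition pr_separable :=
  forall f : cone_field F, rational_function f ->
  exists q : {poly cone_field F},
    [/\ forall i, pr_pullback (@rational_function _ _ _ _ D) q`_i,
        separable_poly q & root q f].

Definition algebraic_mult (a : 'rV[L]_n.+1) (b : 'rV[L]_m.+1) (e : nat) :=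
  let O := @local_ring _ _ _ _ F (row_mx a b) in
  quotient_length O
    (generated_ideal O (pr_pullback (@maximal_ideal _ _ _ _ D a))) e.

End Cover.

(* A valuation of K with values in the totally ordered abelian group
   (vgroup, vle); vval is only meaningful on nonzero elements. *)
Record valuation (K : fieldType) := Valuation {
  vgroup : zmodType;
  vle : rel vgroup;
  vval : K -> vgroup;
  vle_refl : reflexive vle;
  vle_anti : antisymmetric vle;
  vle_trans : transitive vle;
  vle_total : total vle;
  vle_add : forall c x y, vle x y -> vle (x + c) (y + c);
  vvalM : forall x y, x != 0 -> y != 0 -> vval (x * y) = vval x + vval y;
  vvalD : forall x y, x != 0 -> y != 0 -> x + y != 0 ->
    vle (vval x) (vval (x + y)) || vle (vval y) (vval (x + y))
}.

Section Specialisation.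
Variables (L K : closedFieldType) (iota : {rmorphism L -> K}).
Variable v : valuation K.

Definition val_integral (x : K) := x = 0 \/ vle (0 : vgroup v) (vval v x).

Definition val_infinitesimal (x : K) :=
  x = 0 \/ (vle (0 : vgroup v) (vval v x) /\ vval v x <> 0).

(* K is a proper extension of L (via iota), with a nontrivial valuation that is
   trivial on L and has residue field L. *)
Definition nonstandard_model :=
  [/\ exists x, forall c, x <> iota c,
      exists2 x, x != 0 & vval v x <> 0,
      forall c, c != 0 -> vval v (iota c) = 0
    & forall x, val_integral x -> exists c, val_infinitesimal (x - iota c)].

(* x' specialises to x, i.e. x' lies in the infinitesimal neighbourhood of x:
   suitably rescaled, the coordinates of x' are integral and reduce to those
   of x. *)
Definition specialises (n : nat) (x' : 'rV[K]_n.+1) (x : 'rV[L]_n.+1) :=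
  exists2 c, c != 0 & forall i, val_infinitesimal (c * x' 0 i - iota (x 0 i)).

Definition rational_over (n : nat) (x' : 'rV[K]_n.+1) :=
  exists x : 'rV[L]_n.+1, same_point (@pn_block n) x' (map_mx iota x).

(* e points of P^m(K) satisfy P, where the point with coordinates y is
   represented by the line <<y>>. *)
Definition card_points (m : nat) (P : 'rV[K]_m.+1 -> Prop) (e : nat) :=
  exists s : seq 'M[K]_m.+1,
  [/\ uniq s, size s = e
    & forall l, l \in s <-> exists y, [/\ y != 0, P y & l = <<y>>%MS]].

Definition zariski_mult (n m : nat) (F : variety (@pnpm_block n m) L)
    (a' : 'rV[K]_n.+1) (b : 'rV[L]_m.+1) (e : nat) :=
  card_points
    (fun b' => specialises b' b /\ on_variety_over iota F (row_mx a' b')) e.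

End Specialisation.

(* Main.v *)
From Stdlib Require Import ClassicalEpsilon.
From HB Require Import structures.
Require Import Defs.
From mathcomp Require Import all_boot all_order all_algebra all_field.
From mathcomp Require Import ring_quotient.
From mathcomp Require Import mpoly.
From mathcomp Require Import ring.
Set Implicit Arguments.
Unset Strict Implicit.
Unset Printing Implicit Defensive.
Import GRing.Theory.
Local Open Scope ring_scope.

(** Write [O] and [M] for the valuation ring of [K] and its maximal ideal.

    Both multiplicities are shown to equal the ramification index [e] of the
    cover at the point [(a, b)], that is the exponent in [x = theta ^ e * unit],
    for uniformisers [x] of [D] at [a] and [theta] of [F] at [(a, b)].  For the
    algebraic multiplicity this is the length of the quotient of a discrete
    valuation ring by the [e]-th power of its maximal ideal
    ([length_multiples]); the uniformisers come from the Jacobian criterion and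
    Nakayama's lemma ([smooth_curve_uniformiser]).

    For the Zariski multiplicity, the nonstandard point [a'] is generic in [D],
    because a curve has no variety strictly between itself and a point
    ([curve_point_generic]).  Evaluation at [a'] therefore embeds the function
    field of [D] in [K], and the points of [F] over [a'] are the extensions of
    this embedding to the function field of [F].  They are finitely many, so
    that a coordinate chart can be chosen that contains them together with
    their reductions, and [theta] can be chosen to separate them and to vanish
    at no point over [a], other than [(a, b)], to which one of them reduces
    ([fibre_chart], [fibre_parameter]).  Let [P] be the minimal polynomial of
    [theta] over the function field of [D], and [P'] its specialisation at [a'].
    Every root of [P'] is the value of [theta] at a point over [a']
    ([root_lift]), hence the points over [a'] infinitely near to [(a, b)]
    correspond to the infinitesimal roots of [P'], and these are simple since
    the cover is separable.  It remains to see that there are [e] of them.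

    At least [e]: all the roots of [P'] are integral, so [P] can be taken monic
    with coefficients regular at [a].  If there are [r] infinitesimal roots, then
    the coefficient of degree [r] is a unit.  Let [i <= r] be the least degree
    with a unit coefficient.  The lower coefficients are divisible by [x], hence
    by [theta ^ e], so the equation for [theta] makes [theta ^ i] a multiple of
    [theta ^ e], and [e <= i] ([ramification_le]).

    At most [e]: modulo every power of [x], the function [theta ^ e] is a
    combination of [1, ..., theta ^ (e - 1)] with coefficients on [D].  The
    infinitesimal roots are thus approximate roots, to any order in the
    infinitesimal [x (a')], of monic polynomials of degree [e].  By the
    pigeonhole principle more than [e] of them would include two at infinitely
    small distance relative to [x (a')] ([close_roots]), but this distance
    divides the value of the derivative of [P'] at a root, which has finite
    order, again because [F] is a curve. *)

(** * Places *)

(** A valuation of [K], given by its ring [O] and maximal ideal [M], with residue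
    field [L] embedded in [O] by [iota]. *)
Record place (L K : fieldType) (iota : {rmorphism L -> K}) (O M : K -> Prop) : Prop :=
  Place {
  pl_const : forall c, O (iota c);
  plB : forall x y, O x -> O y -> O (x - y);
  plM : forall x y, O x -> O y -> O (x * y);
  pl_sub : forall x, M x -> O x;
  pl_idB : forall x y, M x -> M y -> M (x - y);
  pl_idM : forall x y, O x -> M y -> M (x * y);
  pl_id1 : ~ M 1;
  pl_total : forall x, O x \/ M x^-1;
  pl_residue : forall x, O x -> exists c, M (x - iota c)
}.

Section PlaceTheory.
Variables (L K : fieldType) (iota : {rmorphism L -> K}) (O M : K -> Prop).
Hypothesis pl : place iota O M.

Lemma pl0 : O 0.
Proof. by rewrite -(rmorph0 iota); apply: (pl_const pl). Qed.

Lemma pl1 : O 1.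
Proof. by rewrite -(rmorph1 iota); apply: (pl_const pl). Qed.

Lemma plN x : O x -> O (- x).
Proof. by move=> Ox; rewrite -sub0r; apply: (plB pl pl0 Ox). Qed.

Lemma plD x y : O x -> O y -> O (x + y).
Proof. by move=> Ox Oy; rewrite -[y]opprK; apply: (plB pl Ox (plN Oy)). Qed.

Lemma pl_id0 : M 0.
Proof.
case: (pl_residue pl pl0) => c Mc; rewrite -(subrr (0 - iota c)).
exact: (pl_idB pl Mc Mc).
Qed.

Lemma pl_idN x : M x -> M (- x).
Proof. by move=> Mx; rewrite -sub0r; apply: (pl_idB pl pl_id0 Mx). Qed.

Lemma pl_idD x y : M x -> M y -> M (x + y).
Proof. by move=> Mx My; rewrite -[y]opprK; apply: (pl_idB pl Mx (pl_idN My)). Qed.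

Lemma pl_idMr x y : M x -> O y -> M (x * y).
Proof. by move=> Mx Oy; rewrite mulrC; apply: (pl_idM pl Oy Mx). Qed.

Lemma plX x k : O x -> O (x ^+ k).
Proof.
by move=> Ox; elim: k => [|k IH]; [apply: pl1 | rewrite exprS; apply: (plM pl Ox IH)].
Qed.

Lemma pl_sum (I : Type) (r : seq I) (P : pred I) (F : I -> K) :
  (forall i, P i -> O (F i)) -> O (\sum_(i <- r | P i) F i).
Proof. by move=> OF; apply: (big_ind O) => //; [apply: pl0 | apply: plD]. Qed.

Lemma pl_prod (I : Type) (r : seq I) (P : pred I) (F : I -> K) :
  (forall i, P i -> O (F i)) -> O (\prod_(i <- r | P i) F i).
Proof. by move=> OF; apply: (big_ind O) => //; [apply: pl1 | apply: (plM pl)]. Qed.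

Lemma pl_id_sum (I : Type) (r : seq I) (P : pred I) (F : I -> K) :
  (forall i, P i -> M (F i)) -> M (\sum_(i <- r | P i) F i).
Proof. by move=> MF; apply: (big_ind M) => //; [apply: pl_id0 | apply: pl_idD]. Qed.

Lemma pl_unit x : O x -> ~ M x -> O x^-1.
Proof. by move=> Ox nMx; case: (pl_total pl x^-1) => //; rewrite invrK. Qed.

Lemma pl_unit_neq0 x : ~ M x -> x != 0.
Proof. by move=> nMx; apply/eqP => x0; apply: nMx; rewrite x0; apply: pl_id0. Qed.

Lemma pl_idV x : M x -> x != 0 -> ~ O x^-1.
Proof.
move=> Mx x0 Ox; apply: (pl_id1 pl).
by rewrite -(mulVf x0); apply: (pl_idM pl Ox Mx).
Qed.

Lemma pl_prime x y : O x -> O y -> M (x * y) -> M x \/ M y.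
Proof.
move=> Ox Oy Mxy; case: (excluded_middle_informative (M x)) => [|nMx]; first by left.
right; rewrite -(mulKf (pl_unit_neq0 nMx) y); apply: (pl_idM pl _ Mxy).
exact: pl_unit.
Qed.

Lemma pl_id_const c : M (iota c) -> c = 0.
Proof.
move=> Mc; apply/eqP; case: (altP (c =P 0)) => // c0; case: (pl_id1 pl).
rewrite -(rmorph1 iota) -(mulVf c0) rmorphM.
exact: (pl_idM pl (pl_const pl _) Mc).
Qed.

(** Divisibility by all powers of [pi].  These elements form a prime ideal, which
    can be nonzero as the valuation may have rank larger than one; an element
    outside it has a bounded order in terms of [pi]. *)
Definition flat (pi z : K) := forall k, O (z / pi ^+ k).

Variable pi : K.
Hypotheses (Mpi : M pi) (pi0 : pi != 0).

Lemma flat0 : flat pi 0.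
Proof. by move=> k; rewrite mul0r; apply: pl0. Qed.

Lemma flatD x y : flat pi x -> flat pi y -> flat pi (x + y).
Proof. by move=> fx fy k; rewrite mulrDl; apply: plD. Qed.

Lemma flatM x y : O x -> flat pi y -> flat pi (x * y).
Proof. by move=> Ox fy k; rewrite -mulrA; apply: (plM pl Ox (fy k)). Qed.

Lemma flat1 : ~ flat pi 1.
Proof. by move/(_ 1%N); rewrite expr1 div1r; apply: pl_idV. Qed.

Lemma flat_prime x y : O x -> O y -> flat pi (x * y) -> flat pi x \/ flat pi y.
Proof.
move=> Ox Oy fxy.
case: (excluded_middle_informative (flat pi x)) => [|nfx]; first by left.
right => j.
have [k nk] : exists k, ~ O (x / pi ^+ k) by apply: Classical_Pred_Type.not_all_ex_not.
have x0 : x != 0 by apply/eqP => x0; apply: nk; rewrite x0 mul0r; apply: pl0.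
case: (pl_total pl (x / pi ^+ k)) => // Minv.
have -> : y / pi ^+ j = (x * y) / pi ^+ (j + k) * (x / pi ^+ k)^-1.
  by rewrite exprD; field; rewrite x0 ?expf_neq0.
by apply: (plM pl (fxy _)); apply: (pl_sub pl).
Qed.

Lemma flat_self : ~ flat pi pi.
Proof.
by move/(_ 2); rewrite expr2 invfM mulrA divff // mul1r; apply: pl_idV.
Qed.

Lemma flat_id x : flat pi x -> M x.
Proof.
move/(_ 1%N); rewrite expr1 => Ox; rewrite -(divfK pi0 x).
exact: (pl_idM pl Ox Mpi).
Qed.

End PlaceTheory.

Section PlaceOfValuation.
Variables (L K : closedFieldType) (iota : {rmorphism L -> K}) (v : valuation K).

Let vv := @vval K v.

Lemma vval1 : vv 1 = 0.
Proof.
have := vvalM v (oner_neq0 K) (oner_neq0 K); rewrite mulr1 -/vv => h.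
by apply: (addrI (vv 1)); rewrite addr0 -h.
Qed.

Lemma vvalV x : x != 0 -> vv x^-1 = - vv x.
Proof.
move=> x0; apply: (addrI (vv x)); rewrite subrr -vvalM ?invr_eq0 //.
by rewrite divff // -/vv vval1.
Qed.

Lemma vle_addr (x y : vgroup v) : vle 0 x -> vle 0 y -> vle 0 (x + y).
Proof.
move=> x0 y0; apply: (vle_trans y0).
by have := @vle_add _ v y _ _ x0; rewrite add0r.
Qed.

Lemma vle_opp (x : vgroup v) : vle 0 x -> vle (- x) 0.
Proof. by move=> x0; have := @vle_add _ v (- x) _ _ x0; rewrite add0r subrr. Qed.

Lemma vle_oppr (x : vgroup v) : vle x 0 -> vle 0 (- x).
Proof. by move=> x0; have := @vle_add _ v (- x) _ _ x0; rewrite add0r subrr. Qed.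

Lemma vvalN x : x != 0 -> vv (- x) = vv x.
Proof.
have n1 : (-1 : K) != 0 by rewrite oppr_eq0 oner_neq0.
have h : vv (-1) + vv (-1) = 0 by rewrite -vvalM // mulrNN mulr1 -/vv vval1.
have v1 : vv (-1) = 0.
  have e : vv (-1) = - vv (-1) by apply/eqP; rewrite -subr_eq0 opprK h.
  apply: vle_anti; case/orP: (vle_total (vv (-1)) 0) => le; rewrite le ?andbT /=.
    by rewrite e; apply: vle_oppr.
  by rewrite e; apply: vle_opp.
by move=> x0; rewrite -mulN1r /vv vvalM // -/vv v1 add0r.
Qed.

Lemma val_place : nonstandard_model iota v ->
  place iota (val_integral v) (val_infinitesimal v).
Proof.
case=> _ _ triv res.
have O_M x y : val_integral v x -> val_integral v y -> val_integral v (x * y).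
  case=> [->|vx]; first by rewrite mul0r; left.
  case=> [->|vy]; first by rewrite mulr0; left.
  case: (altP (x =P 0)) => [->|x0]; first by rewrite mul0r; left.
  case: (altP (y =P 0)) => [->|y0]; first by rewrite mulr0; left.
  by right; rewrite vvalM //; apply: vle_addr.
split=> //.
- move=> c; case: (altP (c =P 0)) => [->|c0]; first by rewrite rmorph0; left.
  by right; rewrite triv //; apply: vle_refl.
- move=> x y; case=> [->|vx].
    case=> [->|vy]; first by rewrite subrr; left.
    case: (altP (y =P 0)) => [->|y0]; first by rewrite subrr; left.
    by rewrite sub0r; right; rewrite -/vv vvalN.
  case=> [->|vy]; first by rewrite subr0; right.
  case: (altP (x =P 0)) => [->|x0].
    case: (altP (y =P 0)) => [->|y0]; first by rewrite subrr; left.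
    by rewrite sub0r; right; rewrite -/vv vvalN.
  case: (altP (y =P 0)) => [->|y0]; first by rewrite subr0; right.
  case: (altP (x - y =P 0)) => [->|xy0]; first by left.
  have ny0 : - y != 0 by rewrite oppr_eq0.
  right; case/orP: (vvalD v x0 ny0 xy0); first exact: (vle_trans vx).
  by rewrite -/vv vvalN //; apply: (vle_trans vy).
- by move=> x [->|[vx _]]; [left | right].
- move=> x y; case=> [->|[vx nx]].
    case=> [->|[vy ny]]; first by rewrite subrr; left.
    case: (altP (y =P 0)) => [->|y0]; first by rewrite subrr; left.
    by rewrite sub0r; right; rewrite -/vv vvalN.
  case=> [->|[vy ny]]; first by rewrite subr0; right.
  case: (altP (x =P 0)) => [->|x0].
    case: (altP (y =P 0)) => [->|y0]; first by rewrite subrr; left.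
    by rewrite sub0r; right; rewrite -/vv vvalN.
  case: (altP (y =P 0)) => [->|y0]; first by rewrite subr0; right.
  case: (altP (x - y =P 0)) => [->|xy0]; first by left.
  have ny0 : - y != 0 by rewrite oppr_eq0.
  right; case/orP: (vvalD v x0 ny0 xy0) => le.
    split; first exact: (vle_trans vx le).
    by move=> e; apply: nx; apply: vle_anti; rewrite vx -e le.
  rewrite -/vv vvalN // in le.
  split; first exact: (vle_trans vy le).
  by move=> e; apply: ny; apply: vle_anti; rewrite vy -e le.
- move=> x y; case=> [->|vx]; first by rewrite mul0r; left.
  case=> [->|[vy ny]]; first by rewrite mulr0; left.
  case: (altP (x =P 0)) => [->|x0]; first by rewrite mul0r; left.
  case: (altP (y =P 0)) => [->|y0]; first by rewrite mulr0; left.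
  right; rewrite vvalM //; split; first exact: vle_addr.
  move=> e; apply: ny; apply: vle_anti; rewrite vy andbT.
  by have := @vle_add _ v (vval v y) _ _ vx; rewrite add0r e.
- by case=> [/eqP|[_]]; rewrite ?oner_eq0 // -/vv vval1.
- move=> x; case: (altP (x =P 0)) => [->|x0]; first by left; left.
  case: (excluded_middle_informative (vle 0 (vval v x))) => [|nle]; first by left; right.
  right; right; rewrite -/vv vvalV //.
  case/orP: (vle_total (vval v x) 0) => // le; split; first exact: vle_oppr.
  by move/eqP; rewrite oppr_eq0 => /eqP e; apply: nle; rewrite -/vv e; apply: vle_refl.
Qed.

End PlaceOfValuation.

(** * Homogeneous components and varieties of points *)

Section Graded.
Variables (N : nat) (G : finType) (w : 'I_N -> G) (L : closedFieldType).
Local Notation poly := {mpoly L[N]}.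
Implicit Types (p : poly) (d : G -> nat).

Definition deg_mnm (d : G -> nat) : 'X_{1..#|G|} :=
  [multinom d (enum_val i) | i < #|G|].

Lemma deg_mnm_onto (k : 'X_{1..#|G|}) : deg_mnm (fun g => k (enum_rank g)) = k.
Proof. by apply/mnmP => i; rewrite mnmE enum_valK. Qed.

Lemma deg_mnm_eq (d d' : G -> nat) :
  (deg_mnm d == deg_mnm d') = [forall g, d g == d' g].
Proof.
apply/eqP/forallP => [e g|e].
  by have /mnmP/(_ (enum_rank g)) := e; rewrite !mnmE enum_rankK => ->.
by apply/mnmP => i; rewrite !mnmE; apply/eqP.
Qed.

Section Eval.
Variables (S : comNzRingType) (iota : {rmorphism L -> S}) (z : 'I_N -> S).

(** Evaluation at the point [s z], for independent scalars [s_g] on the blocks: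
    its coefficients are the values at [z] of the homogeneous components. *)
Definition grev : poly -> {mpoly S[#|G|]} :=
  mmap (@mpolyC #|G| S \o iota) (fun i => z i *: 'X_(enum_rank (w i))).

Lemma grev_mnm m :
  grev 'X_[m] = mmap1 z m *: 'X_[deg_mnm (mnm_multideg w m)].
Proof.
rewrite /grev mmapX /mmap1.
under eq_bigr do rewrite exprZn.
rewrite scaler_prod; congr (_ *: _).
rewrite [RHS]mpolyXE_id.
transitivity (\prod_(g : G) 'X_(enum_rank g) ^+ mnm_multideg w m g : {mpoly S[#|G|]}).
  rewrite (partition_big w predT) //=; apply: eq_bigr => g _.
  rewrite /mnm_multideg; under eq_bigr => i /eqP-> do [].
  by rewrite prodrXr.
rewrite (reindex (@enum_val G predT)) /=; last first.
  by exists enum_rank => i _; rewrite ?enum_rankK ?enum_valK.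
by apply: eq_bigr => i _; rewrite enum_valK mnmE.
Qed.

Lemma grevE p : grev p = \sum_(m <- msupp p)
  (iota p@_m * mmap1 z m) *: 'X_[deg_mnm (mnm_multideg w m)].
Proof.
rewrite {1}[p]mpolyE /grev raddf_sum /=; apply: eq_bigr => m _.
by rewrite mmapZ -[mmap _ _ 'X_[m]]/(grev _) grev_mnm /= mul_mpolyC scalerA.
Qed.

Lemma grev_coef p d :
  (grev p)@_(deg_mnm d) = mmap iota z (homog_component w d p).
Proof.
rewrite grevE raddf_sum /homog_component raddf_sum /= [RHS]big_mkcond /=.
apply: eq_bigr => m _; rewrite mcoeffZ mcoeffX deg_mnm_eq.
by case: ifP; rewrite ?mulr1 ?mulr0 // mmapZ mmapX.
Qed.

Lemma grev_homog d p : multihomog w d p ->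
  grev p = mmap iota z p *: 'X_[deg_mnm d].
Proof.
move=> hd; rewrite grevE {3}[p]mpolyE raddf_sum /= scaler_suml.
rewrite big_seq [RHS]big_seq; apply: eq_bigr => m m_p.
rewrite mmapZ mmapX; congr (_ *: 'X_[_]); apply/eqP; rewrite deg_mnm_eq.
by apply/forallP => g; rewrite hd.
Qed.

Lemma grev_scale (c : G -> S) p :
  (grev p).@[fun k => c (enum_val k)] = mmap iota (fun i => c (w i) * z i) p.
Proof.
rewrite grevE raddf_sum /=.
rewrite [in RHS](mpolyE p) raddf_sum /=; apply: eq_bigr => m _.
rewrite mevalZ mevalX mmapZ mmapX -mulrA; congr (_ * _).
rewrite /mmap1; under [RHS]eq_bigr do rewrite exprMn.
rewrite big_split /= mulrC; congr (_ * _).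
transitivity (\prod_(g : G) c g ^+ mnm_multideg w m g).
  rewrite [RHS](reindex (@enum_val G predT)) /=; last first.
    by exists enum_rank => i _; rewrite ?enum_rankK ?enum_valK.
  by apply: eq_bigr => i _; rewrite mnmE.
rewrite [RHS](partition_big w predT) //=; apply: eq_bigr => g _.
under [RHS]eq_bigr => i /eqP-> do [].
by rewrite prodrXr.
Qed.

Lemma homog_scale d (c : G -> S) p : multihomog w d p ->
  mmap iota (fun i => c (w i) * z i) p = (\prod_g c g ^+ d g) * mmap iota z p.
Proof.
move=> hp; rewrite -grev_scale (grev_homog hp) mevalZ mevalX mulrC; congr (_ * _).
rewrite [RHS](reindex (@enum_val G predT)) /=; last first.
  by exists enum_rank => i _; rewrite ?enum_rankK ?enum_valK.
by apply: eq_bigr => i _; rewrite mnmE.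
Qed.

End Eval.

Lemma eq_ev (S : comNzRingType) (iota iota' : L -> S) (z z' : 'I_N -> S) p :
  iota =1 iota' -> z =1 z' -> mmap iota z p = mmap iota' z' p.
Proof.
move=> ei ez; rewrite /mmap; apply: eq_bigr => m _.
by rewrite ei /mmap1; congr (_ * _); apply: eq_bigr => i _; rewrite ez.
Qed.

Lemma mcoeff_homog_component d p m : (homog_component w d p)@_m =
  if [forall g, mnm_multideg w m g == d g] then p@_m else 0.
Proof.
rewrite /homog_component raddf_sum /= big_mkcond /=.
under eq_bigr => k _ do rewrite mcoeffZ mcoeffX.
case: (boolP (m \in msupp p)) => m_p.
  rewrite (bigD1_seq m) ?msupp_uniq //= eqxx mulr1 big1 ?addr0 //.
  by move=> k /negPf ->; rewrite mulr0 if_same.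
rewrite big_seq big1 ?(memN_msupp_eq0 m_p) ?if_same // => k k_p.
case: ifP => // _; case: eqP => [e|]; rewrite ?mulr0 //.
by move: k_p; rewrite e (negPf m_p).
Qed.

Lemma homog_component_id d p : multihomog w d p -> homog_component w d p = p.
Proof.
move=> hp; apply/mpolyP => m; rewrite mcoeff_homog_component.
case: ifP => // /negP h; case: (boolP (m \in msupp p)) => [/hp m_p|/memN_msupp_eq0 -> //].
by case: h; apply/forallP => g; rewrite m_p.
Qed.

Lemma homog_component_homog d p : multihomog w d (homog_component w d p).
Proof.
move=> m; rewrite mcoeff_msupp mcoeff_homog_component.
by case: ifP => [/forallP h _ g|]; [apply/eqP | rewrite eqxx].
Qed.

Lemma homog_component2 d d' p : homog_component w d' (homog_component w d p) =
  if [forall g, d g == d' g] then homog_component w d p else 0.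
Proof.
apply/mpolyP => m; rewrite mcoeff_homog_component.
case: ifP => [/forallP e'|e'].
  case: ifP => // ne; rewrite mcoeff_homog_component mcoeff0.
  case: ifP => // /forallP e; move/negP: ne; case; apply/forallP => g.
  by rewrite -(eqP (e g)) -(eqP (e' g)).
case: ifP => [/forallP e|]; rewrite ?mcoeff0 // mcoeff_homog_component.
case: ifP => // /forallP e2; move/negP: e'; case; apply/forallP => g.
by rewrite (eqP (e2 g)) (eqP (e g)).
Qed.

End Graded.

(** Prime ideals of subalgebras, given by predicates so as to apply to valuation
    rings without turning these into types. *)
Record prime_of (L S : comNzRingType) (iota : L -> S) (O P : S -> Prop) : Prop :=
  PrimeOf {
  pr_const : forall c, O (iota c);
  prB : forall x y, O x -> O y -> O (x - y);
  prM : forall x y, O x -> O y -> O (x * y);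
  pr_id0 : P 0;
  pr_idD : forall x y, P x -> P y -> P (x + y);
  pr_idM : forall x y, O x -> P y -> P (x * y);
  pr_id1 : ~ P 1;
  pr_prime : forall x y, O x -> O y -> P (x * y) -> P x \/ P y
}.

Lemma zero_prime (L : comNzRingType) (S : idomainType) (iota : {rmorphism L -> S}) :
  prime_of iota (fun=> True) (fun x => x = 0).
Proof.
split=> //; first by move=> x y -> ->; rewrite addr0.
- by move=> x y _ ->; rewrite mulr0.
- by apply/eqP; rewrite oner_eq0.
- by move=> x y _ _ /eqP; rewrite mulf_eq0 => /orP[] /eqP; [left | right].
Qed.

Lemma flat_prime_of (L K : fieldType) (iota : {rmorphism L -> K}) (O M : K -> Prop)
  (pl : place iota O M) (pi : K) (Mpi : M pi) (pi0 : pi != 0) :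
  prime_of iota O (flat O pi).
Proof.
split.
- exact: pl_const pl.
- exact: plB pl.
- exact: plM pl.
- exact: flat0 pl pi.
- by move=> x y fx fy; apply: (flatD pl fx fy).
- by move=> x y Ox fy; apply: (flatM pl Ox fy).
- exact: (flat1 pl Mpi pi0).
- by move=> x y Ox Oy; exact: (flat_prime pl pi0 Ox Oy).
Qed.

Section VarietyOfPoint.
Variables (N : nat) (G : finType) (w : 'I_N -> G) (L : closedFieldType).
Variables (S : comNzRingType) (iota : {rmorphism L -> S}) (O P : S -> Prop).
Hypothesis pr : prime_of iota O P.

Let Oc := pr_const pr.
Let OB := prB pr.
Let OM := prM pr.
Let P0 := pr_id0 pr.
Let PD := pr_idD pr.
Let PM := pr_idM pr.
Let P1 := pr_id1 pr.
Let Pprime := pr_prime pr.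

Let O0 : O 0. Proof. by rewrite -(rmorph0 iota). Qed.
Let O1 : O 1. Proof. by rewrite -(rmorph1 iota). Qed.
Let OD x y : O x -> O y -> O (x + y).
Proof.
move=> Ox Oy; have -> : x + y = x - (0 - y) by rewrite sub0r opprK.
by apply: OB => //; apply: OB.
Qed.

Lemma coef_mulP k (p q : {mpoly S[k]}) :
  (forall m, O p@_m) -> (forall m, P q@_m) -> forall m, P (p * q)@_m.
Proof.
move=> Op Pq m; rewrite mpolyME raddf_sum /=; apply: (big_ind P) => // -[m1 m2] _.
rewrite mcoeffZ mcoeffX /= mulr_natr -mulrnAr; apply: PM => //.
by case: eqP => _; rewrite ?mulr1n ?mulr0n; [apply: Pq | apply: P0].
Qed.

(** Gauss's lemma: discarding the coefficients in [P], the product of the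
    leading coefficients is a coefficient of the product, modulo [P]. *)
Lemma coef_prime k (p q : {mpoly S[k]}) :
  (forall m, O p@_m) -> (forall m, O q@_m) -> (forall m, P (p * q)@_m) ->
  (forall m, P p@_m) \/ (forall m, P q@_m).
Proof.
have split (r : {mpoly S[k]}) : (forall m, O r@_m) ->
    exists r1 r2, [/\ r = r1 + r2, forall m, O r1@_m, forall m, P r2@_m,
      r1 != 0 -> ~ P (mleadc r1) & r1 = 0 -> forall m, P r@_m].
  move=> Or.
  pose b m := if excluded_middle_informative (P r@_m) then true else false.
  have bP m : reflect (P r@_m) (b m).
    by rewrite /b; case: excluded_middle_informative => h; constructor.
  pose r1 := \sum_(m <- msupp r | ~~ b m) r@_m *: 'X_[m].
  have r1E m : r1@_m = if b m then 0 else r@_m.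
    rewrite /r1 raddf_sum /= big_mkcond /=.
    under eq_bigr => j _ do rewrite mcoeffZ mcoeffX.
    case: (boolP (m \in msupp r)) => m_r.
      rewrite (bigD1_seq m) ?msupp_uniq //= eqxx mulr1 big1 ?addr0 ?if_neg //.
      by move=> j /negPf ->; rewrite mulr0 if_same.
    rewrite big_seq big1 ?(memN_msupp_eq0 m_r) ?if_same // => j j_r.
    case: ifP => // _; case: eqP => [e|]; rewrite ?mulr0 //.
    by move: j_r; rewrite e (negPf m_r).
  exists r1, (r - r1); split.
  - by rewrite addrC subrK.
  - by move=> m; rewrite r1E; case: ifP.
  - by move=> m; rewrite mcoeffB r1E; case: bP => Pm; rewrite ?subr0 ?subrr.
  - rewrite -mleadc_eq0 r1E; case: bP => //; by rewrite eqxx.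
  - by move=> r10 m; apply/bP; move/mpolyP/(_ m): r10; rewrite r1E mcoeff0;
      case: bP => // nP e; case: nP; rewrite e.
move=> Op Oq Ppq.
have [p1 [p2 [ep Op1 Pp2 nz_p p10]]] := split p Op.
have [q1 [q2 [eq Oq1 Pq2 nz_q q10]]] := split q Oq.
case: (altP (p1 =P 0)) => [/p10|p1n]; first by left.
case: (altP (q1 =P 0)) => [/q10|q1n]; first by right.
exfalso.
have Pm m : P (p1 * q1)@_m.
  have -> : p1 * q1 = p * q + (- q) * p2 + (- p1) * q2 by rewrite ep eq; ring.
  rewrite !mcoeffD; apply: PD; first apply: PD => //.
    by apply: coef_mulP => // j; rewrite mcoeffN -sub0r; apply: OB.
  by apply: coef_mulP => // j; rewrite mcoeffN -sub0r; apply: OB.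
have := Pm (mlead p1 + mlead q1)%MM; rewrite mleadcM.
by case/Pprime; [| |apply: nz_p|apply: nz_q].
Qed.

(** The Zariski closure of the image of [z] in the residue field of [P].  Its
    ideal is the preimage under [grev] of the polynomials with coefficients in
    [P], which is prime by Gauss's lemma. *)
Lemma variety_of_point (z : 'I_N -> S) :
  (forall i, O (z i)) -> (forall g, exists2 i, w i = g & ~ P (z i)) ->
  exists Y : variety w L, forall p,
    p \in mem_ideal Y <-> forall d, P (mmap iota z (homog_component w d p)).
Proof.
move=> Oz nPz.
have Oev p : O (mmap iota z p).
  rewrite /mmap; apply: (big_ind O) => // m _; apply: OM => //.
  rewrite /mmap1; apply: (big_ind O) => // i _.
  by elim: (m i) => [|k IH]; rewrite ?expr0 // exprS; apply: OM.
have Og p m : O (grev w iota z p)@_m.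
  by rewrite -[m]deg_mnm_onto grev_coef.
pose I p := forall m, P (grev w iota z p)@_m.
pose B p := if excluded_middle_informative (I p) then true else false.
have BP p : reflect (I p) (p \in (B : pred _)).
  by rewrite unfold_in /B; case: excluded_middle_informative => h; constructor.
have idB : idealr_closed (B : {pred {mpoly L[N]}}).
  split.
  - by apply/BP => m; rewrite /grev rmorph0 mcoeff0.
  - apply/BP => h; have := h 0%MM.
    by rewrite /grev rmorph1 mcoeff1 eqxx.
  - move=> a u v /BP Iu /BP Iv; apply/BP => m.
    rewrite /grev rmorphD rmorphM mcoeffD; apply: PD; last exact: Iv.
    by apply: coef_mulP; [apply: Og | apply: Iu].
have prB : prime_idealr_closed (B : {pred {mpoly L[N]}}).
  move=> u v /BP Iuv; apply/orP.
  have := @coef_prime _ (grev w iota z u) (grev w iota z v) (Og u) (Og v).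
  case; first by move=> m; have := Iuv m; rewrite /grev rmorphM.
    by move=> Iu; left; apply/BP.
  by move=> Iv; right; apply/BP.
pose J : prime_idealr {mpoly L[N]} := HB.pack_for (prime_idealr {mpoly L[N]}) B
  (isIdealr.Build {mpoly L[N]} B idB) (isPrimeIdealrClosed.Build {mpoly L[N]} B prB).
have mJ p : p \in (J : pred _) <-> forall d, P (mmap iota z (homog_component w d p)).
  split => [/BP h d|h]; first by rewrite -grev_coef.
  by apply/BP => m; rewrite -[m]deg_mnm_onto grev_coef.
have JH p d : p \in (J : pred _) -> homog_component w d p \in (J : pred _).
  move/mJ => h; apply/mJ => d'; rewrite homog_component2.
  by case: ifP => // _; rewrite rmorph0.
have JR g : exists2 i, w i = g & 'X_i \notin (J : pred {mpoly L[N]}).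
  have [i wi nPi] := nPz g; exists i => //; apply/negP => /BP h; apply: nPi.
  by have := h (deg_mnm (mnm_multideg w U_(i))); rewrite grev_mnm mcoeffZ mcoeffX eqxx mulr1 mmap1U.
by exists (Variety JH JR) => p; apply: mJ.
Qed.

End VarietyOfPoint.

Lemma mem_variety_of_homog (N : nat) (G : finType) (w : 'I_N -> G)
  (L : closedFieldType) (X : variety w L) p :
  p \in mem_ideal X <-> forall d, homog_component w d p \in mem_ideal X.
Proof.
split=> [pX d|h]; first exact: videalH.
pose T := {ffun 'I_(#|G|) -> 'I_(msize p)}.
pose dg (t : T) := fun g : G => val (t (enum_rank g)).
suff -> : p = \sum_(t : T) homog_component w (dg t) p by apply: rpred_sum => t _.
apply/mpolyP => m; rewrite raddf_sum /=.
under eq_bigr => t _ do rewrite mcoeff_homog_component.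
case: (boolP (m \in msupp p)) => [m_p|/memN_msupp_eq0 ->]; last first.
  by rewrite big1 // => t _; rewrite if_same.
have ltm g : (mnm_multideg w m g < msize p)%N.
  apply: leq_ltn_trans (msize_mdeg_lt m_p).
  rewrite mdegE /mnm_multideg [leqRHS](bigID (fun i => w i == g)) /=.
  exact: leq_addr.
pose t0 : T := [ffun k => Ordinal (ltm (enum_val k))].
rewrite (bigD1 t0) //= ifT; last first.
  by apply/forallP => g; rewrite /dg ffunE /= enum_rankK.
rewrite big1 ?addr0 // => t nt; case: ifP => // /forallP e.
case/eqP: nt; apply/ffunP => k; apply: val_inj; rewrite ffunE /=.
by have /eqP := e (enum_val k); rewrite /dg enum_valK.
Qed.

(** The homogeneous equations satisfied by [z] modulo [P] define a subvariety of
    [X] that contains [a] and is larger than [a]: it is [X], since a curve has no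
    chain of three subvarieties. *)
Lemma curve_point_generic (N : nat) (G : finType) (w : 'I_N -> G)
  (L : closedFieldType) (S : comNzRingType) (iota : {rmorphism L -> S})
  (O P : S -> Prop) (X : variety w L) (z : 'I_N -> S) (a : 'rV[L]_N) :
  prime_of iota O P ->
  curve X -> (forall i, O (z i)) ->
  (forall g, exists2 i, w i = g & ~ P (z i)) ->
  (forall p d, multihomog w d p -> p \in mem_ideal X -> P (mmap iota z p)) ->
  block_nonzero w a ->
  (forall p d, multihomog w d p -> P (mmap iota z p) -> p.@[a 0] = 0) ->
  (exists d p0, [/\ multihomog w d p0, p0.@[a 0] = 0 & ~ P (mmap iota z p0)]) ->
  forall p d, multihomog w d p -> P (mmap iota z p) -> p \in mem_ideal X.
Proof.
move=> pr [_ dimX] Oz nPz XP a_nz Pa [d0 [p0 [hp0 p0a nPp0]]] p d hp Pp.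
have [Y memY] := variety_of_point pr Oz nPz.
have [Z memZ] : exists Z : variety w L, forall q,
    q \in mem_ideal Z <-> forall e, (homog_component w e q).@[a 0] = 0.
  apply: (variety_of_point (zero_prime idfun)) => // g.
  by have [i wi /eqP ai] := a_nz g; exists i.
have homogP (q : {mpoly L[N]}) e e' : multihomog w e q ->
    homog_component w e' q = q \/ homog_component w e' q = 0.
  move=> hq; rewrite -(homog_component_id hq) homog_component2.
  by case: ifP => _; [left | right].
apply/idP/negPn/negP => pX.
suff : (2 <= 1)%N by [].
apply: (dimX 2 (fun k => if k is k'.+1 then if k' is 0 then Y else Z else X)).
split=> // -[|[|i]] // _; split.
- move=> q qX; apply/memY => e; apply: (XP _ e); first exact: homog_component_homog.
  exact: videalH.
- exists p => //; apply/memY => e.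
  by case: (homogP p d e hp) => ->; rewrite ?rmorph0 //; apply: pr_id0 pr.
- move=> q /memY qY; apply/memZ => e; apply: (Pa _ e) => //.
  exact: homog_component_homog.
- exists p0; first by apply/memZ => e; case: (homogP p0 d0 e hp0) => ->; rewrite ?rmorph0.
  by apply/negP => /memY /(_ d0); rewrite homog_component_id.
Qed.

(** * Affine charts of multiprojective varieties *)

Section Charts.
Variables (N : nat) (G : finType) (w : 'I_N -> G) (L : closedFieldType).
Local Notation poly := {mpoly L[N]}.
Implicit Types (p q : poly) (d : G -> nat).

Lemma multihomogM d e p q : multihomog w d p -> multihomog w e q ->
  multihomog w (fun g => d g + e g)%N (p * q).
Proof.
move=> hp hq m /msuppM_le/allpairsP[[m1 m2] /= [m1p m2q ->]] g.
rewrite -(hp _ m1p) -(hq _ m2q) /mnm_multideg -big_split /=.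
by apply: eq_bigr => i _; rewrite mnmDE.
Qed.

Lemma multihomog1 : multihomog w (fun=> 0%N) (1 : poly).
Proof.
move=> m; rewrite msupp1 inE => /eqP-> g.
by rewrite /mnm_multideg big1 // => i _; rewrite mnm0E.
Qed.

Lemma multihomogX d p k : multihomog w d p ->
  multihomog w (fun g => k * d g)%N (p ^+ k).
Proof.
move=> hp; elim: k => [|k IH]; first exact: multihomog1.
by rewrite exprS => m /(multihomogM hp IH) h g; rewrite h mulSn.
Qed.

Lemma multihomogZ d c p : multihomog w d p -> multihomog w d (c *: p).
Proof. by move=> hp m /msuppZ_le /hp. Qed.

Lemma multihomog_sum d (I : Type) (r : seq I) (P : pred I) (F : I -> poly) :
  (forall i, P i -> multihomog w d (F i)) ->
  multihomog w d (\sum_(i <- r | P i) F i).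
Proof.
move=> hF; apply: (big_ind (multihomog w d)) => //; first by move=> m; rewrite msupp0.
by move=> p q hp hq m /msuppD_le; rewrite mem_cat => /orP[/hp|/hq].
Qed.

Lemma multihomog_mnm m : multihomog w (mnm_multideg w m) ('X_[m] : poly).
Proof. by move=> k; rewrite msuppX inE => /eqP->. Qed.

Lemma multihomog_prod (I : Type) (r : seq I) (d : I -> G -> nat) (F : I -> poly) :
  (forall i, multihomog w (d i) (F i)) ->
  multihomog w (fun g => \sum_(i <- r) d i g)%N (\prod_(i <- r) F i).
Proof.
move=> hF; elim: r => [|i r IH].
  by move=> m; rewrite big_nil => /multihomog1 h g; rewrite big_nil h.
by move=> m; rewrite big_cons => /(multihomogM (hF i) IH) h g; rewrite big_cons h.
Qed.

Lemma multihomog_eq d e p : d =1 e -> multihomog w d p -> multihomog w e p.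
Proof. by move=> de hp m m_p g; rewrite hp. Qed.

Lemma multideg1 i g : mnm_multideg w U_(i) g = (w i == g).
Proof.
rewrite /mnm_multideg big_mkcond (bigD1 i) //= big1 ?addn0 ?mnm1E ?eqxx; first by case: eqP.
by move=> j /negPf nji; rewrite mnm1E (eq_sym i) nji if_same.
Qed.

(** The hyperplanes at infinity of a chart, one per block of coordinates. *)
Definition ell (lam : 'I_N -> L) (g : G) : poly :=
  \sum_(i | w i == g) lam i *: 'X_i.

Lemma multihomog_ell lam g : multihomog w (fun g' => g == g' : nat) (ell lam g).
Proof.
apply: multihomog_sum => i /eqP wi; apply: multihomogZ.
apply: multihomog_eq (@multihomog_mnm U_(i)) => g'.
by rewrite multideg1 wi.
Qed.

(** [z] represents a point of the chart by its affine coordinates. *)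
Definition normalised (S : comNzRingType) (iota : L -> S) (lam : 'I_N -> L)
    (z : 'I_N -> S) :=
  forall g, \sum_(i | w i == g) iota (lam i) * z i = 1.

Lemma ev_ell (S : comNzRingType) (iota : {rmorphism L -> S}) z lam g :
  mmap iota z (ell lam g) = \sum_(i | w i == g) iota (lam i) * z i.
Proof.
rewrite /ell raddf_sum /=; apply: eq_bigr => i _.
by rewrite mmapZ mmapX mmap1U.
Qed.

(** Complete the degree of each monomial with the equations of the hyperplanes at
    infinity, which take the value [1] on normalised coordinates. *)
Lemma homogenise lam p : exists D0, forall D, (D0 <= D)%N ->
  exists2 P, multihomog w (fun=> D) P &
  forall (S : comNzRingType) (iota : {rmorphism L -> S}) (z : 'I_N -> S),
    normalised iota lam z -> mmap iota z P = mmap iota z p.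
Proof.
exists (msize p) => D leD.
exists (\sum_(m <- msupp p) p@_m *:
    ('X_[m] * \prod_g ell lam g ^+ (D - mnm_multideg w m g))).
  rewrite big_seq; apply: multihomog_sum => m m_p; apply: multihomogZ.
  have hm := multihomogM (@multihomog_mnm m)
    (multihomog_prod (r := index_enum G) (fun g => multihomogX (k := (D - mnm_multideg w m g)%N)
      (@multihomog_ell lam g))).
  apply: (multihomog_eq _ hm) => g.
  rewrite /= (bigD1 g) //= eqxx muln1 big1 ?addn0.
    rewrite subnKC // (leq_trans _ leD) // ltnW //.
    apply: leq_ltn_trans (msize_mdeg_lt m_p).
    rewrite mdegE /mnm_multideg [leqRHS](bigID (fun i => w i == g)) /=.
    exact: leq_addr.
  by move=> g' /negPf ->; rewrite muln0.
move=> S iota z nz; rewrite raddf_sum /= [in RHS](mpolyE p) raddf_sum /=.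
apply: eq_bigr => m _; rewrite !mmapZ rmorphM rmorph_prod /= big1 ?mulr1 //.
by move=> g _; rewrite rmorphXn /= ev_ell nz expr1n.
Qed.

Section Cone.
Variable X : variety w L.

Lemma cone_class_zmod : zmod_morphism (cone_class X).
Proof. by move=> p q; rewrite /cone_class -rmorphB -rmorphB. Qed.

Lemma cone_class_monoid : monoid_morphism (cone_class X).
Proof.
split=> [|p q]; first by rewrite /cone_class rmorph1 -[RHS](rmorph1 (@FracField.tofrac _)).
by rewrite /cone_class -rmorphM -rmorphM.
Qed.

HB.instance Definition _ :=
  GRing.isZmodMorphism.Build poly (cone_field X) (cone_class X) cone_class_zmod.
HB.instance Definition _ :=
  GRing.isMonoidMorphism.Build poly (cone_field X) (cone_class X) cone_class_monoid.

Definition cone_const (c : L) : cone_field X := cone_class X c%:MP.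

HB.instance Definition _ :=
  GRing.RMorphism.copy cone_const (cone_class X \o @mpolyC N L).

Lemma cone_classCM c p : cone_class X (c%:MP * p) = cone_const c * cone_class X p.
Proof. by rewrite rmorphM. Qed.

Lemma cone_class_eq0 p : (cone_class X p == 0) = (p \in mem_ideal X).
Proof.
rewrite /cone_class tofrac_eq0.
rewrite -[p in RHS]subr0 [RHS]Quotient.idealrBE rmorph0.
by [].
Qed.

Lemma cone_classE p : cone_class X p = mmap cone_const (fun i => cone_class X 'X_i) p.
Proof.
rewrite {1}[p]mpolyE rmorph_sum /mmap; apply: eq_bigr => m _.
rewrite -mul_mpolyC rmorphM; congr (_ * _).
rewrite mpolyXE_id rmorph_prod /mmap1; apply: eq_bigr => i _.
by rewrite rmorphXn.
Qed.

(** The generic point of [X], in affine coordinates. *)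
Definition chart (lam : 'I_N -> L) (i : 'I_N) : cone_field X :=
  cone_class X 'X_i / cone_class X (ell lam (w i)).

Variable lam : 'I_N -> L.
Hypothesis lamX : forall g, ell lam g \notin mem_ideal X.
Local Notation eta := (chart lam).

Lemma cone_ell_neq0 g : cone_class X (ell lam g) != 0.
Proof. by rewrite cone_class_eq0. Qed.

Lemma chart_normalised : normalised cone_const lam eta.
Proof.
move=> g; apply: (mulIf (cone_ell_neq0 g)); rewrite mul1r mulr_suml.
rewrite [RHS]cone_classE ev_ell; apply: eq_bigr => i /eqP wi.
by rewrite /chart wi -mulrA divfK // cone_ell_neq0.
Qed.

Lemma cone_class_chart d p : multihomog w d p ->
  cone_class X p = (\prod_g cone_class X (ell lam g) ^+ d g) * mmap cone_const eta p.
Proof.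
move=> hp; rewrite -(homog_scale cone_const eta (fun g => cone_class X (ell lam g)) hp).
rewrite cone_classE; apply: eq_ev => // i.
by rewrite /chart mulrC divfK // cone_ell_neq0.
Qed.

Lemma cone_prod_neq0 d : \prod_g cone_class X (ell lam g) ^+ d g != 0.
Proof. by apply/prodf_neq0 => g _; rewrite expf_neq0 // cone_ell_neq0. Qed.

Lemma chart_homog_eq0 d p : multihomog w d p ->
  (mmap cone_const eta p == 0) = (p \in mem_ideal X).
Proof.
move=> hp; rewrite -cone_class_eq0 (cone_class_chart hp) mulf_eq0.
by rewrite (negPf (cone_prod_neq0 d)).
Qed.

Lemma chart_ratio d p q : multihomog w d p -> multihomog w d q ->
  cone_class X p / cone_class X q = mmap cone_const eta p / mmap cone_const eta q.
Proof.
move=> hp hq; rewrite (cone_class_chart hp) (cone_class_chart hq) -mulf_div.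
by rewrite divff ?mul1r // cone_prod_neq0.
Qed.

Lemma chart_ideal p : p \in mem_ideal X -> mmap cone_const eta p = 0.
Proof.
move=> /mem_variety_of_homog pX.
have h d : mmap cone_const eta (homog_component w d p) = 0.
  by apply/eqP; rewrite (chart_homog_eq0 (@homog_component_homog _ _ w L d p)).
have g0 : grev w cone_const eta p = 0.
  by apply/mpolyP => m; rewrite mcoeff0 -[m]deg_mnm_onto grev_coef h.
have -> : mmap cone_const eta p = mmap cone_const (fun i => 1 * eta i) p.
  by apply: eq_ev => // i; rewrite mul1r.
by rewrite -(grev_scale w cone_const eta (fun=> 1)) g0 meval0.
Qed.

(** A relation between the affine coordinates of the generic point becomes, once
    homogenised, an equation of [X]. *)
Lemma chart_specialise (S : comNzRingType) (iota : {rmorphism L -> S}) z p :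
  normalised iota lam z -> (forall q, q \in mem_ideal X -> mmap iota z q = 0) ->
  mmap cone_const eta p = 0 -> mmap iota z p = 0.
Proof.
move=> nz zX p0; have [D0 /(_ D0 (leqnn _)) [P hP eP]] := homogenise lam p.
rewrite -(eP _ _ _ nz); apply: zX; rewrite -(chart_homog_eq0 hP).
by rewrite (eP _ _ _ chart_normalised) p0.
Qed.

Lemma common_homogenise p q : exists D P Q, [/\ multihomog w (fun=> D) P,
  multihomog w (fun=> D) Q,
  forall (S : comNzRingType) (iota : {rmorphism L -> S}) z,
    normalised iota lam z -> mmap iota z P = mmap iota z p &
  forall (S : comNzRingType) (iota : {rmorphism L -> S}) z,
    normalised iota lam z -> mmap iota z Q = mmap iota z q].
Proof.
have [D1 h1] := homogenise lam p; have [D2 h2] := homogenise lam q.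
have [P hP eP] := h1 _ (leq_maxl D1 D2); have [Q hQ eQ] := h2 _ (leq_maxr D1 D2).
by exists (maxn D1 D2), P, Q.
Qed.

Lemma rational_chart f : rational_function f <->
  exists p q, mmap cone_const eta q != 0 /\ f = mmap cone_const eta p / mmap cone_const eta q.
Proof.
split=> [[d [g [h [hg hh nh ->]]]]|[p [q [nq ->]]]].
  by exists g, h; rewrite (chart_homog_eq0 hh) (chart_ratio hg hh).
have [D [P [Q [hP hQ eP eQ]]]] := common_homogenise p q.
exists (fun=> D), P, Q; split=> //.
  by rewrite -(chart_homog_eq0 hQ) eQ //; apply: chart_normalised.
by rewrite (chart_ratio hP hQ) eP ?eQ //; apply: chart_normalised.
Qed.

Lemma has_value_chart (z : 'rV[L]_N) f c : normalised idfun lam (z 0) ->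
  has_value z f c <-> exists p q, [/\ q.@[z 0] != 0,
    f = mmap cone_const eta p / mmap cone_const eta q & c = p.@[z 0] / q.@[z 0]].
Proof.
move=> nz; split=> [[d [g [h [hg hh nh -> ->]]]]|[p [q [nq -> ->]]]].
  by exists g, h; rewrite (chart_ratio hg hh).
have [D [P [Q [hP hQ eP eQ]]]] := common_homogenise p q.
have zP : P.@[z 0] = p.@[z 0] := eP _ idfun _ nz.
have zQ : Q.@[z 0] = q.@[z 0] := eQ _ idfun _ nz.
exists (fun=> D), P, Q; rewrite zP zQ (chart_ratio hP hQ) !(eP, eQ) //; exact: chart_normalised.
Qed.

End Cone.
End Charts.

(** * Uniformisers from the Jacobian criterion *)

Lemma ev_morph (N : nat) (L S T : comNzRingType) (iota : {rmorphism L -> S})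
    (f : {rmorphism S -> T}) (z : 'I_N -> S) p :
  f (mmap iota z p) = mmap (f \o iota) (f \o z) p.
Proof.
rewrite /mmap rmorph_sum; apply: eq_bigr => m _; rewrite rmorphM /mmap1 rmorph_prod.
by congr (_ * _); apply: eq_bigr => i _; rewrite rmorphXn.
Qed.

Lemma taylor1 (N : nat) (L : comNzRingType) (z : 'I_N -> L) (p : {mpoly L[N]}) :
  exists2 h : 'I_N -> {mpoly L[N]},
    forall l, (h l).@[z] = (p^`M(l)).@[z] &
    p = (p.@[z])%:MP + \sum_l h l * ('X_l - (z l)%:MP).
Proof.
pose T (p : {mpoly L[N]}) := exists2 h : 'I_N -> {mpoly L[N]},
    forall l, (h l).@[z] = (p^`M(l)).@[z] &
    p = (p.@[z])%:MP + \sum_l h l * ('X_l - (z l)%:MP).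
have TC c : T c%:MP.
  exists (fun=> 0) => [l|]; first by rewrite mderivC.
  by rewrite mevalC big1 ?addr0 // => l _; rewrite mul0r.
have TX i : T 'X_i.
  exists (fun l => (l == i)%:R) => [l|].
    rewrite mderivX mnm1E eq_sym; case: eqP => [->|_]; last by rewrite scale0r !meval0.
    have -> : (U_(l) - U_(l))%MM = 0%MM :> 'X_{1..N}.
      by apply/mnmP => j; rewrite mnmBE subnn mnm0E.
    by rewrite mpolyX0 scale1r.
  rewrite mevalXU (bigD1 i) //= eqxx mul1r big1 ?addr0 ?(addrC (_%:MP)) ?subrK //.
  by move=> l /negPf ->; rewrite mul0r.
have TD q r : T q -> T r -> T (q + r).
  case=> [h hv eq] [k kv er]; exists (fun l => h l + k l) => [l|].
    by rewrite mevalD hv kv mderivD mevalD.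
  under eq_bigr do rewrite mulrDl.
  by rewrite big_split /= {1}eq {1}er mevalD mpolyCD addrACA.
have TM q r : T q -> T r -> T (q * r).
  case=> [h hv eq] [k kv er].
  exists (fun l => (q.@[z])%:MP * k l + h l * r) => [l|].
    by rewrite mevalD !mevalM mevalC hv kv mderivM mevalD !mevalM addrC.
  under eq_bigr do rewrite mulrDl -mulrA [h _ * r * _]mulrAC.
  rewrite big_split /= -mulr_sumr -mulr_suml {1}eq mulrDl addrA; congr (_ + _).
  by rewrite {1}er mulrDr mevalM mpolyCM.
rewrite -/(T p) [p]mpolyE; apply: (big_ind T) => [|q r|m _]; [by rewrite -mpolyC0 | exact: TD |].
rewrite -mul_mpolyC; apply: (TM _ _ (TC _)).
rewrite mpolyXE_id; apply: (big_ind T) => [|q r|i _]; [by rewrite -mpolyC1 | exact: TM |].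
elim: (m i) => [|k IH]; first by rewrite expr0 -mpolyC1.
by rewrite exprS; apply: (TM _ _ (TX i)).
Qed.

(** [kappa] is an equation of the hyperplane spanned by the rows of [W]. *)
Lemma corank1_covectors (L : fieldType) (r N : nat) (W : 'M[L]_(r, N)) :
  (0 < N)%N -> (N <= (\rank W).+1)%N ->
  exists2 kappa : 'cV[L]_N, kappa != 0 &
  forall alpha : 'rV[L]_N, alpha *m kappa != 0 ->
  forall c : 'rV[L]_N, exists beta, (c - beta *: alpha <= W)%MS.
Proof.
move=> N0 rkW; case: (altP (cokermx W =P 0)) => [C0|/matrix0Pn[i [j Cij]]].
  exists (const_mx 1); last by move=> alpha _ c; exists 0; rewrite submxE C0 mulmx0.
  apply/matrix0Pn; exists (Ordinal N0), 0; rewrite mxE; exact: oner_neq0.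
exists (col j (cokermx W)).
  by apply/matrix0Pn; exists i, 0; rewrite mxE.
move=> alpha nz c.
have naW : ~~ (alpha <= W)%MS.
  apply: contra nz; rewrite submxE => /eqP aC.
  by rewrite colE mulmxA aC mul0mx.
have lt : (W < W + alpha)%MS by rewrite ltmxE addsmxSl addsmx_sub submx_refl.
have full : row_full (W + alpha)%MS.
  rewrite /row_full eqn_leq rank_leq_col /=.
  exact: leq_trans rkW (rank_ltmx lt).
have /sub_addsmxP[[u v] /= ->] : (c <= W + alpha)%MS by apply: submx_full.
exists (v 0 0); rewrite [v]mx11_scalar mul_scalar_mx mxE eqxx mulr1n addrK.
exact: submxMl.
Qed.

Section Uniformiser.
Variables (N : nat) (G : finType) (w : 'I_N -> G) (L : closedFieldType).
Variables (X : variety w L) (z : 'rV[L]_N) (lam : 'I_N -> L).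
Hypotheses (zX : on_variety X z) (nz : normalised w idfun lam (z 0)).

Lemma chart_defined g : ell w lam g \notin mem_ideal X.
Proof.
apply/negP => /(zX.2); rewrite -[meval _ _]/(mmap idfun (z 0) _) ev_ell nz => /eqP.
by rewrite oner_eq0.
Qed.

Lemma point_ideal p : p \in mem_ideal X ->
  grev w (@polyC L) (fun i => (z 0 i)%:P) p = 0.
Proof.
move=> pX; apply/mpolyP => m; rewrite mcoeff0 -[m]deg_mnm_onto grev_coef.
rewrite -(@ev_morph _ _ _ _ idfun (@polyC L) (z 0)) /=.
by rewrite (_ : mmap _ _ _ = 0) ?polyC0 //; apply: zX.2; apply: videalH.
Qed.

(** Euler's relation: differentiate [p] along the rescaling of block [g]. *)
Lemma euler g p : p \in mem_ideal X ->
  \sum_(i | w i == g) (p^`M(i)).@[z 0] * z 0 i = 0.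
Proof.
move=> pX; have [h hv ep] := taylor1 (z 0) p.
pose c g' : {poly L} := if g' == g then 'X else 1.
pose zeta i := c (w i) * (z 0 i)%:P.
have z1 (q : {mpoly L[N]}) : (mmap (@polyC L) zeta q).[1] = q.@[z 0].
  rewrite -/(horner_eval 1 _) ev_morph; apply: eq_ev => [x|i] /=.
    by rewrite /horner_eval hornerC.
  by rewrite /horner_eval hornerM hornerC /c; case: ifP; rewrite ?hornerX ?hornerC mul1r.
have := congr1 (mmap (@polyC L) zeta) ep.
rewrite {1}/zeta -grev_scale (point_ideal pX) meval0 (zX.2 _ pX) mpolyC0 add0r.
rewrite raddf_sum (bigID (fun i => w i == g)) /= [X in _ + X]big1 ?addr0; last first.
  move=> i /negPf wi; rewrite rmorphM rmorphB /= mmapX mmap1U mmapC.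
  by rewrite /zeta /c wi mul1r subrr mulr0.
have fac i : w i == g -> mmap (@polyC L) zeta (h i * ('X_i - (z 0 i)%:MP)) =
    mmap (@polyC L) zeta (h i) * (z 0 i)%:P * ('X - 1).
  move=> wi; rewrite rmorphM rmorphB /= mmapX mmap1U mmapC -mulrA; congr (_ * _).
  by rewrite /zeta /c wi; ring.
under eq_bigr => i wi do rewrite (fac i wi).
rewrite -mulr_suml => /esym/eqP; rewrite mulf_eq0 -polyC1 polyXsubC_eq0 orbF.
move/eqP/(congr1 (horner_eval 1)); rewrite /horner_eval horner0 horner_sum => e0; rewrite -[RHS]e0.
by apply: eq_bigr => i _; rewrite hornerM hornerC z1 hv.
Qed.

Local Notation ev := (mmap (@cone_const _ _ _ _ X) (chart X lam)).
Local Notation eta := (chart X lam).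
Local Notation K := (@cone_const _ _ _ _ X).

Let gam i := eta i - K (z 0 i).

(** The relations among the differentials of the coordinates at [z]. *)
Let rel (c : 'rV[L]_N) := exists2 M : 'I_N -> {mpoly L[N]},
  forall l, (M l).@[z 0] = 0 &
  \sum_l K (c 0 l) * gam l = \sum_l ev (M l) * gam l.

Lemma rel_sum (I : finType) (F : I -> 'rV[L]_N) (u : I -> L) :
  (forall i, rel (F i)) -> rel (\sum_i u i *: F i).
Proof.
move=> relF; apply: (big_ind rel).
- exists (fun=> 0) => [l|]; first exact: meval0.
  by apply: eq_bigr => l _; rewrite mxE (rmorph0 K) mmap0.
- move=> c d [M Mz eM] [M' Mz' eM']; exists (fun l => M l + M' l) => [l|].
    by rewrite mevalD Mz Mz' addr0.
  under eq_bigr do rewrite mxE rmorphD mulrDl.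
  by rewrite big_split /= eM eM' -big_split; apply: eq_bigr => l _; rewrite rmorphD mulrDl.
- move=> i _; have [M Mz eM] := relF i; exists (fun l => u i *: M l) => [l|].
    by rewrite mevalZ Mz mulr0.
  under eq_bigr do rewrite mxE rmorphM -mulrA.
  rewrite -mulr_sumr eM mulr_sumr; apply: eq_bigr => l _.
  by rewrite mmapZ mulrA.
Qed.

Lemma rel_submx (r : nat) (W : 'M[L]_(r, N)) c :
  (forall i, rel (row i W)) -> (c <= W)%MS -> rel c.
Proof. by move=> relW /submxP[u ->]; rewrite mulmx_sum_row; apply: rel_sum. Qed.

Lemma rel_equation p : p \in mem_ideal X -> rel (\row_l (p^`M(l)).@[z 0]).
Proof.
move=> pX; have [h hv ep] := taylor1 (z 0) p.
exists (fun l => ((p^`M(l)).@[z 0])%:MP - h l) => [l|].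
  by rewrite mevalB mevalC hv subrr.
have := congr1 ev ep; rewrite (chart_ideal chart_defined pX) (zX.2 _ pX) mpolyC0 add0r.
rewrite raddf_sum /= => e0; apply/eqP; rewrite -subr_eq0 -sumrB; apply/eqP.
rewrite [RHS]e0; apply: eq_bigr => l _.
by rewrite mxE !rmorphB rmorphM rmorphB /= !mmapC mmapX mmap1U /gam; ring.
Qed.

Lemma rel_ell g : rel (\row_l (if w l == g then lam l else 0)).
Proof.
exists (fun=> 0) => [l|]; first exact: meval0.
transitivity (\sum_(l | w l == g) K (lam l) * gam l).
  rewrite [RHS]big_mkcond; apply: eq_bigr => l _; rewrite mxE.
  by case: ifP => // _; rewrite rmorph0 mul0r.
rewrite [RHS]big1 => [|l _]; last by rewrite mmap0 mul0r.
under eq_bigr do rewrite mulrBr -rmorphM.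
by rewrite sumrB (chart_normalised chart_defined) -rmorph_sum nz rmorph1 subrr.
Qed.

Hypotheses (Xcurve : curve X) (Xsmooth : smooth X) (N0 : (0 < N)%N).

(** Euler's relations say that the gradients of the equations of [X] vanish on the
    radial vectors of the blocks, whereas the equations of the hyperplanes at
    infinity form a dual family to these vectors.  Adding the latter to the
    Jacobian matrix thus raises its rank by [#|G|]. *)
Lemma cotangent_rank1 : exists2 kappa : 'cV[L]_N, kappa != 0 &
  forall alpha : 'rV[L]_N, alpha *m kappa != 0 ->
  forall c, exists beta, rel (c - beta *: alpha).
Proof.
have [k [f [genf rkJ]]] := Xsmooth Xcurve zX.
set J := (X in \rank X) in rkJ.
pose La := \matrix_(g < #|G|, l < N) (if w l == enum_val g then lam l else 0).
pose Xi := \matrix_(l < N, g < #|G|) (if w l == enum_val g then z 0 l else 0).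
have fX j : f j \in mem_ideal X.
  apply/genf; exists (fun i => (i == j)%:R).
  by rewrite (bigD1 j) //= eqxx mul1r big1 ?addr0 // => i /negPf ->; rewrite mul0r.
have JXi : J *m Xi = 0.
  apply/matrixP => j g; rewrite !mxE -[RHS](euler (enum_val g) (fX j)) [RHS]big_mkcond.
  by apply: eq_bigr => l _; rewrite !mxE; case: ifP; rewrite ?mulr0.
have LaXi : La *m Xi = 1%:M.
  apply/matrixP => g g'; rewrite !mxE; case: (altP (g =P g')) => [<-|ne].
    rewrite -[RHS](nz (enum_val g)) [RHS]big_mkcond; apply: eq_bigr => l _.
    by rewrite !mxE; case: ifP; rewrite ?mulr0.
  apply: big1 => l _; rewrite !mxE; case: eqP => [->|]; rewrite ?mul0r //.
  by rewrite (inj_eq enum_val_inj) (negPf ne) mulr0.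
have rkLa : \rank La = #|G|.
  apply/eqP; rewrite eqn_leq rank_leq_row /= -[leqLHS](mxrank1 L #|G|) -LaXi.
  exact: mxrankM_maxl.
have cap0 : (J :&: La)%MS = 0.
  apply/eqP; rewrite -submx0; apply/rV_subP => u; rewrite sub_capmx => /andP[/submxP[x ->]].
  case/submxP => y e; have := congr1 (mulmx^~ Xi) e.
  by rewrite -!mulmxA JXi LaXi mulmx0 mulmx1 => y0; rewrite e -y0 mul0mx sub0mx.
have rkW : (N <= (\rank (J + La)%MS).+1)%N.
  by rewrite mxrank_disjoint_sum // rkLa rkJ addnC -addnS -leq_subLR subn1 leqSpred.
have [kap kap0 kapP] := corank1_covectors N0 rkW.
exists kap => // alpha nza c; have [beta sub] := kapP alpha nza c.
exists beta; case/sub_addsmxP: sub => -[u v] /= ->.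
have relJ : rel (u *m J).
  apply: rel_submx (submxMl u J) => j.
  rewrite (_ : row j J = \row_l ((f j)^`M(l)).@[z 0]); first exact: rel_equation.
  by apply/rowP => l; rewrite !mxE.
have relLa : rel (v *m La).
  apply: rel_submx (submxMl v La) => g.
  rewrite (_ : row g La = \row_l (if w l == enum_val g then lam l else 0)); first exact: rel_ell.
  by apply/rowP => l; rewrite !mxE.
have -> : u *m J + v *m La = \sum_(b : bool) 1 *: (if b then u *m J else v *m La).
  by rewrite big_bool /= !scale1r.
by apply: rel_sum => -[].
Qed.

(** A linear form off the hyperplane [kappa] generates the maximal ideal modulo its
    square.  It generates the maximal ideal by Nakayama's lemma, which the
    adjugate of the matrix [A] below makes explicit. *)
Lemma smooth_curve_uniformiser : exists2 kappa : 'cV[L]_N, kappa != 0 &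
  forall alpha : 'rV[L]_N, alpha *m kappa != 0 ->
  exists2 q, q.@[z 0] != 0 & forall p, p.@[z 0] = 0 ->
  exists r, ev q * ev p = ev r * (\sum_i K (alpha 0 i) * (eta i - K (z 0 i))).
Proof.
have [kap kap0 kapP] := cotangent_rank1; exists kap => // alpha nza.
pose theta := \sum_i K (alpha 0 i) * gam i.
have gamE i : exists bM : L * ('I_N -> {mpoly L[N]}),
    (forall l, (bM.2 l).@[z 0] = 0) /\
    gam i = K bM.1 * theta + \sum_l ev (bM.2 l) * gam l.
  have [beta [M Mz eM]] := kapP alpha nza (delta_mx 0 i).
  exists (beta, M); split=> //=; rewrite -eM /theta mulr_sumr -big_split /=.
  rewrite (bigD1 i) //= !mxE !eqxx /= big1 ?addr0.
    by rewrite rmorphB rmorphM rmorph1; ring.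
  by move=> l /negPf nl; rewrite !mxE nl andbF sub0r rmorphN rmorphM; ring.
pose bM i := proj1_sig (constructive_indefinite_description _ (gamE i)).
have bMz i l : ((bM i).2 l).@[z 0] = 0.
  by rewrite /bM; case: constructive_indefinite_description => ? [].
have bME i : gam i = K (bM i).1 * theta + \sum_l ev ((bM i).2 l) * gam l.
  by rewrite /bM; case: constructive_indefinite_description => ? [].
(* [A] is invertible at [z], and [A * gam] is a multiple of [theta] *)
pose A : 'M[{mpoly L[N]}]_N := 1%:M - \matrix_(i, l) (bM i).2 l.
pose gc : 'cV_N := \col_i gam i.
have Agc : map_mx ev A *m gc = theta *: \col_i K (bM i).1.
  apply/colP => i; rewrite !mxE.
  under eq_bigr => l _ do rewrite !mxE rmorphB rmorphMn rmorph1 mulrBl.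
  rewrite sumrB (bigD1 i) //= eqxx mulr1n mul1r big1 ?addr0.
    by rewrite {1}bME addrK mulrC.
  by move=> l /negPf nl; rewrite eq_sym nl mulr0n mul0r.
have detA : (\det A).@[z 0] = 1.
  rewrite -(det_map_mx (meval (z 0))) (_ : map_mx _ A = 1%:M) ?det1 //.
  apply/matrixP => i l; rewrite !mxE rmorphB /= bMz subr0.
  by rewrite rmorphMn rmorph1.
exists (\det A); first by rewrite detA oner_neq0.
have gr i : ev (\det A) * gam i =
    ev (\sum_l (\adj A) i l * ((bM l).1)%:MP) * theta.
  have := congr1 (mulmx (\adj (map_mx ev A))) Agc.
  rewrite mulmxA mul_adj_mx mul_scalar_mx -scalemxAr => /colP /(_ i).
  rewrite !mxE det_map_mx => ->; rewrite mulrC; congr (_ * _).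
  rewrite raddf_sum /=; apply: eq_bigr => l _.
  by rewrite rmorphM /= mmapC -map_mx_adj !mxE.
move=> p pz; have [h hv ep] := taylor1 (z 0) p.
exists (\sum_i h i * (\sum_l (\adj A) i l * ((bM l).1)%:MP)).
rewrite {1}ep pz mpolyC0 add0r.
rewrite [X in _ * X = _]raddf_sum [X in _ = X * _]raddf_sum /= mulr_sumr mulr_suml.
apply: eq_bigr => i _.
have eX : ev ('X_i - (z 0 i)%:MP) = gam i by rewrite rmorphB /= mmapX mmap1U mmapC.
by rewrite !rmorphM /= eX mulrCA gr mulrA.
Qed.

End Uniformiser.

(** * Specialising algebraic elements *)

Section Minimal.
Variables (R : comNzRingType) (E : fieldType) (f : {rmorphism R -> E}).

Definition algebraic_over (x : E) :=
  exists2 Q : {poly R}, map_poly f Q != 0 & root (map_poly f Q) x.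

(** A minimal polynomial of [x] over the fractions of [f R], with its
    denominators cleared. *)
Definition minimal_over (x : E) (P : {poly R}) :=
  [/\ f (lead_coef P) != 0, root (map_poly f P) x
    & forall Q, root (map_poly f Q) x -> (size (map_poly f Q) < size P)%N ->
      map_poly f Q = 0].

Definition trim (Q : {poly R}) := \poly_(i < size (map_poly f Q)) Q`_i.

Lemma size_trim Q : (size (trim Q) <= size (map_poly f Q))%N.
Proof. exact: size_poly. Qed.

Lemma map_trim (T : nzRingType) (g : {rmorphism R -> T}) Q :
  (forall c, f c = 0 -> g c = 0) -> map_poly g (trim Q) = map_poly g Q.
Proof.
move=> fg; apply/polyP => i; rewrite !coef_map coef_poly /=.
case: ltnP => // le; rewrite rmorph0 fg //.
by rewrite -coef_map nth_default.
Qed.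

Lemma minimal_exists x : algebraic_over x -> exists P, minimal_over x P.
Proof.
case=> Q; have [n] := ubnP (size Q); elim: n Q => // n IH Q; rewrite ltnS => leQ Q0 rQ.
case: (excluded_middle_informative (exists2 Q' : {poly R}, (size (map_poly f Q') < size Q)%N &
    map_poly f Q' != 0 /\ root (map_poly f Q') x)) => [[Q' lt [Q'0 rQ']]|nex].
  apply: (IH (trim Q')); rewrite ?map_trim //.
  by apply: leq_ltn_trans (size_trim _) _; apply: leq_trans lt leQ.
exists Q; split=> // [|Q' rQ' lt].
  apply/negP => /eqP lQ; apply: nex; exists Q => //.
  have sQ : (0 < size Q)%N.
    by rewrite size_poly_gt0; apply: contraNneq Q0 => ->; rewrite rmorph0.
  rewrite -[ltnRHS](prednK sQ) ltnS; apply/leq_sizeP => i le; rewrite coef_map /=.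
  case: (ltngtP i (size Q).-1) le => // [lt|->] _; last by rewrite -lead_coefE.
  by rewrite nth_default ?rmorph0 // -[size Q](prednK sQ).
by apply/eqP/negPn/negP => Q'0; apply: nex; exists Q'.
Qed.

Lemma minimal_dvd x P Q : minimal_over x P -> root (map_poly f Q) x ->
  map_poly f P %| map_poly f Q.
Proof.
case=> lP rP minP rQ.
have P0 : P != 0 by apply: contraNneq lP => ->; rewrite lead_coef0 rmorph0.
have e := Pdiv.ComRing.rdivp_eq P Q.
set c := (lead_coef P ^+ _) in e.
have := congr1 (map_poly f) e.
rewrite -mul_polyC !(rmorphM, rmorphD) /= map_polyC /= => e'.
have c0 : f c != 0 by rewrite rmorphXn expf_neq0.
have rem0 : map_poly f (Pdiv.Ring.rmodp Q P) = 0.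
  apply: minP; last first.
    apply: leq_ltn_trans (size_poly _ _) _; by rewrite Pdiv.Ring.ltn_rmodp.
  have := congr1 (horner_eval x) e'.
  rewrite /horner_eval !(hornerM, hornerD) hornerC (rootP rP) (rootP rQ) !mulr0 add0r.
  by move=> /esym/rootP.
rewrite -(dvdpZr _ _ c0) -mul_polyC e' rem0 addr0.
exact: dvdp_mull.
Qed.

Lemma minimal_size x P : minimal_over x P ->
  size (map_poly f P) = size P /\ (1 < size P)%N.
Proof.
case=> lP rP _; have sz : size (map_poly f P) = size P by apply: size_map_poly_id0.
split=> //; rewrite -sz; apply: (root_size_gt1 _ rP).
by rewrite -size_poly_gt0 sz size_poly_gt0; apply: contraNneq lP => ->; rewrite lead_coef0 rmorph0.
Qed.

Lemma clear_denominators (q : {poly E}) :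
  (forall i, exists a b, f b != 0 /\ q`_i = f a / f b) ->
  exists Q c, c != 0 /\ map_poly f Q = c *: q.
Proof.
move=> hq.
have hq' i : exists ab : R * R, f ab.2 != 0 /\ q`_i = f ab.1 / f ab.2.
  by have [a [b h]] := hq i; exists (a, b).
pose ab i := proj1_sig (constructive_indefinite_description _ (hq' i)).
have abP i : f (ab i).2 != 0 /\ q`_i = f (ab i).1 / f (ab i).2.
  by rewrite /ab; case: constructive_indefinite_description.
exists (\poly_(i < size q) ((ab i).1 * \prod_(j < size q | j != i :> nat) (ab j).2)).
exists (\prod_(j < size q) f (ab j).2); split.
  by apply/prodf_neq0 => j _; case: (abP j).
apply/polyP => i; rewrite coef_map coefZ coef_poly /=.
case: ltnP => [lt|le]; last by rewrite rmorph0 nth_default ?mulr0.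
rewrite [in RHS](bigD1 (Ordinal lt)) //= rmorphM rmorph_prod.
have [n0 ->] := abP i.
by rewrite [RHS]mulrC mulrA divfK.
Qed.

End Minimal.

Section Extension.
Variables (E : fieldType) (K : closedFieldType).

Definition same_kernel (R : nzRingType) (f1 : R -> E) (f2 : R -> K) :=
  forall x, (f1 x == 0) = (f2 x == 0).

Lemma map_poly_kernel (R : nzRingType) (f1 : {rmorphism R -> E}) (f2 : {rmorphism R -> K}) Q :
  same_kernel f1 f2 -> (map_poly f1 Q == 0) = (map_poly f2 Q == 0).
Proof.
move=> ker; apply/eqP/eqP => /polyP e; apply/polyP => i; apply/eqP;
  have := e i; rewrite !coef_map !coef0 => /eqP; by rewrite ker.
Qed.

Section Simple.
Variables (R : comNzRingType) (f1 : {rmorphism R -> E}) (f2 : {rmorphism R -> K}).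
Variables (x : E) (rho : K) (P : {poly R}).
Hypotheses (ker : same_kernel f1 f2) (minP : minimal_over f1 x P)
  (rP : root (map_poly f2 P) rho).

Lemma simple_extension_sub Q :
  root (map_poly f1 Q) x -> root (map_poly f2 Q) rho.
Proof.
move=> rQ; have [lP rP1 min] := minP.
have P0 : P != 0 by apply: contraNneq lP => ->; rewrite lead_coef0 rmorph0.
have e := Pdiv.ComRing.rdivp_eq P Q.
set c := (lead_coef P ^+ _) in e.
have c0 : f2 c != 0 by rewrite -ker rmorphXn expf_neq0.
have e1 := congr1 (horner_eval x \o map_poly f1) e.
have e2 := congr1 (horner_eval rho \o map_poly f2) e.
move: e1 e2; rewrite /= /horner_eval -mul_polyC !(rmorphM, rmorphD) /= !map_polyC /=.
rewrite !(hornerM, hornerD) !hornerC (rootP rP1) (rootP rP) (rootP rQ) !mulr0 !add0r.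
move=> /esym/rootP rrem e2.
have /eqP : map_poly f1 (Pdiv.Ring.rmodp Q P) = 0.
  by apply: min => //; apply: leq_ltn_trans (size_poly _ _) _; rewrite Pdiv.Ring.ltn_rmodp.
rewrite (map_poly_kernel _ ker) => /eqP rem0.
rewrite rem0 horner0 in e2; move/eqP: e2.
by rewrite mulf_eq0 (negPf c0).
Qed.

(** A polynomial of least degree that vanishes at [rho] but not at [x] would be a
    proper factor of [P], contradicting the minimality of [P]. *)
Lemma simple_extension : same_kernel (fun Q => (map_poly f1 Q).[x])
  (fun Q => (map_poly f2 Q).[rho]).
Proof.
have [lP rP1 min] := minP.
have P0 : P != 0 by apply: contraNneq lP => ->; rewrite lead_coef0 rmorph0.
move=> Q; apply/eqP/eqP => [/rootP/simple_extension_sub/rootP // | /rootP rQ2].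
apply/rootP; move: rQ2.
have [n] := ubnP (size Q); elim: n Q => // n IH Q; rewrite ltnS => leQ rQ2.
apply/negPn/negP => rQ1.
have f12 c : f1 c = 0 -> f2 c = 0 by move/eqP; rewrite ker => /eqP.
have IHlt (B : {poly R}) : (size B < size Q)%N -> root (map_poly f2 B) rho -> root (map_poly f1 B) x.
  by move=> lt; apply: IH; apply: leq_trans lt leQ.
have mQ0 : map_poly f1 Q != 0 by apply: contraNneq rQ1 => ->; rewrite root0.
have Q0 : Q != 0 by apply: contraNneq mQ0 => ->; rewrite rmorph0.
have sQ : size (map_poly f1 Q) = size Q.
  apply/eqP; rewrite eqn_leq size_poly leqNgt /=; apply/negP => lt.
  have := IHlt (trim f1 Q) (leq_ltn_trans (size_trim f1 Q) lt).
  by rewrite !map_trim // (negPf rQ1) => /(_ rQ2).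
have div (A B : {poly R}) : B != 0 -> exists c U V,
    [/\ (forall (T : fieldType) (g : {rmorphism R -> T}), g (lead_coef B) != 0 -> g c != 0),
      c%:P * A = U * B + V & (size V < size B)%N].
  move=> B0; exists (lead_coef B ^+ Pdiv.Ring.rscalp A B), (Pdiv.Ring.rdivp A B), (Pdiv.Ring.rmodp A B).
  split; last by rewrite Pdiv.Ring.ltn_rmodp.
    by move=> T g g0; rewrite rmorphXn expf_neq0.
  by rewrite mul_polyC Pdiv.ComRing.rdivp_eq.
have ev (F : fieldType) (g : {rmorphism R -> F}) (y : F) c (A U B V : {poly R}) : c%:P * A = U * B + V ->
    g c * (map_poly g A).[y] = (map_poly g U).[y] * (map_poly g B).[y] + (map_poly g V).[y].
  move/(congr1 (map_poly g)); rewrite !(rmorphM, rmorphD) /= map_polyC.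
  by move/(congr1 (horner_eval y)); rewrite /horner_eval !(hornerM, hornerD) hornerC.
have ltQP : (size Q < size P)%N.
  rewrite ltnNge; apply/negP => leP.
  have [c [U [V [/(_ _ f1 lP) c0 e lt]]]] := div Q P P0.
  have /IHlt : (size V < size Q)%N by apply: leq_trans lt leP.
  have := ev _ f2 rho _ _ _ _ _ e; rewrite (rootP rQ2) (rootP rP) !mulr0 add0r.
  move=> /esym/rootP -> /(_ isT) /rootP V0.
  have := ev _ f1 x _ _ _ _ _ e; rewrite (rootP rP1) V0 mulr0 addr0 => /eqP.
  by rewrite mulf_eq0 (negPf c0) -[_ == 0]/(root _ x) (negPf rQ1).
have lQ : f1 (lead_coef Q) != 0.
  by rewrite lead_coefE -coef_map -sQ -lead_coefE lead_coef_eq0.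
have [c [U [V [/(_ _ f1 lQ) c0 e lt]]]] := div P Q Q0.
have V0 : map_poly f1 V = 0.
  apply: min; last by apply: leq_ltn_trans (size_poly _ _) (ltn_trans lt ltQP).
  apply: IHlt => //; have := ev _ f2 rho _ _ _ _ _ e.
  by rewrite (rootP rQ2) (rootP rP) !mulr0 add0r => /esym/rootP.
have sQ1 : (1 < size Q)%N.
  rewrite ltnNge; apply/negP => /size1_polyC eQ; move: rQ2 rQ1.
  by rewrite eQ !map_polyC !rootC /= ker => ->.
have e1 := congr1 (map_poly f1) e.
move: e1; rewrite !(rmorphM, rmorphD) /= map_polyC V0 addr0 mul_polyC => e1.
have sP : size (map_poly f1 P) = size P by have [] := minimal_size minP.
have mU0 : map_poly f1 U != 0.
  apply: contraTneq isT => U0; move: e1; rewrite U0 mul0r => /eqP.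
  by rewrite scaler_eq0 (negPf c0) -size_poly_eq0 sP size_poly_eq0 (negPf P0).
have := congr1 (size \o polyseq) e1; rewrite /= size_scale // size_mul // sP sQ => sz.
have U0 : map_poly f1 U = 0.
  apply: min; last by rewrite sz; case: (size Q) sQ1 => [|[|k]] // _; rewrite !addnS /= ltnS leq_addr.
  have := ev _ f1 x _ _ _ _ _ e; rewrite V0 horner0 addr0 (rootP rP1) mulr0 => /esym/eqP.
  by rewrite mulf_eq0 -![_ == 0]/(root _ x) (negPf rQ1) orbF.
by rewrite U0 eqxx in mU0.
Qed.

End Simple.

(** Adjoining finitely many algebraic elements one after the other, each time
    choosing a root in [K] of its minimal polynomial. *)
Lemma extend_generators (R : comNzRingType) (f1 : {rmorphism R -> E})
    (f2 : {rmorphism R -> K}) (gens : seq E) :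
  same_kernel f1 f2 -> (forall x, x \in gens -> algebraic_over f1 x) ->
  exists (S : comNzRingType) (j : {rmorphism R -> S}) (g1 : {rmorphism S -> E})
    (g2 : {rmorphism S -> K}),
  [/\ forall r, g1 (j r) = f1 r, forall r, g2 (j r) = f2 r, same_kernel g1 g2
    & forall x, x \in gens -> exists s, g1 s = x].
Proof.
elim: gens R f1 f2 => [|x gens IH] R f1 f2 ker alg.
  by exists R, idfun, f1, f2.
have [P minP] := minimal_exists (alg x (mem_head _ _)).
have [sP P1] := minimal_size minP.
have [rho rP] : exists rho, root (map_poly f2 P) rho.
  apply/closed_rootP; rewrite size_map_poly_id0; first by rewrite neq_ltn P1 orbT.
  by rewrite -ker; case: minP.
have c1 : commr_rmorph f1 x by move=> r; apply: mulrC.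
have c2 : commr_rmorph f2 rho by move=> r; apply: mulrC.
have ker' : same_kernel (horner_morph c1) (horner_morph c2) := simple_extension ker minP rP.
case: (IH {poly R} (horner_morph c1) (horner_morph c2) ker').
  move=> y y_g; have [Q Q0 rQ] := alg y (@mem_behead _ (x :: gens) y y_g).
  have e : map_poly (horner_morph c1) (map_poly polyC Q) = map_poly f1 Q.
    by apply/polyP => i; rewrite !coef_map /= horner_morphC.
  by exists (map_poly polyC Q); rewrite e.
move=> S [j [g1 [g2 [e1 e2 kerS gen]]]].
exists S, (j \o polyC), g1, g2; split=> //=.
- by move=> r; rewrite e1 /= horner_morphC.
- by move=> r; rewrite e2 /= horner_morphC.
- move=> y; rewrite inE => /predU1P[->|]; last exact: gen.
  by exists (j 'X); rewrite e1 /= horner_morphX.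
Qed.

End Extension.

(** * The function field of the cover *)

Section CoverField.
Variables (L : closedFieldType) (n m : nat).
Variables (D : variety (@pn_block n) L) (F : variety (@pnpm_block n m) L).
Local Notation wD := (@pn_block n).
Local Notation wF := (@pnpm_block n m).
Local Notation R := {mpoly L[n.+1]}.
Local Notation ls := (@lshift n.+1 m.+1).
Local Notation rs := (@rshift n.+1 m.+1).

Definition lam_pair (lam1 : 'I_n.+1 -> L) (lam2 : 'I_m.+1 -> L)
    (i : 'I_(n.+1 + m.+1)) :=
  match split i with inl j => lam1 j | inr j => lam2 j end.

Lemma lam_pair_l lam1 lam2 i : lam_pair lam1 lam2 (ls i) = lam1 i.
Proof. by rewrite /lam_pair (unsplitK (inl i)). Qed.

Lemma lam_pair_r lam1 lam2 j : lam_pair lam1 lam2 (rs j) = lam2 j.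
Proof. by rewrite /lam_pair (unsplitK (inr j)). Qed.

Lemma pnpm_l i : wF (ls i) = true.
Proof. by rewrite /pnpm_block /= ltn_ord. Qed.

Lemma pnpm_r j : wF (rs j) = false.
Proof. by rewrite /pnpm_block /= -[ltnRHS]addn0 ltn_add2l. Qed.

Lemma normalised_pn (S : comNzRingType) (iota : L -> S) lam1 z :
  normalised wD iota lam1 z <-> \sum_i iota (lam1 i) * z i = 1.
Proof.
by split=> [/(_ tt) <-|e [] //]; apply: eq_bigl.
Qed.

Lemma normalised_pnpm (S : comNzRingType) (iota : L -> S) lam1 lam2 z :
  normalised wF iota (lam_pair lam1 lam2) z <->
  \sum_i iota (lam1 i) * z (ls i) = 1 /\ \sum_j iota (lam2 j) * z (rs j) = 1.
Proof.
have sumE b : \sum_(i | wF i == b) iota (lam_pair lam1 lam2 i) * z i =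
    if b then \sum_i iota (lam1 i) * z (ls i) else \sum_j iota (lam2 j) * z (rs j).
  rewrite big_split_ord /=.
  under eq_bigl do rewrite pnpm_l.
  under [X in _ + X]eq_bigl do rewrite pnpm_r.
  case: b => /=.
    rewrite [X in _ + X]big_pred0 ?addr0 //.
    by apply: eq_bigr => i _; rewrite lam_pair_l.
  rewrite [X in X + _]big_pred0 ?add0r //.
  by apply: eq_bigr => i _; rewrite lam_pair_r.
split=> [nz|[e1 e2] [|]]; last 2 first.
- by rewrite sumE.
- by rewrite sumE.
by split; [rewrite -(nz true) sumE | rewrite -(nz false) sumE].
Qed.

Lemma ev_pr_poly (S : comNzRingType) (iota : {rmorphism L -> S}) z (p : R) :
  mmap iota z (pr_poly m p) = mmap iota (z \o ls) p.
Proof.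
rewrite /pr_poly /comp_mpoly ev_morph; apply: eq_ev => [c|i] /=.
  by rewrite mmapC.
by rewrite tnth_mktuple mmapX mmap1U.
Qed.

Lemma multihomog_pr_poly d (p : R) : multihomog wD d p ->
  multihomog wF (fun b => if b then d tt else 0%N) (pr_poly m p).
Proof.
move=> hp; rewrite /pr_poly comp_mpolyEX big_seq; apply: multihomog_sum => k k_p.
apply: multihomogZ; rewrite comp_mpolyX.
under eq_bigr do rewrite tnth_mktuple.
apply: multihomog_eq (multihomog_prod (fun i => multihomogX (k := k i)
  (@multihomog_mnm _ _ wF L U_(ls i)))) => b.
under eq_bigr do rewrite multideg1 pnpm_l.
case: b; last by rewrite big1 // => i _; rewrite muln0.
rewrite -(hp _ k_p tt) /mnm_multideg; under eq_bigr do rewrite muln1.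
by apply: eq_bigl.
Qed.

Variables (lam1 : 'I_n.+1 -> L) (lam2 : 'I_m.+1 -> L).
Local Notation lam := (lam_pair lam1 lam2).
Hypotheses (F_over_D : lies_over D F)
  (lamF : forall g, ell wF lam g \notin mem_ideal F)
  (lamD : forall g, ell wD lam1 g \notin mem_ideal D).

Local Notation evF := (mmap (@cone_const _ _ _ _ F) (chart F lam)).
Local Notation evD := (mmap (@cone_const _ _ _ _ D) (chart D lam1)).

(** Pulling back along the projection, in affine coordinates. *)
Definition pullback : R -> cone_field F :=
  mmap (@cone_const _ _ _ _ F) (chart F lam \o ls).

HB.instance Definition _ := GRing.RMorphism.on pullback.

Lemma pullbackE p : pullback p = evF (pr_poly m p).
Proof. by rewrite ev_pr_poly. Qed.

Lemma pullback_normalised : normalised wD (@cone_const _ _ _ _ F) lam1 (chart F lam \o ls).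
Proof.
by apply/normalised_pn; have /normalised_pnpm[] := chart_normalised lamF.
Qed.

Lemma pullback_ideal p : p \in mem_ideal D -> pullback p = 0.
Proof. by move=> /F_over_D pF; rewrite pullbackE chart_ideal. Qed.

Lemma pullback0 p : evD p = 0 -> pullback p = 0.
Proof.
apply: (chart_specialise lamD pullback_normalised) => q qD.
by rewrite -/(pullback q) pullback_ideal.
Qed.

Lemma pr_pullback_chart A psi : pr_pullback A psi -> exists p q,
  [/\ evD q != 0, psi = pullback p / pullback q & A (evD p / evD q)].
Proof.
case=> d [g [h [hg hh nh Ah ->]]]; exists g, h.
rewrite (chart_homog_eq0 lamD hh) nh -(chart_ratio lamD hg hh); split=> //.
by rewrite (chart_ratio lamF (multihomog_pr_poly hg) (multihomog_pr_poly hh)) -!pullbackE.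
Qed.

Variables (a : 'rV[L]_n.+1) (b : 'rV[L]_m.+1).
Hypotheses (hab : on_variety F (row_mx a b))
  (na : \sum_i lam1 i * a 0 i = 1)
  (D_curve : curve D) (F_curve : curve F) (F_sep : pr_separable D F).

Lemma row_mx_ls (K : fieldType) (x : 'rV[K]_n.+1) (y : 'rV[K]_m.+1) :
  row_mx x y 0 \o ls =1 x 0.
Proof. by move=> i /=; rewrite row_mxEl. Qed.

Lemma pr_poly_at_ab p : (pr_poly m p).@[row_mx a b 0] = p.@[a 0].
Proof. by rewrite /meval ev_pr_poly; apply: eq_ev => // i; apply: row_mx_ls. Qed.

(** Otherwise every rational function on [F], being algebraic over constants,
    would be constant, and [F] would have no proper subvariety. *)
Lemma pullback_nonconstant :
  ~ (forall p d, multihomog wD d p -> p.@[a 0] = 0 -> pullback p = 0).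
Proof.
move=> const.
have nD : normalised wD idfun lam1 (a 0) by apply/normalised_pn.
have pbC p : pullback p = cone_const F p.@[a 0].
  have [D0 /(_ D0 (leqnn _)) [P hP eP]] := homogenise wD lam1 (p - (p.@[a 0])%:MP).
  have : pullback P = 0.
    apply: (const _ _ hP); rewrite /meval (eP _ _ _ nD) -/(meval _ _).
    by rewrite mevalB mevalC subrr.
  rewrite /pullback (eP _ _ _ pullback_normalised) rmorphB /= mmapC => /eqP.
  by rewrite subr_eq0 => /eqP.
have ratC f : rational_function f -> exists c, f = cone_const F c.
  move=> /F_sep[q [qE qsep /rootP qf]].
  have cE i : exists c, q`_i = cone_const F c.
    have [p [s [_ -> _]]] := pr_pullback_chart (qE i).
    by exists (p.@[a 0] / s.@[a 0]); rewrite !pbC fmorph_div.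
  pose c i := proj1_sig (constructive_indefinite_description _ (cE i)).
  have cP i : q`_i = cone_const F (c i).
    by rewrite /c; case: constructive_indefinite_description.
  have q0E : q = map_poly (cone_const F) (\poly_(i < size q) c i).
    apply/polyP => i; rewrite coef_map coef_poly /=; case: ltnP => // le.
    by rewrite rmorph0 nth_default.
  have q0 : q != 0 by apply: separable_poly_neq0.
  move: qf q0; rewrite q0E; have [r ->] := closed_field_poly_normal (\poly_(i < size q) c i).
  rewrite map_polyZ rmorph_prod /= => rf.
  rewrite scaler_eq0 negb_or => /andP[l0 _]; move/eqP: rf.
  rewrite hornerZ mulf_eq0 (negPf l0) /= horner_prod prodf_seq_eq0 => /hasP[x _] /=.
  by rewrite rmorphB /= map_polyX map_polyC hornerXsubC subr_eq0 => /eqP ->; exists x.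
case: F_curve => -[ch [ch0 chP]] _.
have [sub [p pY pF]] := chP 0%N isT; rewrite ch0 in sub pF.
set Y := ch 1%N in sub pY.
have [d pdF] : exists d, homog_component wF d p \notin mem_ideal F.
  apply: Classical_Pred_Type.not_all_not_ex => h; case/negP: pF.
  by apply/mem_variety_of_homog => d; apply/negPn/negP/h.
have pdY : homog_component wF d p \in mem_ideal Y by apply: videalH.
have iE g : exists i, wF i = g /\ 'X_i \notin mem_ideal Y.
  by have [i wi Xi] := videalR Y g; exists i.
pose i_ g := proj1_sig (constructive_indefinite_description _ (iE g)).
have iP g : wF (i_ g) = g /\ 'X_(i_ g) \notin mem_ideal Y.
  by rewrite /i_; case: constructive_indefinite_description.
pose M : {mpoly L[n.+1 + m.+1]} := \prod_g 'X_(i_ g) ^+ d g.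
have MY : M \notin mem_ideal Y.
  rewrite -cone_class_eq0 rmorph_prod /=; apply/prodf_neq0 => g _.
  by rewrite rmorphXn expf_neq0 // cone_class_eq0; case: (iP g).
have hM : multihomog wF d M.
  apply: multihomog_eq (multihomog_prod (fun g => multihomogX (k := d g)
    (@multihomog_mnm _ _ wF L U_(i_ g)))) => g /=.
  rewrite (bigD1 g) //= multideg1 (iP g).1 eqxx muln1 big1 ?addn0 //.
  by move=> g' /negPf ng; rewrite multideg1 (iP g').1 ng muln0.
have MF : cone_class F M != 0.
  by rewrite cone_class_eq0; apply: contra MY; apply: sub.
have [c ec] : exists c, cone_class F (homog_component wF d p) / cone_class F M = cone_const F c.
  apply: ratC; exists d, (homog_component wF d p), M; split=> //.
    exact: homog_component_homog.
  by rewrite -cone_class_eq0.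
have pcM : homog_component wF d p - c%:MP * M \in mem_ideal F.
  rewrite -cone_class_eq0 rmorphB /=.
  by rewrite cone_classCM -ec divfK // subrr.
have cMY : c%:MP * M \in mem_ideal Y.
  rewrite -[_ * _](subKr (homog_component wF d p)).
  by apply: rpredB pdY _; apply: sub.
have c0 : c = 0.
  move: cMY; rewrite -cone_class_eq0.
  by rewrite cone_classCM mulf_eq0 fmorph_eq0 cone_class_eq0 (negPf MY) orbF => /eqP.
move: pcM; rewrite c0 mpolyC0 mul0r subr0; exact/negP.
Qed.

(** The image of [F] is a subvariety of [D] through [a] which is not the point [a],
    so it is dense in [D]. *)
Lemma pullback_eq0 p : (evD p == 0) = (pullback p == 0).
Proof.
apply/eqP/eqP => [/pullback0 //|].
have [D0 /(_ D0 (leqnn _)) [P hP eP]] := homogenise wD lam1 p.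
rewrite -(eP _ _ _ (chart_normalised lamD)) /pullback -(eP _ _ _ pullback_normalised) => P0.
apply/eqP; rewrite (chart_homog_eq0 lamD hP).
have hgen := curve_point_generic (zero_prime (cone_const F)) D_curve
  (z := chart F lam \o ls) (a := a).
apply: hgen hP P0 => //.
- move=> g; apply: Classical_Prop.NNPP => nex.
  have /eqP := pullback_normalised g; rewrite big1 ?(eq_sym 0) ?oner_eq0 //.
  move=> i /eqP wi; apply: Classical_Prop.NNPP => nz; apply: nex; exists i => // z0.
  by apply: nz; rewrite z0 mulr0.
- by move=> q d _ /pullback_ideal.
- move=> []; have [i] := hab.1 true; case: (split_ordP i) => j ->.
    by rewrite row_mxEl; exists j.
  by rewrite pnpm_r.
- move=> q d hq q0; rewrite -pr_poly_at_ab; apply: hab.2.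
  rewrite -(chart_homog_eq0 lamF (multihomog_pr_poly hq)) -pullbackE.
  exact/eqP.
- apply: Classical_Prop.NNPP => nex; apply: pullback_nonconstant => q d hq qa.
  by apply: Classical_Prop.NNPP => nz; apply: nex; exists d, q.
Qed.

Lemma rational_algebraic f : rational_function f -> exists2 Q : {poly R},
  separable_poly (map_poly pullback Q) & root (map_poly pullback Q) f.
Proof.
move=> /F_sep[q [qE qsep qf]].
have [Q [c [c0 eQ]]] : exists Q c, c != 0 /\ map_poly pullback Q = c *: q.
  apply: clear_denominators => i.
  have [p [s [s0 -> _]]] := pr_pullback_chart (qE i).
  by exists p, s; rewrite -pullback_eq0.
exists Q; rewrite eQ; last by rewrite rootZ.
by rewrite (eqp_separable (eqp_scale _ c0)).
Qed.

Lemma coordinate_algebraic j : exists2 Q : {poly R},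
  separable_poly (map_poly pullback Q) & root (map_poly pullback Q) (chart F lam j).
Proof.
apply: rational_algebraic; apply/(rational_chart lamF).
exists 'X_j, 1; rewrite rmorph1 oner_eq0; split=> //.
by rewrite divr1 mmapX mmap1U.
Qed.

End CoverField.

(** * Reduction of points and roots *)

Section Reduction.
Variables (L K : closedFieldType) (iota : {rmorphism L -> K}) (O M : K -> Prop).
Hypothesis pl : place iota O M.

Section Points.
Variables (N : nat) (z' : 'I_N -> K) (z : 'I_N -> L).
Hypothesis red : forall i, M (z' i - iota (z i)).

Lemma red_integral i : O (z' i).
Proof.
rewrite -[z' i](subrK (iota (z i))); apply: (plD pl); last exact: (pl_const pl).
exact: (pl_sub pl).
Qed.

Lemma ev_integral p : O (mmap iota z' p).
Proof.
rewrite /mmap; apply: (pl_sum pl) => m _; apply: (plM pl); first exact: (pl_const pl).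
by apply: (pl_prod pl) => i _; apply: (plX pl); apply: red_integral.
Qed.

Lemma ev_reduce p : M (mmap iota z' p - iota p.@[z]).
Proof.
have [h _ {1}->] := taylor1 z p.
rewrite rmorphD /= mmapC addrC addKr rmorph_sum /=; apply: (pl_id_sum pl) => l _.
rewrite rmorphM; apply: (pl_idM pl); first exact: ev_integral.
by rewrite rmorphB /= mmapX mmap1U mmapC.
Qed.

Lemma ev_unit p : p.@[z] != 0 -> ~ M (mmap iota z' p).
Proof.
move=> /eqP nz Mp; apply: nz; apply: (pl_id_const pl).
rewrite -(subKr (mmap iota z' p) (iota _)).
by apply: (pl_idB pl) => //; apply: ev_reduce.
Qed.

Lemma ev_id p : M (mmap iota z' p) -> p.@[z] = 0.
Proof. by move=> Mp; apply/eqP/negPn/negP => /ev_unit. Qed.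

Lemma ev_id0 p : p.@[z] = 0 -> M (mmap iota z' p).
Proof. by move=> pz; rewrite -[mmap _ _ _]subr0 -(rmorph0 iota) -pz; apply: ev_reduce. Qed.

End Points.

Lemma closed_field_avoid (F : closedFieldType) (s : seq F) : exists x, x \notin s.
Proof.
have [x rx] : exists x, root (\prod_(t <- s) ('X - t%:P) * 'X + 1 : {poly F}) x.
  apply/closed_rootP; rewrite size_polyDl size_mulX ?monic_neq0 ?monic_prod_XsubC //.
    by rewrite size_prod_XsubC.
  by rewrite size_prod_XsubC size_poly1.
exists x; apply/negP => xs; move: rx; rewrite rootE hornerD hornerM hornerC.
have /rootP -> : root (\prod_(t <- s) ('X - t%:P)) x by rewrite root_prod_XsubC.
by rewrite mul0r add0r oner_eq0.
Qed.

Lemma avoid_roots (q : {poly K}) : q != 0 -> exists s : L, q.[iota s] != 0.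
Proof.
move=> q0; apply: Classical_Prop.NNPP => nex.
have all_root s : root q (iota s).
  by apply/negPn/negP => h; apply: nex; exists s.
have [s [us ss]] : exists s : seq L, uniq s /\ size s = size q.
  elim: (size q) => [|k [s [us ss]]]; first by exists [::].
  by have [x xs] := closed_field_avoid s; exists (x :: s); rewrite /= xs ss.
suff : (size q < size q)%N by rewrite ltnn.
rewrite -{1}ss -(size_map iota); apply: max_poly_roots q0 _ _.
  by apply/allP => _ /mapP[x _ ->].
by rewrite map_inj_uniq //; apply: fmorph_inj.
Qed.

Definition curve_poly N (v : 'rV[K]_N) : {poly K} := \sum_i v 0 i *: 'X^i.

Lemma horner_curve_poly N (v : 'rV[K]_N) s :
  (curve_poly v).[s] = \sum_i v 0 i * s ^+ i.
Proof. by rewrite horner_sum; apply: eq_bigr => i _; rewrite hornerZ hornerXn. Qed.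

Lemma curve_poly_neq0 N (v : 'rV[K]_N) : v != 0 -> curve_poly v != 0.
Proof.
move=> v0; have [i vi] : exists i, v 0 i != 0.
  apply: Classical_Prop.NNPP => nex; case/eqP: v0; apply/rowP => i; rewrite mxE.
  by apply/eqP/negPn/negP => h; apply: nex; exists i.
apply: contraNneq vi => /polyP/(_ i); rewrite coef0 coef_sum.
rewrite (bigD1 i) //= coefZ coefXn eqxx mulr1 big1 ?addr0 // => [->|j nj] //.
by rewrite coefZ coefXn eq_sym val_eqE (negPf nj) mulr0.
Qed.

(** The points of the rational normal curve provide the generic vector: each
    hyperplane meets the curve in finitely many points. *)
Lemma avoid_hyperplanes N (vs : seq 'rV[K]_N) :
  exists s : L, forall v, v \in vs -> v != 0 -> \sum_i v 0 i * iota s ^+ i != 0.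
Proof.
have [s nz] : exists s : L, (\prod_(v <- vs | v != 0) curve_poly v).[iota s] != 0.
  apply: avoid_roots; rewrite prodf_seq_neq0; apply/allP => v _.
  by apply/implyP/curve_poly_neq0.
exists s => v v_vs v0; rewrite -horner_curve_poly; apply: contraNneq nz => e.
by rewrite horner_prod (big_rem v) //= v0 e mul0r.
Qed.

(** Divide by a coordinate of least valuation. *)
Lemma point_reduction N (y : 'rV[K]_N) : y != 0 ->
  exists k (c : 'rV[L]_N), [/\ k != 0, c != 0 & forall j, M (k * y 0 j - iota (c 0 j))].
Proof.
move=> y0.
have [j0 yj0] : exists j, y 0 j != 0.
  apply: Classical_Prop.NNPP => nex; case/eqP: y0; apply/rowP => i; rewrite mxE.
  by apply/eqP/negPn/negP => h; apply: nex; exists i.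
have max (s : seq 'I_N) : exists2 j, y 0 j != 0 & forall i, i \in s -> O (y 0 i / y 0 j).
  elim: s => [|i s [j yj IH]]; first by exists j0.
  case: (pl_total pl (y 0 i / y 0 j)) => [Oij|Mji].
    by exists j => // l; rewrite inE => /predU1P[->|/IH].
  case: (altP (y 0 i =P 0)) => [yi0|yi].
    exists j => // l; rewrite inE => /predU1P[->|/IH //].
    by rewrite yi0 mul0r; apply: (pl0 pl).
  exists i => // l; rewrite inE => /predU1P[->|/IH Olj].
    by rewrite divff //; apply: (pl1 pl).
  have -> : y 0 l / y 0 i = y 0 l / y 0 j * (y 0 i / y 0 j)^-1.
    by field; rewrite yi yj.
  by apply: (plM pl) => //; apply: (pl_sub pl).
have [j yj Oy] := max (enum 'I_N).
have res i : exists c, M ((y 0 j)^-1 * y 0 i - iota c).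
  by rewrite mulrC; apply: (pl_residue pl); apply: Oy; rewrite mem_enum.
pose c i := proj1_sig (constructive_indefinite_description _ (res i)).
have cP i : M ((y 0 j)^-1 * y 0 i - iota (c i)).
  by rewrite /c; case: constructive_indefinite_description.
exists (y 0 j)^-1, (\row_i c i); split; first by rewrite invr_eq0.
- apply/eqP => /rowP /(_ j); rewrite !mxE => cj.
  by have := cP j; rewrite mulVf // cj rmorph0 subr0; apply: (pl_id1 pl).
- by move=> i; rewrite mxE.
Qed.

Lemma flat_le pi x k j : M pi -> pi != 0 -> (j <= k)%N ->
  O (x / pi ^+ k) -> O (x / pi ^+ j).
Proof.
move=> Mpi pi0 le Ox.
have -> : x / pi ^+ j = pi ^+ (k - j) * (x / pi ^+ k).
  by rewrite -{2}(subnK le) exprD; field; rewrite !expf_neq0.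
by apply: (plM pl) => //; apply: (plX pl); apply: (pl_sub pl).
Qed.

(** Elements that are approximate roots, to every precision, of monic
    polynomials of degree [e] number at most [e]: beyond the precision that
    separates them, two of them cannot be close to the same exact root. *)
Lemma close_roots (s : seq K) (e : nat) (pi : K) : M pi -> pi != 0 -> uniq s ->
  (forall x y, x \in s -> y \in s -> x != y -> ~ flat O pi (x - y)) ->
  (forall k, exists2 E : {poly K}, E \is monic /\ size E = e.+1 &
     forall x, x \in s -> O (E.[x] / pi ^+ k)) ->
  (size s <= e)%N.
Proof.
move=> Mpi pi0 us sep app.
have [k kP] : exists k, forall x y, x \in s -> y \in s -> x != y -> ~ O ((x - y) / pi ^+ k).
  have one x y : exists k, x \in s -> y \in s -> x != y -> ~ O ((x - y) / pi ^+ k).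
    case: (excluded_middle_informative (flat O pi (x - y))) => [fl|nfl].
      by exists 0%N => xs ys ne; case: (sep _ _ xs ys ne).
    by have [k nk] := Classical_Pred_Type.not_all_ex_not _ _ nfl; exists k.
  pose kk x y := proj1_sig (constructive_indefinite_description _ (one x y)).
  have kkP x y : x \in s -> y \in s -> x != y -> ~ O ((x - y) / pi ^+ kk x y).
    by rewrite /kk; case: constructive_indefinite_description.
  exists (\max_(x <- s) \max_(y <- s) kk x y) => x y xs ys ne Oxy.
  apply: (kkP x y) => //; apply: flat_le Oxy => //.
  by rewrite (big_rem x) //= (big_rem y) //= !leq_max leqnn.
(* if the [e] roots of [E] are all further from [x] than [pi ^+ k], then the order
   of [E.[x]] is less than [e * k] *)
have [E [mE sE] OE] := app (e * k).+1.
have [r eE] := closed_field_poly_normal E.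
rewrite (monicP mE) scale1r in eE.
have sr : size r = e by move: sE; rewrite eE size_prod_XsubC => -[].
have near x : x \in s -> exists2 t, t \in r & O ((x - t) / pi ^+ k).
  move=> xs; apply: Classical_Prop.NNPP => nex.
  have inv t : t \in r -> O ((x - t) / pi ^+ k)^-1.
    move=> tr; apply: (pl_sub pl); case: (pl_total pl ((x - t) / pi ^+ k)) => // Ot.
    by case: nex; exists t.
  have Oinv : O (\prod_(t <- r) ((x - t) / pi ^+ k)^-1).
    by rewrite big_seq; apply: (pl_prod pl).
  have Mpi1 : M (pi * (E.[x] / pi ^+ (e * k).+1)).
    by apply: (pl_idMr pl) => //; apply: OE.
  have nz : E.[x] != 0.
    rewrite eE horner_prod prodf_seq_neq0; apply/allP => t tr /=; rewrite hornerXsubC.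
    apply/eqP => xt; apply: nex; exists t => //.
    by rewrite xt mul0r; apply: (pl0 pl).
  have prodE (r' : seq K) : \prod_(t <- r') ((x - t) / pi ^+ k) =
      (\prod_(t <- r') ('X - t%:P)).[x] / pi ^+ (size r' * k).
    elim: r' => [|t r' IH]; first by rewrite !big_nil hornerC expr0 divr1.
    rewrite !big_cons IH hornerM hornerXsubC /= mulSn exprD.
    by field; rewrite !expf_neq0.
  apply: (pl_id1 pl).
  have -> : 1 = \prod_(t <- r) ((x - t) / pi ^+ k)^-1 * (pi * (E.[x] / pi ^+ (e * k).+1)).
    rewrite prodfV prodE -eE sr exprS.
    by field; rewrite nz !expf_neq0 // pi0.
  exact: (pl_idM pl).
have nearE x : exists t, x \in s -> t \in r /\ O ((x - t) / pi ^+ k).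
  case: (boolP (x \in s)) => [/near[t tr Ot]|_]; first by exists t.
  by exists 0.
pose t x := proj1_sig (constructive_indefinite_description _ (nearE x)).
have tP x : x \in s -> t x \in r /\ O ((x - t x) / pi ^+ k).
  by rewrite /t; case: constructive_indefinite_description.
rewrite -sr -(size_map t s); apply: uniq_leq_size; last first.
  by move=> _ /mapP[x xs ->]; case: (tP x xs).
rewrite map_inj_in_uniq // => x y xs ys txy.
apply/eqP/negPn/negP => ne; apply: (kP x y xs ys ne).
have -> : (x - y) / pi ^+ k = (x - t x) / pi ^+ k - (y - t y) / pi ^+ k.
  by rewrite txy; ring.
by apply: (plB pl); [case: (tP x xs) | case: (tP y ys)].
Qed.

End Reduction.

(** * The local ring of the base at the specialised generic point *)

Lemma normalised_block (N : nat) (G : finType) (w : 'I_N -> G)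
    (L S : comNzRingType) (iota : L -> S) (lam : 'I_N -> L) (z : 'I_N -> S)
    (P : S -> Prop) g :
  P 0 -> (forall x y, P x -> P y -> P (x + y)) -> (forall c x, P x -> P (iota c * x)) ->
  ~ P 1 -> \sum_(i | w i == g) iota (lam i) * z i = 1 ->
  exists2 i, w i = g & ~ P (z i).
Proof.
move=> P0 PD PM P1 e; apply: Classical_Prop.NNPP => nex; apply: P1; rewrite -e.
apply: (big_ind P) => // i /eqP wi; apply: PM.
by apply: Classical_Prop.NNPP => nP; apply: nex; exists i.
Qed.

Section Base.
Variables (L K : closedFieldType) (iota : {rmorphism L -> K}) (O M : K -> Prop).
Hypothesis pl : place iota O M.
Variables (n : nat) (D : variety (@pn_block n) L) (a : 'rV[L]_n.+1)
  (lam1 : 'I_n.+1 -> L) (a' : 'I_n.+1 -> K).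
Local Notation wD := (@pn_block n).
Local Notation R := {mpoly L[n.+1]}.
Hypotheses (D_curve : curve D) (D_smooth : smooth D) (aD : on_variety D a)
  (na : normalised wD idfun lam1 (a 0))
  (na' : normalised wD iota lam1 a')
  (a'D : forall p, p \in mem_ideal D -> mmap iota a' p = 0)
  (a'a : forall i, M (a' i - iota (a 0 i)))
  (a'_gen : exists i, a' i != iota (a 0 i)).

Local Notation evD := (mmap (@cone_const _ _ _ _ D) (chart D lam1)).
Local Notation ev' := (mmap iota a').
Let lamD := chart_defined aD na.

Lemma base_specialise p : evD p = 0 -> ev' p = 0.
Proof. by apply: (chart_specialise lamD na' a'D). Qed.

Lemma base_at p : evD p = 0 -> p.@[a 0] = 0.
Proof. by apply: (chart_specialise lamD (iota := idfun) na aD.2). Qed.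

Lemma base_eq p q : evD p = evD q -> ev' p = ev' q.
Proof.
by move=> e; apply/eqP; rewrite -subr_eq0 -rmorphB /= base_specialise // rmorphB /= e subrr.
Qed.

(** The value of a uniformiser at the generic point bounds all orders, since a
    rational function of infinite order there would cut out a variety strictly
    between [D] and the point [a]. *)
Lemma base_uniformiser : exists xi : R, [/\ xi.@[a 0] = 0, ev' xi != 0,
  exists2 q, q.@[a 0] != 0 & forall p, p.@[a 0] = 0 ->
    exists r, evD q * evD p = evD r * evD xi
  & forall p, evD p != 0 -> ~ flat O (ev' xi) (ev' p)].
Proof.
have [kap kap0 uni] := smooth_curve_uniformiser aD na D_curve D_smooth isT.
have [i ki] : exists i, kap i 0 != 0.
  apply: Classical_Prop.NNPP => nex; case/eqP: kap0; apply/colP => i; rewrite mxE.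
  by apply/eqP/negPn/negP => h; apply: nex; exists i.
case: (uni (delta_mx 0 i)).
  by rewrite -rowE; apply/eqP => /rowP /(_ 0); rewrite !mxE; apply/eqP.
move=> q qa Uq.
pose xi : R := 'X_i - (a 0 i)%:MP.
have evxi (S : comNzRingType) (j : {rmorphism L -> S}) z : mmap j z xi = z i - j (a 0 i).
  by rewrite rmorphB /= mmapX mmap1U mmapC.
have xia : xi.@[a 0] = 0 by rewrite /meval evxi subrr.
have U p : p.@[a 0] = 0 -> exists r, evD q * evD p = evD r * evD xi.
  move=> /Uq[r ->]; exists r; rewrite evxi; congr (_ * _).
  rewrite (bigD1 i) //= mxE !eqxx rmorph1 mul1r big1 ?addr0 //.
  by move=> j /negPf nj; rewrite mxE nj andbF rmorph0 mul0r.
have qa' : ~ M (ev' q) by apply: (ev_unit pl a'a).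
have xi'0 : ev' xi != 0.
  have [j a'j] := a'_gen; apply: contraNneq a'j => xi0.
  have [|r er] := U ('X_j - (a 0 j)%:MP).
    by rewrite mevalB mevalXU mevalC subrr.
  have := @base_eq (q * ('X_j - (a 0 j)%:MP)) (r * xi); rewrite !rmorphM /= => /(_ er).
  rewrite rmorphB /= mmapX mmap1U mmapC xi0 mulr0 => /eqP.
  by rewrite mulf_eq0 (negPf (pl_unit_neq0 pl qa')) subr_eq0.
exists xi; split=> //; first by exists q.
move=> p; have [D0 /(_ D0 (leqnn _)) [P hP eP]] := homogenise wD lam1 p.
have [D1 /(_ D1 (leqnn _)) [Xi hXi eXi]] := homogenise wD lam1 xi.
move=> p0 flp; case/negP: p0.
rewrite -(eP _ _ _ (chart_normalised lamD)) (chart_homog_eq0 lamD hP).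
have Mxi : M (ev' xi) by apply: (ev_id0 pl a'a).
have Pr := flat_prime_of pl Mxi xi'0.
apply: (curve_point_generic Pr D_curve (z := a') (a := a)) hP _ => //.
- by move=> j; apply: (red_integral pl a'a).
- move=> g; apply: (@normalised_block _ _ wD _ _ iota lam1 a' (flat O (ev' xi)) g _ _ _ _ (na' g)).
  + exact: (pr_id0 Pr).
  + exact: (pr_idD Pr).
  + by move=> c x; apply: (pr_idM Pr); apply: (pl_const pl).
  + exact: (pr_id1 Pr).
- by move=> s d _ /a'D ->; apply: (pr_id0 Pr).
- exact: aD.1.
- by move=> s d _ fs; apply: (ev_id pl a'a); apply: (flat_id pl Mxi xi'0 fs).
- exists (fun=> D1), Xi; split=> //; first by rewrite /meval (eXi _ _ _ na).
  by rewrite (eXi _ _ _ na'); apply: (flat_self pl Mxi xi'0).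
- by rewrite (eP _ _ _ na').
Qed.

Variable xi : R.
Hypotheses (xia : xi.@[a 0] = 0) (xi0 : ev' xi != 0)
  (xiU : exists2 q, q.@[a 0] != 0 & forall p, p.@[a 0] = 0 ->
    exists r, evD q * evD p = evD r * evD xi)
  (xiB : forall p, evD p != 0 -> ~ flat O (ev' xi) (ev' p)).

Let Mxi : M (ev' xi) := ev_id0 pl a'a xia.

Lemma base_eq0 p : (evD p == 0) = (ev' p == 0).
Proof.
apply/eqP/eqP => [/base_specialise //|p0]; apply/eqP/negPn/negP => /xiB; apply.
by rewrite p0; apply: (flat0 pl).
Qed.

(** Divide by [xi] until a unit is left, which happens since the order is bounded. *)
Lemma base_factor p : evD p != 0 -> exists k u q,
  [/\ u.@[a 0] != 0, q.@[a 0] != 0 & evD q * evD p = evD xi ^+ k * evD u].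
Proof.
move=> p0; have [k] := Classical_Pred_Type.not_all_ex_not _ _ (xiB p0).
elim: k p p0 => [|k IH] p p0 nO.
  by case: nO; rewrite expr0 divr1; apply: (ev_integral pl a'a).
case: (altP (p.@[a 0] =P 0)) => [pa|pa]; last first.
  by exists 0%N, p, 1; rewrite meval1 oner_neq0 rmorph1 expr0.
have [q qa /(_ p pa) [r er]] := xiU.
have qu := ev_unit pl a'a qa.
have e' : ev' q * ev' p = ev' r * ev' xi.
  by have := @base_eq (q * p) (r * xi); rewrite !rmorphM; apply.
have r0 : evD r != 0.
  rewrite base_eq0; apply/eqP => r0; move/eqP: e'; rewrite r0 mul0r mulf_eq0.
  by rewrite (negPf (pl_unit_neq0 pl qu)) -base_eq0 (negPf p0).
case: (IH r r0) => [Or|j [u [s [ua sa es]]]].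
  apply: nO.
  have -> : ev' p / ev' xi ^+ k.+1 = (ev' q)^-1 * (ev' r / ev' xi ^+ k).
    have -> : ev' p = (ev' q)^-1 * (ev' r * ev' xi).
      by rewrite -e' mulKf // (pl_unit_neq0 pl qu).
    by rewrite exprS; field; rewrite !expf_neq0 // xi0 (pl_unit_neq0 pl qu).
  apply: (plM pl) => //; apply: (pl_unit pl) => //; exact: (ev_integral pl a'a).
exists j.+1, u, (s * q); split=> //; first by rewrite mevalM mulf_neq0.
by rewrite rmorphM /= -mulrA er mulrA es exprS; ring.
Qed.

(** The fraction is a unit times a power of [xi], and its value at [a'] is not
    integral when this power is negative. *)
Lemma base_ratio p l : evD l != 0 -> O (ev' p / ev' l) -> exists r q,
  q.@[a 0] != 0 /\ evD q * evD p = evD r * evD l.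
Proof.
move=> l0 Opl; case: (altP (evD p =P 0)) => [p0|p0].
  by exists 0, 1; rewrite meval1 oner_neq0 p0 mulr0 rmorph0 mul0r.
have [k [u [q [ua qa e]]]] := base_factor p0.
have [j [s [t [sa ta e2]]]] := base_factor l0.
have toK x y c d i : evD x * evD y = evD c ^+ i * evD d -> ev' x * ev' y = ev' c ^+ i * ev' d.
  move=> h; have := @base_eq (x * y) (c ^+ i * d).
  by rewrite !rmorphM !rmorphXn; apply.
have e' := toK _ _ _ _ _ e; have e2' := toK _ _ _ _ _ e2.
case: (leqP j k) => [le|lt].
  exists (t * xi ^+ (k - j) * u), (q * s); split; first by rewrite mevalM mulf_neq0.
  rewrite !rmorphM rmorphXn /=.
  transitivity (evD s * (evD q * evD p)); first by ring.
  transitivity (evD xi ^+ (k - j) * evD u * (evD t * evD l)); last by ring.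
  by rewrite e e2 -{1}(subnK le) exprD; ring.
have U w : w.@[a 0] != 0 -> ev' w != 0 /\ O (ev' w)^-1.
  move=> /(ev_unit pl a'a) nM; split; first exact: (pl_unit_neq0 pl).
  by apply: (pl_unit pl) => //; apply: (ev_integral pl a'a).
have [[u0 Ou] [q0 Oq]] := (U u ua, U q qa).
have [[s0 Os] [t0 Ot]] := (U s sa, U t ta).
case: (pl_idV pl Mxi xi0).
have -> : (ev' xi)^-1 = ev' xi ^+ (j - k).-1 *
    (ev' p / ev' l * (ev' q * ev' s * ((ev' u)^-1 * (ev' t)^-1))).
  have pE : ev' p = (ev' q)^-1 * (ev' xi ^+ k * ev' u) by rewrite -e' mulKf.
  have lE : ev' l = (ev' t)^-1 * (ev' xi ^+ j * ev' s) by rewrite -e2' mulKf.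
  have jE : j = ((j - k).-1 + k).+1 by rewrite -addSn prednK ?subn_gt0 // subnK // ltnW.
  rewrite pE lE {2}jE exprS exprD; field.
  by rewrite u0 q0 s0 t0 xi0 !expf_neq0.
apply: (plM pl); first by apply: (plX pl); apply: (pl_sub pl).
apply: (plM pl) => //; apply: (plM pl); last exact: (plM pl).
by apply: (plM pl); apply: (ev_integral pl a'a).
Qed.

End Base.

(** * The fibre over the generic point *)

Lemma ideal_scale (N : nat) (G : finType) (w : 'I_N -> G) (L : closedFieldType)
    (X : variety w L) (S : comNzRingType) (iota : {rmorphism L -> S})
    (z : 'I_N -> S) (c : G -> S) :
  (forall p, p \in mem_ideal X -> mmap iota z p = 0) ->
  forall p, p \in mem_ideal X -> mmap iota (fun i => c (w i) * z i) p = 0.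
Proof.
move=> zX p pX; rewrite -grev_scale (_ : grev w iota z p = 0) ?meval0 //.
apply/mpolyP => k; rewrite mcoeff0 -[k]deg_mnm_onto grev_coef zX //.
exact: videalH.
Qed.

Lemma pl_div (L K : fieldType) (iota : {rmorphism L -> K}) (O M : K -> Prop)
    (pl : place iota O M) x t u s :
  M (x - iota u) -> M (t - iota s) -> s != 0 -> t != 0 /\ M (x / t - iota (u / s)).
Proof.
move=> Mx Mt s0.
have Ot : O t by rewrite -(subrK (iota s) t); apply: (plD pl); [apply: (pl_sub pl) | apply: (pl_const pl)].
have nMt : ~ M t.
  move=> Mt'; case/eqP: s0; apply: (pl_id_const pl).
  by rewrite -(subKr t (iota s)); apply: (pl_idB pl).
have t0 := pl_unit_neq0 pl nMt; have Oti := pl_unit pl Ot nMt.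
split=> //; rewrite fmorph_div.
have is0 : iota s != 0 by rewrite fmorph_eq0.
have -> : x / t - iota u / iota s =
    t^-1 * ((x - iota u) - iota u / iota s * (t - iota s)) by field; rewrite t0 is0.
apply: (pl_idM pl) => //; apply: (pl_idB pl) => //; apply: (pl_idM pl) => //.
by rewrite -fmorph_div; apply: (pl_const pl).
Qed.

Lemma root_list (K : closedFieldType) (P : {poly K}) : P != 0 ->
  exists s : seq K, forall x, root P x -> x \in s.
Proof.
move=> P0; have [s sE] := closed_field_poly_normal P; exists s => x.
by rewrite {1}sE rootZ ?lead_coef_eq0 // root_prod_XsubC.
Qed.

HB.instance Definition _ (L : closedFieldType) (n m : nat) :=
  GRing.RMorphism.copy (@pr_poly L n m)
    (comp_mpoly [tuple 'X_(lshift m.+1 i) | i < n.+1]).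

Section Fibre.
Variables (L K : closedFieldType) (iota : {rmorphism L -> K}) (O M : K -> Prop).
Hypothesis pl : place iota O M.
Variables (n m : nat) (D : variety (@pn_block n) L) (F : variety (@pnpm_block n m) L).
Variables (a : 'rV[L]_n.+1) (b : 'rV[L]_m.+1) (lam1 : 'I_n.+1 -> L) (A : 'rV[K]_n.+1).
Local Notation wD := (@pn_block n).
Local Notation wF := (@pnpm_block n m).
Local Notation R := {mpoly L[n.+1]}.
Local Notation S := {mpoly L[n.+1 + m.+1]}.
Local Notation ls := (@lshift n.+1 m.+1).
Local Notation rs := (@rshift n.+1 m.+1).
Hypotheses (D_curve : curve D) (F_curve : curve F)
  (F_over_D : lies_over D F) (F_sep : pr_separable D F)
  (hab : on_variety F (row_mx a b)) (aD : on_variety D a)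
  (na : \sum_i lam1 i * a 0 i = 1) (nA : \sum_i iota (lam1 i) * A 0 i = 1)
  (AD : forall p, p \in mem_ideal D -> mmap iota (A 0) p = 0)
  (Aa : forall i, M (A 0 i - iota (a 0 i))).
Local Notation evD := (mmap (@cone_const _ _ _ _ D) (chart D lam1)).
Local Notation evA := (mmap iota (A 0)).
Variable xi : R.
Hypotheses (xia : xi.@[a 0] = 0) (xi0 : evA xi != 0)
  (xiB : forall p, evD p != 0 -> ~ flat O (evA xi) (evA p)).

Let Mxi : M (evA xi) := ev_id0 pl Aa xia.
Let naD : normalised wD idfun lam1 (a 0).
Proof. by apply/normalised_pn. Qed.
Let nAD : normalised wD iota lam1 (A 0).
Proof. by apply/normalised_pn. Qed.
Let lamD := chart_defined aD naD.

Definition on_fibre (y : 'rV[K]_m.+1) :=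
  forall p, p \in mem_ideal F -> mmap iota (row_mx A y 0) p = 0.

Lemma on_fibre_scale k y : on_fibre y -> on_fibre (k *: y).
Proof.
move=> yF p pF; have := ideal_scale (fun g : bool => if g then 1 else k) yF pF.
move=> e; rewrite -[RHS]e; apply: eq_ev => // i.
case: (split_ordP i) => j ->; first by rewrite pnpm_l !row_mxEl mul1r.
by rewrite pnpm_r !row_mxEr mxE.
Qed.

Lemma fibre_red (y : 'rV[K]_m.+1) (c : 'rV[L]_m.+1) :
  (forall j, M (y 0 j - iota (c 0 j))) ->
  forall i, M (row_mx A y 0 i - iota (row_mx a c 0 i)).
Proof.
by move=> yc i; case: (split_ordP i) => j ->; rewrite ?row_mxEl ?row_mxEr.
Qed.

Lemma ev_pr_row (T : comNzRingType) (j : {rmorphism L -> T}) (x : 'rV[T]_n.+1) y (p : R) :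
  mmap j (row_mx x y 0) (pr_poly m p) = mmap j (x 0) p.
Proof. by rewrite ev_pr_poly; apply: eq_ev => // i /=; rewrite row_mxEl. Qed.

(** The polynomials whose value at the point has infinite order are the equations
    of a subvariety of [F], which the pullback of [xi] shows to be larger than a
    point. *)
Lemma fibre_generic (y : 'rV[K]_m.+1) (c : 'rV[L]_m.+1) : c != 0 ->
  (forall j, M (y 0 j - iota (c 0 j))) -> on_fibre y ->
  forall p d, multihomog wF d p -> flat O (evA xi) (mmap iota (row_mx A y 0) p) ->
  p \in mem_ideal F.
Proof.
move=> c0 yc yF; have red := fibre_red yc.
have Pr := flat_prime_of pl Mxi xi0.
have [j0 cj0] : exists j, c 0 j != 0.
  apply: Classical_Prop.NNPP => nex; case/eqP: c0; apply/rowP => i; rewrite mxE.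
  by apply/eqP/negPn/negP => h; apply: nex; exists i.
apply: (curve_point_generic Pr F_curve (z := row_mx A y 0) (a := row_mx a c)) => //.
- by move=> i; apply: (red_integral pl red).
- case.
    have [i _ nfl] : exists2 i, wD i = tt & ~ flat O (evA xi) (A 0 i).
      apply: (@normalised_block _ _ wD _ _ iota lam1 (A 0) (flat O (evA xi)) tt _ _ _ _ (nAD tt)).
      + exact: (pr_id0 Pr).
      + exact: (pr_idD Pr).
      + by move=> k x; apply: (pr_idM Pr); apply: (pl_const pl).
      + exact: (pr_id1 Pr).
    by exists (ls i); rewrite ?pnpm_l ?row_mxEl.
  exists (rs j0); first by rewrite pnpm_r.
  rewrite row_mxEr => fy; case/eqP: cj0; apply: (pl_id_const pl).
  rewrite -(subKr (y 0 j0) (iota _)); apply: (pl_idB pl) => //.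
  exact: (flat_id pl Mxi xi0).
- by move=> p d _ /yF ->; apply: (pr_id0 Pr).
- case.
    have [i _ ai] := aD.1 tt; by exists (ls i); rewrite ?pnpm_l ?row_mxEl.
  by exists (rs j0); rewrite ?pnpm_r ?row_mxEr.
- by move=> p d _ fp; apply: (ev_id pl red); apply: (flat_id pl Mxi xi0 fp).
have [D1 /(_ D1 (leqnn _)) [Xi hXi eXi]] := homogenise wD lam1 xi.
exists (fun g => if g then D1 else 0%N), (pr_poly m Xi); split.
- exact: multihomog_pr_poly hXi.
- by rewrite /meval ev_pr_row (eXi _ _ _ naD).
- by rewrite ev_pr_row (eXi _ _ _ nAD); apply: (flat_self pl Mxi xi0).
Qed.

Section Chart.
Variable lam2 : 'I_m.+1 -> L.
Hypothesis lamF : forall g, ell wF (lam_pair lam1 lam2) g \notin mem_ideal F.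
Local Notation lam := (lam_pair lam1 lam2).
Local Notation evF := (mmap (@cone_const _ _ _ _ F) (chart F lam)).
Local Notation pb := (pullback F lam1 lam2).

Lemma pullback_kernel : same_kernel pb evA.
Proof.
move=> p; rewrite -(pullback_eq0 F_over_D lamF lamD hab na D_curve F_curve F_sep).
exact: (base_eq0 pl aD naD nAD AD xiB).
Qed.

Definition eval_over_base (Q : {poly R}) (T : S) : S := (map_poly (@pr_poly L n m) Q).[T].

Lemma ev_over_base (U : comNzRingType) (j : {rmorphism L -> U}) z Q T :
  mmap j z (eval_over_base Q T) = (map_poly (mmap j (z \o ls)) Q).[mmap j z T].
Proof.
rewrite /eval_over_base -horner_map -map_poly_comp; congr (_.[_]).
by apply: eq_map_poly => p; rewrite /= ev_pr_poly.
Qed.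

Lemma ev_over_base_row (x : 'rV[K]_n.+1) y Q T : mmap iota (row_mx x y 0) (eval_over_base Q T) =
  (map_poly (mmap iota (x 0)) Q).[mmap iota (row_mx x y 0) T].
Proof.
rewrite ev_over_base; congr (_.[_]); apply: eq_map_poly => p.
by apply: eq_ev => // i; rewrite /= row_mxEl.
Qed.

Lemma fibre_specialise (y : 'rV[K]_m.+1) p : \sum_j iota (lam2 j) * y 0 j = 1 -> on_fibre y ->
  evF p = 0 -> mmap iota (row_mx A y 0) p = 0.
Proof.
move=> ny yF; apply: (chart_specialise lamF) => //; apply/normalised_pnpm; split.
  by under eq_bigr do rewrite row_mxEl.
by under eq_bigr do rewrite row_mxEr.
Qed.

Lemma fibre_root (y : 'rV[K]_m.+1) Q T : \sum_j iota (lam2 j) * y 0 j = 1 -> on_fibre y ->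
  root (map_poly pb Q) (evF T) ->
  root (map_poly evA Q) (mmap iota (row_mx A y 0) T).
Proof.
move=> ny yF /rootP r; apply/rootP; rewrite -ev_over_base_row; apply: fibre_specialise => //.
by rewrite ev_over_base.
Qed.

End Chart.

(** Set to [1] a coordinate that does not vanish on [F]: the other coordinates are
    then roots of the specialisations at [a'] of their minimal polynomials. *)
Lemma fibre_finite : exists Phi : seq ('rV[K]_m.+1 * 'rV[L]_m.+1),
  (forall yc, yc \in Phi -> yc.2 != 0 /\ forall j, M (yc.1 0 j - iota (yc.2 0 j))) /\
  forall y, y != 0 -> on_fibre y -> exists yc k, [/\ yc \in Phi, k != 0 & y = k *: yc.1].
Proof.
have [i0 wi0 Xi0] := videalR F false.
case: (split_ordP i0) wi0 Xi0 => j0 ->; rewrite ?pnpm_l // => _ Xj0.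
pose lam2 (j : 'I_m.+1) : L := (j == j0)%:R.
have sum2 (T : comNzRingType) (j : {rmorphism L -> T}) (f : 'I_m.+1 -> T) :
    \sum_i j (lam2 i) * f i = f j0.
  rewrite (bigD1 j0) //= /lam2 eqxx rmorph1 mul1r big1 ?addr0 //.
  by move=> i /negPf ->; rewrite rmorph0 mul0r.
have lamF g : ell wF (lam_pair lam1 lam2) g \notin mem_ideal F.
  case: g.
    apply/negP => /(hab.2); rewrite -[meval _ _]/(mmap idfun _ _) ev_ell => /eqP.
    rewrite big_split_ord /= [X in _ + X]big_pred0 ?addr0; last by move=> j; rewrite pnpm_r.
    under eq_bigl do rewrite pnpm_l.
    by under eq_bigr do rewrite lam_pair_l row_mxEl; rewrite na oner_eq0.
  suff -> : ell wF (lam_pair lam1 lam2) false = 'X_(rs j0) by [].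
  rewrite /ell big_split_ord /= big_pred0 ?add0r; last by move=> j; rewrite pnpm_l.
  under eq_bigl do rewrite pnpm_r.
  rewrite (bigD1 j0) //= lam_pair_r /lam2 eqxx scale1r big1 ?addr0 //.
  by move=> j /negPf nj; rewrite lam_pair_r nj scale0r.
have ker := pullback_kernel lamF.
have rootsE j : exists s : seq K, forall y : 'rV[K]_m.+1, \sum_j iota (lam2 j) * y 0 j = 1 ->
    on_fibre y -> y 0 j \in s.
  have [Q Qsep Qr] := coordinate_algebraic F_over_D lamF lamD hab na D_curve F_curve F_sep (rs j).
  have Q0 : map_poly evA Q != 0.
    by rewrite -(map_poly_kernel _ ker); apply: separable_poly_neq0.
  have [s sE] := root_list Q0; exists s => y ny yF; apply: sE.
  have -> : y 0 j = mmap iota (row_mx A y 0) 'X_(rs j) by rewrite mmapX mmap1U row_mxEr.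
  by apply: (fibre_root lamF ny yF); rewrite mmapX mmap1U.
pose s j := proj1_sig (constructive_indefinite_description _ (rootsE j)).
have sP j (y : 'rV[K]_m.+1) : \sum_j iota (lam2 j) * y 0 j = 1 -> on_fibre y -> y 0 j \in s j.
  by rewrite /s; case: constructive_indefinite_description => /= ? ; apply.
pose Z := flatten [seq s j | j <- enum 'I_m.+1].
pose V := [seq \row_j nth 0 Z (f j) | f : {ffun 'I_m.+1 -> 'I_(size Z)}].
have kcE (y : 'rV[K]_m.+1) : exists kc : K * 'rV[L]_m.+1, y != 0 ->
    [/\ kc.1 != 0, kc.2 != 0 & forall j, M (kc.1 * y 0 j - iota (kc.2 0 j))].
  case: (altP (y =P 0)) => [|y0]; first by exists (0, 0).
  by have [k [c kcP]] := point_reduction pl y0; exists (k, c).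
pose kc y := proj1_sig (constructive_indefinite_description _ (kcE y)).
have kcP (y : 'rV[K]_m.+1) : y != 0 -> [/\ (kc y).1 != 0, (kc y).2 != 0 &
    forall j, M ((kc y).1 * y 0 j - iota ((kc y).2 0 j))].
  by rewrite /kc; case: constructive_indefinite_description.
exists [seq ((kc y).1 *: y, (kc y).2) | y <- V & y != 0]; split.
  move=> yc /mapP[y]; rewrite mem_filter => /andP[y0 _] ->; have [k0 c0 kM] := kcP y y0.
  by split=> //= j; rewrite mxE.
move=> y y0 yF; have [k0 c0 kM] := kcP y y0.
have yj0 : y 0 j0 != 0.
  apply: contraNneq Xj0 => yj0.
  apply: (@fibre_generic ((kc y).1 *: y) (kc y).2 c0 _ _ 'X_(rs j0) _ (@multihomog_mnm _ _ wF L _)).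
  - by move=> j; rewrite mxE.
  - exact: on_fibre_scale.
  - by rewrite mmapX mmap1U row_mxEr mxE yj0 mulr0; apply: (flat0 pl).
pose y1 : 'rV[K]_m.+1 := (y 0 j0)^-1 *: y.
have ny1 : \sum_j iota (lam2 j) * y1 0 j = 1 by rewrite sum2 mxE mulVf.
have y1F : on_fibre y1 by apply: on_fibre_scale.
have y10 : y1 != 0 by rewrite scaler_eq0 invr_eq0 (negPf yj0).
have y1V : y1 \in V.
  have Zj (j : 'I_m.+1) : y1 0 j \in Z.
    by apply/flattenP; exists (s j); [apply/map_f; rewrite mem_enum | apply: sP].
  have lt (j : 'I_m.+1) : (index (y1 0%R j) Z < size Z)%N by rewrite index_mem.
  apply/imageP; exists [ffun j => Ordinal (lt j)] => //.
  by apply/rowP => j; rewrite [RHS]mxE ffunE /= nth_index.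
have [k10 c10 _] := kcP y1 y10.
exists ((kc y1).1 *: y1, (kc y1).2), (y 0 j0 / (kc y1).1); split.
- by apply/mapP; exists y1; rewrite // mem_filter y10.
- by rewrite mulf_neq0 // invr_eq0.
- by rewrite /= scalerA divfK // /y1 scalerA divff // scale1r.
Qed.

(** A hyperplane in general position avoids [b] and the reductions of the points of
    the fibre. *)
Lemma fibre_chart : exists (lam2 : 'I_m.+1 -> L) (Phi : seq ('rV[K]_m.+1 * 'rV[L]_m.+1)),
  [/\ \sum_j lam2 j * b 0 j = 1,
    forall yc, yc \in Phi -> forall j, M (yc.1 0 j - iota (yc.2 0 j))
  & forall y : 'rV[K]_m.+1, \sum_j iota (lam2 j) * y 0 j = 1 -> on_fibre y ->
    exists c, (y, c) \in Phi].
Proof.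
have [Phi [PhiM PhiC]] := fibre_finite.
have b0 : b != 0.
  have [i] := hab.1 false; case: (split_ordP i) => j ->; rewrite ?pnpm_l // => _.
  by rewrite row_mxEr; apply: contraNneq => ->; rewrite mxE.
have [s sP] := avoid_hyperplanes iota
  (map_mx iota b :: [seq map_mx iota yc.2 | yc <- Phi]).
have sL (c : 'rV[L]_m.+1) : c != 0 -> map_mx iota c \in map_mx iota b :: [seq map_mx iota yc.2 | yc <- Phi] ->
    \sum_j c 0 j * s ^+ j != 0.
  move=> c0 cs; rewrite -(fmorph_eq0 iota) rmorph_sum /=.
  have := sP _ cs; rewrite map_mx_eq0 => /(_ c0); congr (_ != 0).
  by apply: eq_bigr => j _; rewrite mxE rmorphM rmorphXn.
pose t := \sum_j b 0 j * s ^+ j.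
have t0 : t != 0 by apply: sL => //; apply: mem_head.
pose lam2 (j : 'I_m.+1) := s ^+ j / t.
pose l2 (c : 'rV[L]_m.+1) := \sum_j lam2 j * c 0 j.
pose l2K (y : 'rV[K]_m.+1) := \sum_j iota (lam2 j) * y 0 j.
have l2E c : l2 c = (\sum_j c 0 j * s ^+ j) / t.
  by rewrite mulr_suml; apply: eq_bigr => j _; rewrite /lam2; ring.
exists lam2, [seq ((l2K yc.1)^-1 *: yc.1, (l2 yc.2)^-1 *: yc.2) | yc <- Phi].
have l2M yc : yc \in Phi -> M (l2K yc.1 - iota (l2 yc.2)) /\ l2 yc.2 != 0.
  move=> yc_P; have [c0 ycM] := PhiM _ yc_P; split.
    rewrite rmorph_sum -sumrB; apply: (pl_id_sum pl) => j _ /=.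
    by rewrite rmorphM -mulrBr; apply: (pl_idM pl) => //; apply: (pl_const pl).
  rewrite l2E mulf_neq0 ?invr_eq0 // sL //.
  by rewrite inE; apply/orP; right; apply/mapP; exists yc.
split.
- by rewrite -/(l2 b) l2E divff.
- move=> yc0 /mapP[yc yc_P ->] j /=; rewrite !mxE ![_^-1 * _]mulrC.
  have [ycM l20] := l2M _ yc_P; have [_ ycj] := PhiM _ yc_P.
  by have [_] := pl_div pl (ycj j) ycM l20.
- move=> y ny yF.
  have y0 : y != 0.
    apply: contraTneq isT => y0; have /eqP := ny.
    by rewrite big1 ?(eq_sym 0) ?oner_eq0 // => j _; rewrite y0 mxE mulr0.
  have [yc [k [yc_P k0 yE]]] := PhiC y y0 yF.
  have [ycM l20] := l2M _ yc_P.
  exists ((l2 yc.2)^-1 *: yc.2); apply/mapP; exists yc => //; congr (_, _).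
  have : k * l2K yc.1 = 1.
    rewrite -ny yE /l2K mulr_sumr; apply: eq_bigr => j _; rewrite mxE; ring.
  move=> kl; rewrite yE; congr (_ *: _).
  by apply: (mulIf (x := l2K yc.1)); rewrite ?kl ?mulVf //; have [] := pl_div pl ycM ycM l20.
Qed.

Hypotheses (F_smooth : smooth F).

(** Each of the properties required of a linear form excludes a hyperplane of
    coefficient vectors. *)
Lemma fibre_parameter lam2 (Phi : seq ('rV[K]_m.+1 * 'rV[L]_m.+1)) :
  \sum_j lam2 j * b 0 j = 1 ->
  let evF := mmap (@cone_const _ _ _ _ F) (chart F (lam_pair lam1 lam2)) in
  exists T : S, [/\ T.@[row_mx a b 0] = 0,
    exists2 q, q.@[row_mx a b 0] != 0 & forall p, p.@[row_mx a b 0] = 0 ->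
      exists r, evF q * evF p = evF r * evF T,
    forall yc, yc \in Phi -> T.@[row_mx a yc.2 0] = 0 -> yc.2 = b
  & forall yc yc', yc \in Phi -> yc' \in Phi ->
      mmap iota (row_mx A yc.1 0) T = mmap iota (row_mx A yc'.1 0) T -> yc.1 = yc'.1].
Proof.
move=> nb evF.
have nF : normalised wF idfun (lam_pair lam1 lam2) (row_mx a b 0).
  apply/normalised_pnpm; split; first by under eq_bigr do rewrite row_mxEl.
  by under eq_bigr do rewrite row_mxEr.
have [kap kap0 uni] := smooth_curve_uniformiser hab nF F_curve F_smooth isT.
pose vs := map_mx iota kap^T ::
  [seq row_mx 0 (map_mx iota (yc.2 - b)) | yc <- Phi] ++
  [seq row_mx 0 (yc.1 - yc'.1) | yc <- Phi, yc' <- Phi] : seq 'rV[K]_(n.+1 + m.+1).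
have [s sP] := avoid_hyperplanes iota vs.
pose alpha : 'rV[L]_(n.+1 + m.+1) := \row_i s ^+ i.
pose T : S := \sum_(i < n.+1 + m.+1) s ^+ i *: ('X_i - (row_mx a b 0 i)%:MP).
have evT (U : comNzRingType) (j : {rmorphism L -> U}) z :
    mmap j z T = \sum_(i < n.+1 + m.+1) j s ^+ i * (z i - j (row_mx a b 0 i)).
  rewrite rmorph_sum /=; apply: eq_bigr => i _.
  by rewrite mmapZ rmorphXn rmorphB /= mmapX mmap1U mmapC.
exists T; split.
- by rewrite /meval evT big1 // => i _; rewrite subrr mulr0.
- case: (uni alpha).
    apply: contraTneq isT => /rowP /(_ 0); rewrite !mxE => e.
    have := sP _ (mem_head _ _); rewrite map_mx_eq0 trmx_eq0 => /(_ kap0) /eqP; case.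
    rewrite -[RHS](rmorph0 iota) -[X in _ = iota X]e rmorph_sum; apply: eq_bigr => i _ /=.
    by rewrite !mxE rmorphM rmorphXn mulrC.
  move=> q q0 Uq; exists q => // p /Uq[r ->]; exists r; rewrite /evF evT; congr (_ * _).
  by apply: eq_bigr => i _; rewrite mxE rmorphXn.
- move=> yc yc_P; rewrite /meval evT => e.
  have vin : row_mx 0 (map_mx iota (yc.2 - b)) \in vs.
    by rewrite inE mem_cat; apply/orP; right; apply/orP; left; apply/mapP; exists yc.
  apply/eqP/negPn/negP => ne.
  have v0 : row_mx 0 (map_mx iota (yc.2 - b)) != 0 :> 'rV[K]_(n.+1 + m.+1).
    by rewrite row_mx_eq0 negb_and map_mx_eq0 subr_eq0 ne orbT.
  have /eqP := sP _ vin v0; apply.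
  rewrite -[RHS](rmorph0 iota) -[X in _ = iota X]e rmorph_sum; apply: eq_bigr => i _ /=.
  rewrite rmorphM rmorphXn mulrC; congr (_ * _).
  by case: (split_ordP i) => j ->; rewrite ?row_mxEl ?row_mxEr ?subrr ?mxE ?rmorph0.
- move=> yc yc' yc_P yc'_P; rewrite !evT => e.
  have vin : row_mx 0 (yc.1 - yc'.1) \in vs.
    rewrite inE mem_cat; apply/orP; right; apply/orP; right.
    by apply/allpairsP; exists (yc, yc').
  apply/eqP/negPn/negP => ne.
  have v0 : row_mx 0 (yc.1 - yc'.1) != 0 :> 'rV[K]_(n.+1 + m.+1).
    by rewrite row_mx_eq0 negb_and subr_eq0 ne orbT.
  have /eqP := sP _ vin v0; apply.
  move/eqP: e; rewrite -subr_eq0 -sumrB => /eqP e; rewrite -[RHS]e.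
  apply: eq_bigr => i _; rewrite -mulrBr mulrC; congr (_ * _).
  by case: (split_ordP i) => j ->; rewrite ?row_mxEl ?row_mxEr ?mxE; ring.
Qed.

End Fibre.

(** * Length of a quotient of a discrete valuation ring *)

Section UniformiserLength.
Variables (E : fieldType) (O : E -> Prop) (theta : E).
Hypotheses (O0 : O 0) (O1 : O 1) (OD : forall f g, O f -> O g -> O (f + g))
  (OM : forall f g, O f -> O g -> O (f * g)) (Otheta : O theta)
  (theta0 : theta != 0) (thetaV : ~ O theta^-1)
  (dvr : forall f, O f -> f != 0 /\ O f^-1 \/ exists2 g, O g & f = theta * g).

Definition multiples (k : nat) (f : E) := exists2 g, O g & f = theta ^+ k * g.

Lemma multiplesS k f : multiples k.+1 f -> multiples k f.
Proof. by case=> g Og ->; exists (theta * g); [apply: OM | rewrite exprSr mulrA]. Qed.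

Lemma multiples_ideal k : ideal_of O (multiples k).
Proof.
split.
- by move=> f [g Og ->]; apply: (OM _ Og); elim: k => [|k IH]; rewrite ?expr0 ?exprS //; apply: OM.
- by exists 0; rewrite ?mulr0.
- by move=> f g [f1 Of ->] [g1 Og ->]; exists (f1 + g1); [apply: OD | rewrite mulrDr].
- by move=> r f Or [g Og ->]; exists (r * g); [apply: OM | rewrite mulrCA].
Qed.

Lemma order_below k f : O f ->
  (exists l w, [/\ (l < k)%N, O w^-1, w != 0 & f = theta ^+ l * w]) \/ multiples k f.
Proof.
elim: k f => [|k IH] f Of; first by right; exists f; rewrite // expr0 mul1r.
case: (dvr Of) => [[f0 Ofi]|[g Og ->]].
  by left; exists 0%N, f; rewrite expr0 mul1r.
case: (IH g Og) => [[l [w [lt Ow w0 ->]]]|[h Oh ->]].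
  by left; exists l.+1, w; rewrite exprS mulrA.
by right; exists h; rewrite // exprS mulrA.
Qed.

(** Along a chain of ideals the least exponent of a power of [theta] in the ideal
    decreases strictly. *)
Lemma length_multiples (J : E -> Prop) e :
  (forall f, J f <-> multiples e f) -> quotient_length O J e.
Proof.
move=> JE; split.
  exists (fun i => multiples (e - i)); split.
  - by move=> f; rewrite subn0 JE.
  - move=> f; rewrite subnn; split=> [[g Og ->]|Of]; first by rewrite expr0 mul1r.
    by exists f; rewrite // expr0 mul1r.
  - by move=> i _; apply: multiples_ideal.
  - move=> i lt; rewrite -(subnSK lt); split=> [f|]; first exact: multiplesS.
    exists (theta ^+ (e - i.+1)); first by exists 1; rewrite ?mulr1.
    case=> g Og; rewrite exprSr -mulrA -{1}[theta ^+ _]mulr1 => /(mulfI (expf_neq0 _ theta0)) e1.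
    by apply: thetaV; rewrite -[theta^-1]mulr1 e1 mulKf.
move=> k [c [c0 ck cid cS]].
suff step i : (i <= k)%N -> exists2 j, (j + i <= e)%N & c i (theta ^+ j).
  by have [j le _] := step k (leqnn k); apply: leq_trans (leq_addl _ _) le.
elim: i => [_|i IH lt].
  exists e; first by rewrite addn0.
  by apply/c0/JE; exists 1; rewrite ?mulr1.
have [j le cj] := IH (ltnW lt); have [sub [f cf ncf]] := cS i lt.
have [OcS _ _ cSM] := cid i.+1 lt; have [_ _ _ ciM] := cid i (ltnW lt).
case: (order_below j (OcS f cf)) => [[l [w [ltl Ow w0 fE]]]|[g Og fE]].
  exists l; first by rewrite addnS -addSn; apply: leq_trans le; rewrite leq_add2r.
  have -> : theta ^+ l = w^-1 * f by rewrite fE mulrCA mulVf ?mulr1.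
  exact: cSM.
by case: ncf; rewrite fE mulrC; apply: ciM.
Qed.

End UniformiserLength.

(** * Counting the infinitesimal roots *)

Section RootCount.
Variables (L K : closedFieldType) (iota : {rmorphism L -> K}) (O M : K -> Prop).
Hypothesis pl : place iota O M.

Definition infinitesimal (x : K) : bool :=
  if excluded_middle_informative (M x) then true else false.

Lemma infinitesimalP x : reflect (M x) (infinitesimal x).
Proof. by rewrite /infinitesimal; case: excluded_middle_informative => h; constructor. Qed.

Lemma coef_cons_root (t : K) p i :
  (('X - t%:P) * p)`_i = (if i is j.+1 then p`_j else 0) - t * p`_i.
Proof. by rewrite mulrBl coefB coefXM coefCM; case: i. Qed.

Lemma prod_coef_integral (s : seq K) : (forall t, t \in s -> O t) ->
  forall i, O (\prod_(t <- s) ('X - t%:P))`_i.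
Proof.
elim: s => [|t s IH] Os i.
  by rewrite big_nil coefC; case: ifP => _; [apply: (pl1 pl) | apply: (pl0 pl)].
have {}IH : forall i, O (\prod_(t <- s) ('X - t%:P))`_i.
  by apply: IH => x xs; apply: Os; rewrite inE xs orbT.
rewrite big_cons coef_cons_root; apply: (plB pl).
  by case: i => [|i]; [apply: (pl0 pl) | apply: IH].
by apply: (plM pl) => //; apply: Os; apply: mem_head.
Qed.

(** Modulo [M] the product is ['X^r], for [r] the number of infinitesimal roots,
    times a polynomial with nonzero constant term. *)
Lemma prod_coef_unit (s : seq K) : (forall t, t \in s -> O t) ->
  ~ M (\prod_(t <- s) ('X - t%:P))`_(count infinitesimal s) /\
  forall i, (i < count infinitesimal s)%N -> M (\prod_(t <- s) ('X - t%:P))`_i.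
Proof.
elim: s => [|t s IH] Os.
  by rewrite big_nil coefC /=; split=> //; apply: (pl_id1 pl).
have Os' x : x \in s -> O x by move=> xs; apply: Os; rewrite inE xs orbT.
have Ot : O t by apply: Os; apply: mem_head.
have [nMr Mi] := IH Os'; have Oc := prod_coef_integral Os'.
rewrite big_cons /=; move: nMr Mi Oc.
set p : {poly K} := \prod_(u <- s) ('X - u%:P); set r := count _ s => nMr Mi Oc.
case: infinitesimalP => [Mt|nMt].
  rewrite add1n; split=> [|i]; rewrite coef_cons_root.
    move=> h; apply: nMr; rewrite -(subrK (t * p`_r.+1) p`_r).
    by apply: (pl_idD pl) => //; apply: (pl_idMr pl).
  move=> lt; apply: (pl_idB pl); last exact: (pl_idMr pl).
  by case: i lt => [|i] lt; [apply: (pl_id0 pl) | apply: Mi].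
rewrite add0n; split=> [|i lt]; rewrite coef_cons_root.
  move=> h; have : M (t * p`_r).
    rewrite -[t * _](subKr (if r is j.+1 then p`_j else 0)).
    apply: (pl_idB pl) => //; case: (r) Mi => [|j] Mi; first exact: (pl_id0 pl).
    exact: Mi.
  by case/(pl_prime pl).
apply: (pl_idB pl); last by apply: (pl_idM pl) => //; apply: Mi.
case: i lt => [|i] lt; first exact: (pl_id0 pl).
by apply: Mi; apply: ltnW.
Qed.

End RootCount.

Lemma frac_extract (E : fieldType) (r q q1 s t : E) : q != 0 -> q1 != 0 ->
  q1 * r = s * t -> r / q = t * (s / (q1 * q)).
Proof.
move=> q0 q10 e; apply: (mulIf q0); apply: (mulfI q10); rewrite divfK // e.
by field; rewrite q0 q10.
Qed.

Section Count.
Variables (L K : closedFieldType) (iota : {rmorphism L -> K}) (O M : K -> Prop).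
Hypothesis pl : place iota O M.
Variables (n m : nat) (D : variety (@pn_block n) L) (F : variety (@pnpm_block n m) L).
Variables (a : 'rV[L]_n.+1) (b : 'rV[L]_m.+1) (lam1 : 'I_n.+1 -> L) (A : 'rV[K]_n.+1).
Local Notation wD := (@pn_block n).
Local Notation wF := (@pnpm_block n m).
Local Notation R := {mpoly L[n.+1]}.
Local Notation S := {mpoly L[n.+1 + m.+1]}.
Local Notation ls := (@lshift n.+1 m.+1).
Local Notation rs := (@rshift n.+1 m.+1).
Hypotheses (D_curve : curve D) (F_curve : curve F)
  (F_over_D : lies_over D F) (F_sep : pr_separable D F)
  (hab : on_variety F (row_mx a b)) (aD : on_variety D a)
  (na : \sum_i lam1 i * a 0 i = 1) (nA : \sum_i iota (lam1 i) * A 0 i = 1)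
  (AD : forall p, p \in mem_ideal D -> mmap iota (A 0) p = 0)
  (Aa : forall i, M (A 0 i - iota (a 0 i))).
Local Notation evD := (mmap (@cone_const _ _ _ _ D) (chart D lam1)).
Local Notation evA := (mmap iota (A 0)).
Variable xi : R.
Hypotheses (xia : xi.@[a 0] = 0) (xi0 : evA xi != 0)
  (xiU : exists2 q, q.@[a 0] != 0 & forall p, p.@[a 0] = 0 ->
    exists r, evD q * evD p = evD r * evD xi)
  (xiB : forall p, evD p != 0 -> ~ flat O (evA xi) (evA p)).
Variables (lam2 : 'I_m.+1 -> L) (Phi : seq ('rV[K]_m.+1 * 'rV[L]_m.+1)) (T : S).
Local Notation lam := (lam_pair lam1 lam2).
Local Notation evF := (mmap (@cone_const _ _ _ _ F) (chart F lam)).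
Local Notation pb := (pullback F lam1 lam2).
Local Notation z := (row_mx a b).
Local Notation fib := (@on_fibre L K iota n m F A).
Local Notation evy y := (mmap iota (row_mx A y 0)).
Hypotheses (nb : \sum_j lam2 j * b 0 j = 1)
  (PhiM : forall yc, yc \in Phi -> forall j, M (yc.1 0 j - iota (yc.2 0 j)))
  (PhiC : forall y : 'rV[K]_m.+1, \sum_j iota (lam2 j) * y 0 j = 1 -> fib y ->
    exists c, (y, c) \in Phi)
  (Tz : T.@[z 0] = 0)
  (TU : exists2 q, q.@[z 0] != 0 & forall p, p.@[z 0] = 0 ->
      exists r, evF q * evF p = evF r * evF T)
  (Tother : forall yc, yc \in Phi -> T.@[row_mx a yc.2 0] = 0 -> yc.2 = b).

Let Mxi : M (evA xi) := ev_id0 pl Aa xia.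
Let naD : normalised wD idfun lam1 (a 0).
Proof. by apply/normalised_pn. Qed.
Let nAD : normalised wD iota lam1 (A 0).
Proof. by apply/normalised_pn. Qed.
Let lamD := chart_defined aD naD.
Let nF : normalised wF idfun lam (z 0).
Proof.
apply/normalised_pnpm; split; first by under eq_bigr do rewrite row_mxEl.
by under eq_bigr do rewrite row_mxEr.
Qed.
Let lamF := chart_defined hab nF.
Let ker : same_kernel pb evA.
Proof. by apply: (pullback_kernel pl D_curve F_curve F_over_D F_sep hab aD na nA AD xiB lamF). Qed.

Implicit Types y : 'rV[K]_m.+1.

Let theta := evF T.
Let x := pb xi.

(** ** The local ring of [F], with its residue map *)

Definition residue_at (f : cone_field F) (c : L) := exists p q,
  [/\ q.@[z 0] != 0, evF q * f = evF p & c * q.@[z 0] = p.@[z 0]].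

Let at_z p : evF p = 0 -> p.@[z 0] = 0.
Proof. by apply: (chart_specialise lamF (iota := idfun) nF hab.2). Qed.

Let ev_neq0 q : q.@[z 0] != 0 -> evF q != 0.
Proof. by apply: contraNneq => /at_z ->. Qed.

Lemma residue_ev p : residue_at (evF p) p.@[z 0].
Proof. by exists p, 1; rewrite meval1 oner_neq0 rmorph1 !(mul1r, mulr1). Qed.

Lemma residue_const c : residue_at (cone_const F c) c.
Proof. by have := residue_ev c%:MP; rewrite mmapC mevalC. Qed.

Lemma residueD f c g d : residue_at f c -> residue_at g d -> residue_at (f + g) (c + d).
Proof.
case=> [p [q [q0 e ec]]] [p' [q' [q'0 e' ec']]]; exists (q' * p + q * p'), (q * q').
rewrite !(rmorphM, rmorphD) /= -e -e' -ec -ec'; split; [by rewrite mulf_neq0| |]; ring.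
Qed.

Lemma residueM f c g d : residue_at f c -> residue_at g d -> residue_at (f * g) (c * d).
Proof.
case=> [p [q [q0 e ec]]] [p' [q' [q'0 e' ec']]]; exists (p * p'), (q * q').
rewrite !rmorphM /= -e -e' -ec -ec'; split; [by rewrite mulf_neq0| |]; ring.
Qed.

Lemma residueB f c g d : residue_at f c -> residue_at g d -> residue_at (f - g) (c - d).
Proof.
move=> hf hg; apply: residueD => //; rewrite -mulN1r -(mulN1r d).
by apply: residueM => //; rewrite -(rmorph1 (cone_const F)) -rmorphN; apply: residue_const.
Qed.

Lemma residue_uniq f c d : residue_at f c -> residue_at f d -> c = d.
Proof.
move=> hc hd; apply/eqP; rewrite -subr_eq0.
have [p [q [q0 e ec]]] := residueB hc hd.
rewrite subrr mulr0 in e; have := at_z (esym e); rewrite -ec => /eqP.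
by rewrite mulf_eq0 (negPf q0) orbF.
Qed.

Lemma residueV f c : c != 0 -> residue_at f c -> residue_at f^-1 c^-1.
Proof.
move=> c0 [p [q [q0 e ec]]].
have p0 : p.@[z 0] != 0 by rewrite -ec mulf_neq0.
exists q, p; split=> //; last by rewrite -ec mulKf.
have f0 : f != 0.
  by apply/eqP => f0; move: (ev_neq0 p0); rewrite -e f0 mulr0 eqxx.
by rewrite -e mulfK.
Qed.

Lemma residueX f c k : residue_at f c -> residue_at (f ^+ k) (c ^+ k).
Proof.
move=> h; elim: k => [|k IH]; last by rewrite !exprS; apply: residueM.
by rewrite !expr0 -(rmorph1 (cone_const F)); apply: residue_const.
Qed.

Lemma residue_sum (I : Type) (r : seq I) (P : pred I) f c :
  (forall i, P i -> residue_at (f i) (c i)) ->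
  residue_at (\sum_(i <- r | P i) f i) (\sum_(i <- r | P i) c i).
Proof.
move=> h; apply: (big_ind2 residue_at) => // [|f1 c1 f2 c2]; last exact: residueD.
by rewrite -(rmorph0 (cone_const F)); apply: residue_const.
Qed.

Lemma residue_theta : residue_at theta 0.
Proof. by rewrite -Tz; apply: residue_ev. Qed.

Lemma residue_div f : residue_at f 0 -> exists g d, residue_at g d /\ f = theta * g.
Proof.
case=> [p [q [q0 e]]]; rewrite mul0r => /esym pz.
have [q1 q10 /(_ p pz) [r er]] := TU.
have qE : evF (q1 * q) != 0 by apply: ev_neq0; rewrite mevalM mulf_neq0.
exists (evF r / evF (q1 * q)), (r.@[z 0] / (q1 * q).@[z 0]); split.
  exists r, (q1 * q); split; first by rewrite mevalM mulf_neq0.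
    by rewrite mulrC divfK.
  by rewrite divfK // mevalM mulf_neq0.
rewrite mulrA [theta * _]mulrC -er -e; apply: (mulIf qE); rewrite divfK //.
by rewrite rmorphM /=; ring.
Qed.

Lemma residue_pb p : residue_at (pb p) p.@[a 0].
Proof.
have -> : pb p = evF (pr_poly m p) by rewrite ev_pr_poly.
have -> : p.@[a 0] = (pr_poly m p).@[z 0] by rewrite /meval ev_pr_row.
exact: residue_ev.
Qed.

Lemma pb_eq p q : evD p = evD q -> pb p = pb q.
Proof.
move=> e; apply/eqP; rewrite -subr_eq0 -rmorphB; apply/eqP.
by apply: (pullback0 F_over_D lamF lamD); rewrite rmorphB /= e subrr.
Qed.

(** By [base_ratio], a function on [D] with integral value at [a'] is a fraction
    whose denominator is a unit at [a]. *)
Lemma residue_base p l : pb l != 0 -> O (evA p / evA l) -> exists c,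
  [/\ residue_at (pb p / pb l) c, M (evA p / evA l - iota c)
    & c = 0 -> exists g d, residue_at g d /\ pb p / pb l = x * g].
Proof.
move=> l0 Opl; have lA : evA l != 0 by rewrite -ker.
have lDE : evD l != 0 by rewrite (base_eq0 pl aD naD nAD AD xiB).
have [r [q [qa e]]] := base_ratio pl aD naD nAD AD Aa xia xi0 xiU xiB lDE Opl.
have epb : pb q * pb p = pb r * pb l by have := @pb_eq (q * p) (r * l); rewrite !rmorphM; apply.
have eA : evA q * evA p = evA r * evA l.
  by have := base_eq aD naD nAD AD (p := q * p) (q := r * l); rewrite !rmorphM; apply.
have pbq0 (t : R) : t.@[a 0] != 0 -> pb t != 0.
  move=> ta; apply/eqP => t0; have := residue_pb t; rewrite t0 => h.
  case/eqP: ta; apply: residue_uniq h _.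
  by rewrite -(rmorph0 (cone_const F)); apply: residue_const.
have q0 := pbq0 q qa.
have [qA0 Mq] := pl_div pl (ev_reduce pl Aa r) (ev_reduce pl Aa q) qa.
have E1 : pb p / pb l = pb r / pb q.
  by apply/eqP; rewrite (eqr_div _ _ l0 q0) [X in X == _]mulrC epb.
exists (r.@[a 0] / q.@[a 0]); rewrite E1; split.
- by apply: residueM (residue_pb r) _; apply: residueV (residue_pb q).
- suff -> : evA p / evA l = evA r / evA q by [].
  by apply/eqP; rewrite (eqr_div _ _ lA qA0) [X in X == _]mulrC eA.
move/eqP; rewrite mulf_eq0 invr_eq0 (negPf qa) orbF => /eqP ra.
have [q1 q1a /(_ r ra) [r1 er]] := xiU.
have er' : pb q1 * pb r = pb r1 * x by have := @pb_eq (q1 * r) (r1 * xi); rewrite !rmorphM; apply.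
have q10 := pbq0 q1 q1a.
exists (pb r1 / (pb q1 * pb q)), (r1.@[a 0] / (q1.@[a 0] * q.@[a 0])); split.
  apply: residueM (residue_pb r1) _; apply: residueV; first by rewrite mulf_neq0.
  by apply: residueM; apply: residue_pb.
exact: (frac_extract q0 q10 er').
Qed.

Lemma x_neq0 : x != 0. Proof. by rewrite ker. Qed.

Lemma theta_neq0 : theta != 0.
Proof.
have := residue_pb xi; rewrite xia => /residue_div[g [d [_ xE]]].
by apply: contraNneq x_neq0 => t0; rewrite /x xE t0 mul0r.
Qed.

(** ** Roots and points of the fibre *)

Lemma fibre_nonflat y (p : S) : \sum_j iota (lam2 j) * y 0 j = 1 -> fib y ->
  evF p != 0 -> ~ flat O (evA xi) (evy y p).
Proof.
move=> ny yF p0 fl; have [c yc] := PhiC ny yF; have ycM := PhiM yc.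
have c0 : c != 0.
  apply/eqP => c0; apply: (pl_id1 pl); rewrite -ny; apply: (pl_id_sum pl) => j _.
  apply: (pl_idM pl); first exact: (pl_const pl).
  by have := ycM j; rewrite /= c0 mxE rmorph0 subr0.
have [D1 /(_ D1 (leqnn _)) [P hP eP]] := homogenise wF lam p.
have nY : normalised wF iota lam (row_mx A y 0).
  apply/normalised_pnpm; split; first by under eq_bigr do rewrite row_mxEl.
  by under eq_bigr do rewrite row_mxEr.
case/negP: p0; rewrite -(eP _ _ _ (chart_normalised lamF)) (chart_homog_eq0 lamF hP).
apply: (fibre_generic pl F_curve aD na nA Aa xia xi0 c0 ycM yF hP).
by rewrite (eP _ _ _ nY).
Qed.

Variable P : {poly R}.
Hypothesis minP : minimal_over pb theta P.

Lemma theta_algebraic : exists2 Q : {poly R},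
  separable_poly (map_poly pb Q) & root (map_poly pb Q) theta.
Proof.
apply: (rational_algebraic F_over_D lamF lamD hab na D_curve F_curve F_sep).
by apply/(rational_chart lamF); exists T, 1; rewrite rmorph1 oner_eq0 divr1.
Qed.

Lemma minimal_separable : separable_poly (map_poly pb P).
Proof.
have [Q Qsep Qr] := theta_algebraic.
by apply: dvdp_separable Qsep; apply: (minimal_dvd minP).
Qed.

Lemma pb_over_base Q U : evF (eval_over_base Q U) = (map_poly pb Q).[evF U].
Proof. exact: ev_over_base. Qed.

(** The coordinates of the generic point of [F] are algebraic over the function
    field of [D], so that specialising [theta] to [rho] extends to them. *)
Lemma root_lift rho : root (map_poly evA P) rho -> exists y : 'rV[K]_m.+1,
  [/\ \sum_j iota (lam2 j) * y 0 j = 1, fib y & evy y T = rho].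
Proof.
move=> rP.
have c1 : commr_rmorph pb theta by move=> r; apply: mulrC.
have c2 : commr_rmorph evA rho by move=> r; apply: mulrC.
have ker' : same_kernel (horner_morph c1) (horner_morph c2) := simple_extension ker minP rP.
have alg f : f \in [seq chart F lam (rs j) | j <- enum 'I_m.+1] ->
    algebraic_over (horner_morph c1) f.
  case/mapP=> j _ ->.
  have [Q Qsep Qr] := coordinate_algebraic F_over_D lamF lamD hab na D_curve F_curve F_sep (rs j).
  have e : map_poly (horner_morph c1) (map_poly polyC Q) = map_poly pb Q.
    by apply/polyP => i; rewrite !coef_map /= horner_morphC.
  by exists (map_poly polyC Q); rewrite e //; apply: separable_poly_neq0.
have [U [j [g1 [g2 [e1 e2 kerU gen]]]]] := extend_generators ker' alg.
have genj k : exists s, g1 s = chart F lam (rs k).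
  by apply: gen; apply: map_f; rewrite mem_enum.
pose r k := proj1_sig (constructive_indefinite_description _ (genj k)).
have rE k : g1 (r k) = chart F lam (rs k).
  by rewrite /r; case: constructive_indefinite_description.
pose c : {rmorphism L -> U} := j \o (@polyC R \o @mpolyC n.+1 L).
pose zU i := match split i with inl k => j ('X_k)%:P | inr k => r k end.
pose y : 'rV[K]_m.+1 := \row_k g2 (r k).
have g1E p : g1 (mmap c zU p) = evF p.
  rewrite ev_morph; apply: eq_ev => [t|i] /=.
    by rewrite e1 /= horner_morphC /= /pullback mmapC.
  rewrite /zU; case: (split_ordP i) => k ->; last by rewrite rE.
  by rewrite e1 /= horner_morphC /= /pullback mmapX mmap1U.
have g2E p : g2 (mmap c zU p) = evy y p.
  rewrite ev_morph; apply: eq_ev => [t|i] /=.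
    by rewrite e2 /= horner_morphC /= mmapC.
  rewrite /zU; case: (split_ordP i) => k ->; last by rewrite row_mxEr mxE.
  by rewrite e2 /= horner_morphC /= mmapX mmap1U row_mxEl.
have g12 s : g1 s = 0 -> g2 s = 0 by move/eqP; rewrite kerU => /eqP.
exists y; split.
- have : g2 (\sum_k c (lam2 k) * r k - 1) = 0.
    apply: g12; rewrite rmorphB rmorph1 rmorph_sum /=.
    have /normalised_pnpm[_ <-] := chart_normalised lamF.
    apply/eqP; rewrite subr_eq0; apply/eqP; apply: eq_bigr => k _.
    by rewrite rmorphM rE /= e1 /= horner_morphC /= /pullback mmapC.
  rewrite rmorphB rmorph1 rmorph_sum /= => /eqP; rewrite subr_eq0 => /eqP <-.
  by apply: eq_bigr => k _; rewrite rmorphM /= e2 /= horner_morphC /= mmapC mxE.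
- by move=> p pF; rewrite -g2E; apply: g12; rewrite g1E (chart_ideal lamF).
- have : g2 (mmap c zU T - j 'X) = 0.
    by apply: g12; rewrite rmorphB /= g1E e1 /= horner_morphX subrr.
  by rewrite rmorphB /= g2E e2 /= horner_morphX => /eqP; rewrite subr_eq0 => /eqP.
Qed.

(** Here the choice of [T] matters: among the reductions of the points of the
    fibre it vanishes at [b] only. *)
Lemma root_reduction y : \sum_j iota (lam2 j) * y 0 j = 1 -> fib y ->
  O (evy y T) /\ (M (evy y T) <-> forall j, M (y 0 j - iota (b 0 j))).
Proof.
move=> ny yF; have [c yc] := PhiC ny yF; have red := fibre_red Aa (PhiM yc).
split; first exact: (ev_integral pl red).
split=> [MT|yb]; last by apply: (ev_id0 pl (fibre_red Aa yb)).
have Tc : T.@[row_mx a c 0] = 0 by apply: (ev_id pl red).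
by have := Tother yc Tc; rewrite /= => <-; apply: (PhiM yc).
Qed.

Lemma fibre_is_root y : \sum_j iota (lam2 j) * y 0 j = 1 -> fib y ->
  root (map_poly evA P) (evy y T).
Proof. by move=> ny yF; apply: (fibre_root nA lamF ny yF); case: minP. Qed.

(** The derivative of [P] does not vanish at [theta], by separability, so its values
    at the roots are nonzero and even of finite order, by [fibre_nonflat]; they
    are multiples of the differences of two roots. *)
Lemma roots_exist : exists s : seq K,
  [/\ map_poly evA P = evA (lead_coef P) *: \prod_(t <- s) ('X - t%:P),
    evA (lead_coef P) != 0, uniq s, forall t, t \in s -> O t
  & forall t t', t \in s -> t' \in s -> t != t' -> ~ flat O (evA xi) (t - t')].
Proof.
have [lP rP _] := minP.
have lA : evA (lead_coef P) != 0 by rewrite -ker.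
have [s sE] := closed_field_poly_normal (map_poly evA P).
rewrite lead_coef_map_eq // in sE.
have sroot t : t \in s -> root (map_poly evA P) t.
  by move=> ts; rewrite sE rootZ // root_prod_XsubC.
have Os t : t \in s -> O t.
  by move=> /sroot/root_lift[y [ny yF <-]]; case: (root_reduction ny yF).
have der t : t \in s -> ~ flat O (evA xi) ((map_poly evA P)^`()).[t].
  move=> /sroot/root_lift[y [ny yF <-]]; rewrite deriv_map -ev_over_base_row.
  apply: (fibre_nonflat ny yF); rewrite pb_over_base -deriv_map.
  have := minimal_separable; rewrite separable_poly.unlock => sep.
  by apply/negP => rd; case/negP: (coprimep_root sep rP).
have uniq_s : uniq s.
  rewrite -separable_prod_XsubC separable_poly.unlock; apply/Pdiv.ClosedField.coprimepP => t.
  rewrite root_prod_XsubC => ts; apply/negP => /rootP d0; apply: (der t ts).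
  by rewrite sE derivZ hornerZ d0 mulr0; apply: (flat0 pl).
exists s; split=> // t t' ts t's ne fl; apply: (der t ts).
have t'r : t' \in rem t s by rewrite mem_rem_uniq // inE eq_sym ne.
rewrite sE derivZ hornerZ (big_rem t) //= derivM hornerD !hornerM hornerXsubC subrr mul0r addr0.
rewrite derivXsubC hornerC mul1r (big_rem t') //= hornerM hornerXsubC.
rewrite [(t - t') * _]mulrC mulrA; apply: (flatM pl) => //; apply: (plM pl).
  exact: (ev_integral pl Aa).
rewrite horner_prod big_seq; apply: (pl_prod pl) => t2 t2r; rewrite hornerXsubC.
by apply: (plB pl); apply: Os => //; apply: mem_rem (mem_rem t2r).
Qed.

(** ** Comparison with the ramification index *)

Lemma residue0 : residue_at 0 0.
Proof. by rewrite -(rmorph0 (cone_const F)); apply: residue_const. Qed.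

Lemma minimal_relation : \sum_(i < size P) pb P`_i / pb (lead_coef P) * theta ^+ i = 0.
Proof.
have [_ /rootP rP _] := minP.
rewrite (horner_coef_wide _ (size_poly _ _)) in rP.
transitivity ((pb (lead_coef P))^-1 * \sum_(i < size P) (map_poly pb P)`_i * theta ^+ i).
  by rewrite mulr_sumr; apply: eq_bigr => i _; rewrite coef_map /= mulrA [_^-1 * _]mulrC.
by rewrite rP mulr0.
Qed.

(** Modulo the infinitesimals the minimal polynomial starts in degree at most
    the number of infinitesimal roots, while its lower coefficients are
    divisible by [x]. *)
Lemma ramification_le s :
  map_poly evA P = evA (lead_coef P) *: \prod_(t <- s) ('X - t%:P) ->
  evA (lead_coef P) != 0 -> (forall t, t \in s -> O t) ->
  exists e u d, [/\ residue_at u d, d != 0, x = theta ^+ e * u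
    & (e <= count (infinitesimal M) s)%N].
Proof.
move=> sE lA Os; set l := lead_coef P in sE lA *.
have pbl : pb l != 0 by rewrite ker.
have oE i : evA P`_i / evA l = (\prod_(t <- s) ('X - t%:P))`_i.
  by rewrite -coef_map /= sE coefZ mulrC mulKf.
have Oo := prod_coef_integral pl Os; have [nMr _] := prod_coef_unit pl Os.
have cE i : exists c, [/\ residue_at (pb P`_i / pb l) c,
    M (evA P`_i / evA l - iota c)
    & c = 0 -> exists g d, residue_at g d /\ pb P`_i / pb l = x * g].
  by apply: residue_base => //; rewrite oE.
pose c i := proj1_sig (constructive_indefinite_description _ (cE i)).
have cP i : [/\ residue_at (pb P`_i / pb l) (c i), M (evA P`_i / evA l - iota (c i))
    & c i = 0 -> exists g d, residue_at g d /\ pb P`_i / pb l = x * g].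
  by rewrite /c; case: constructive_indefinite_description.
have cr0 : c (count (infinitesimal M) s) != 0.
  apply/eqP => cr; apply: nMr; have [_ h _] := cP (count (infinitesimal M) s).
  by rewrite cr rmorph0 subr0 oE in h.
have [i0 ci0 mini0] := ex_minnP (ex_intro (fun i => c i != 0) _ cr0).
have i0P : (i0 < size P)%N.
  rewrite ltnNge; apply/negP => le; case/eqP: ci0.
  have [h _ _] := cP i0; rewrite nth_default // rmorph0 mul0r in h.
  exact: residue_uniq h residue0.
have bound k g d : residue_at g d -> x = theta ^+ k * g -> (k <= i0)%N.
  move=> hg xE; rewrite leqNgt; apply/negP => lt.
  (* every other term of the relation is [theta ^+ i0] times a function that
     vanishes at [z] *)
  have hE (i : 'I_(size P)) : exists h, residue_at h (if val i == i0 then c i0 else 0) /\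
      pb P`_i / pb l * theta ^+ i = theta ^+ i0 * h.
    have [fi _ fx] := cP i; case: (ltngtP (val i) i0) => [lti|gti|ei].
    - have ci : c i = 0.
        by apply/eqP/negPn/negP => /mini0; rewrite leqNgt lti.
      have [g1 [d1 [hg1 ->]]] := fx ci.
      exists (theta ^+ (k - i0) * g * g1 * theta ^+ i); split.
        have -> : 0 = 0 ^+ (k - i0) * d * d1 * 0 ^+ i :> L.
          by rewrite expr0n subn_eq0 leqNgt lt !mul0r.
        by apply: residueM (residueX _ residue_theta); apply: residueM hg1;
          apply: residueM hg; apply: residueX residue_theta.
      have kE : theta ^+ k = theta ^+ i0 * theta ^+ (k - i0).
        by rewrite -exprD subnKC // ltnW.
      by rewrite xE kE !mulrA.
    - exists (pb P`_i / pb l * theta ^+ (i - i0)); split.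
        have -> : 0 = c i * 0 ^+ (i - i0) :> L.
          by rewrite expr0n subn_eq0 leqNgt gti mulr0.
        exact: residueM fi (residueX _ residue_theta).
      have iE : theta ^+ i = theta ^+ i0 * theta ^+ (i - i0).
        by rewrite -exprD subnKC // ltnW.
      by rewrite iE mulrCA.
    - exists (pb P`_i / pb l); rewrite -ei; split=> //.
      by rewrite mulrC.
  pose h i := proj1_sig (constructive_indefinite_description _ (hE i)).
  have hP i : residue_at (h i) (if val i == i0 then c i0 else 0) /\
      pb P`_i / pb l * theta ^+ i = theta ^+ i0 * h i.
    by rewrite /h; case: constructive_indefinite_description.
  have H0 : \sum_i h i = 0.
    apply: (mulfI (expf_neq0 i0 theta_neq0)); rewrite mulr0 mulr_sumr -[RHS]minimal_relation.
    by apply: eq_bigr => i _; case: (hP i) => _ ->.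
  have := residue_sum (index_enum 'I_(size P)) (P := xpredT) (fun i _ => (hP i).1).
  rewrite H0 (bigD1 (Ordinal i0P)) //= eqxx big1 ?addr0.
    by move=> hc; case/eqP: ci0; apply: residue_uniq hc residue0.
  by move=> i; rewrite -val_eqE /= => /negPf ->.
pose dec k : bool := if excluded_middle_informative
  (exists g d, residue_at g d /\ x = theta ^+ k * g) then true else false.
have decP k : reflect (exists g d, residue_at g d /\ x = theta ^+ k * g) (dec k).
  by rewrite /dec; case: excluded_middle_informative => h; constructor.
have dec0 : exists k, dec k.
  exists 0%N; apply/decP; exists x, xi.@[a 0]; split; first exact: residue_pb.
  by rewrite expr0 mul1r.
have decB k : dec k -> (k <= i0)%N by move=> /decP[g [d [hg xE]]]; apply: bound hg xE.
have [e /decP[u [d [hu xE]]] maxe] := ex_maxnP dec0 decB.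
exists e, u, d; split=> //.
  apply/eqP => d0; rewrite d0 in hu; have [g [d' [hg uE]]] := residue_div hu.
  have /maxe : dec e.+1.
    by apply/decP; exists g, d'; split=> //; rewrite xE uE exprSr mulrA.
  by rewrite ltnn.
by apply: leq_trans (bound e u d hu xE) (mini0 _ cr0).
Qed.

(** The beginning of the Taylor expansion of [f] in the uniformiser [theta]. *)
Lemma theta_expansion k f c : residue_at f c -> exists (l : {poly L}) g d,
  [/\ (size l <= k)%N, residue_at g d &
    f = (map_poly (cone_const F) l).[theta] + theta ^+ k * g].
Proof.
elim: k f c => [|k IH] f c hf.
  exists 0, f, c; rewrite size_poly0 rmorph0 horner0 add0r expr0 mul1r; split=> //.
have [f1 [c1 [hf1 e1]]] : exists f1 c1, residue_at f1 c1 /\ f - cone_const F c = theta * f1.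
  by apply: residue_div; rewrite -(subrr c); apply: residueB hf (residue_const c).
have [l [g [d [sl hg e2]]]] := IH f1 c1 hf1.
exists (l * 'X + c%:P), g, d; split=> //.
  rewrite size_MXaddC; by case: ifP.
rewrite rmorphD rmorphM /= map_polyX map_polyC hornerD hornerMX hornerC /=.
rewrite -(subrK (cone_const F c) f) e1 e2 exprS mulrDr [theta * (theta ^+ k * g)]mulrA.
by rewrite [theta * _.[theta]]mulrC addrAC.
Qed.

Variables (e : nat) (u : cone_field F) (d : L).
Hypotheses (hu : residue_at u d) (d0 : d != 0) (xE : x = theta ^+ e * u).

(** Expand up to the power [theta ^+ e], which is [x] up to a unit, and repeat with
    the cofactor of [x]. *)
Lemma base_expansion N f c : residue_at f c -> exists (B : {poly R}) g c',
  [/\ (size B <= e)%N, residue_at g c' &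
    f = (map_poly pb B).[theta] + x ^+ N * g].
Proof.
move=> hf; elim: N => [|N [B [g [c1 [sB hg e1]]]]].
  exists 0, f, c; rewrite size_poly0 rmorph0 horner0 add0r expr0 mul1r; split=> //.
have [l [g1 [c2 [sl hg1 e2]]]] := theta_expansion e hg.
have u0 : u != 0.
  by apply: contraNneq x_neq0 => u0; rewrite xE u0 mulr0.
have e3 : theta ^+ e * g1 = x * (u^-1 * g1) by rewrite xE mulrA mulfK.
exists (B + xi ^+ N *: map_poly (@mpolyC n.+1 L) l), (u^-1 * g1), (d^-1 * c2); split.
- apply: leq_trans (size_polyD _ _) _; rewrite geq_max sB /=.
  apply: leq_trans (size_scale_leq _ _) _; apply: leq_trans (size_poly _ _) sl.
- by apply: residueM hg1; apply: residueV hu.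
have mE : map_poly pb (map_poly (@mpolyC n.+1 L) l) = map_poly (cone_const F) l.
  by rewrite -map_poly_comp; apply: eq_map_poly => t /=; rewrite /pullback mmapC.
rewrite -mul_polyC rmorphD rmorphM /= map_polyC hornerD hornerM hornerC mE /=.
by rewrite rmorphXn -/x e1 e2 e3 mulrDr addrA exprSr -mulrA.
Qed.

(** Apply [base_expansion] to [theta ^+ e] and evaluate at the points of the fibre
    infinitely near to [b], where regular functions have integral values. *)
Lemma infinitesimal_roots_le s : uniq s ->
  (forall t, t \in s -> root (map_poly evA P) t /\ M t) ->
  (forall t t', t \in s -> t' \in s -> t != t' -> ~ flat O (evA xi) (t - t')) ->
  (size s <= e)%N.
Proof.
move=> us rs_s sep; apply: (close_roots pl Mxi xi0 us sep) => k.
have [B [g [c [sB [p [q [q0 eg _]]] eB]]]] := base_expansion k (residueX e residue_theta).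
have szE : size ('X^e - B) = e.+1.
  by rewrite size_polyDl size_polyXn // size_polyN.
exists ('X^e - map_poly evA B).
  have szB : (size (- map_poly evA B) <= e)%N.
    by rewrite size_polyN; apply: leq_trans (size_poly _ _) sB.
  split; last by rewrite size_polyDl size_polyXn.
  by rewrite monicE lead_coefDl ?size_polyXn // lead_coefXn.
move=> t ts; have [/root_lift[y [ny yF tE]] Mt] := rs_s t ts.
have yb : forall j, M (y 0 j - iota (b 0 j)).
  by apply/(root_reduction ny yF).2; rewrite tE.
have red := fibre_red Aa yb.
have key : evF (q * eval_over_base ('X^e - B) T) = evF (pr_poly m xi ^+ k * p).
  rewrite !rmorphM rmorphXn /= pb_over_base rmorphB /= map_polyXn hornerD hornerN hornerXn.
  rewrite eB addrC addKr mulrCA; congr (_ ^+ k * _); first by rewrite ev_pr_poly.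
  exact: eg.
have keyy : evy y q * ((map_poly evA ('X^e - B)).[t]) = evA xi ^+ k * evy y p.
  have : evy y (q * eval_over_base ('X^e - B) T - pr_poly m xi ^+ k * p) = 0.
    by apply: (fibre_specialise nA lamF ny yF); rewrite rmorphB /= key subrr.
  rewrite rmorphB !rmorphM rmorphXn /= ev_over_base_row tE ev_pr_row => /eqP.
  by rewrite subr_eq0 => /eqP.
have nMq : ~ M (evy y q) by apply: (ev_unit pl red).
have q'0 := pl_unit_neq0 pl nMq.
have -> : ('X^e - map_poly evA B).[t] / evA xi ^+ k = evy y p / evy y q.
  have -> : 'X^e - map_poly evA B = map_poly evA ('X^e - B).
    by rewrite rmorphB /= map_polyXn.
  apply/eqP; rewrite (eqr_div _ _ (expf_neq0 k xi0) q'0) mulrC keyy.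
  by rewrite mulrC.
apply: (plM pl); first exact: (ev_integral pl red).
by apply: (pl_unit pl) => //; apply: (ev_integral pl red).
Qed.

Lemma local_ring_residue f : local_ring z f <-> exists c, residue_at f c.
Proof.
split=> -[c].
  case/(has_value_chart lamF f c nF) => p [q [q0 -> cE]]; exists c, p, q.
  by split=> //; rewrite ?cE ?divfK // mulrC divfK // ev_neq0.
case=> p [q [q0 e1 e2]]; exists c; apply/(has_value_chart lamF f c nF); exists p, q.
by split=> //; rewrite -?e1 -?e2 ?mulfK // mulrC mulKf // ev_neq0.
Qed.

Lemma pb_neq0 q : q.@[a 0] != 0 -> pb q != 0.
Proof.
move=> qa; apply/eqP => q0; have := residue_pb q; rewrite q0 => h.
by case/eqP: qa; apply: residue_uniq h residue0.
Qed.

Lemma pullback_maximal psi : pr_pullback (@maximal_ideal _ _ _ _ D a) psi ->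
  exists g c, residue_at g c /\ psi = x * g.
Proof.
case/(pr_pullback_chart lamF lamD) => p [q [q0 -> h]].
have [p' [q' [q'a eD]]] := (has_value_chart lamD _ 0 naD).1 h.
move=> /esym/eqP; rewrite mulf_eq0 invr_eq0 (negPf q'a) orbF => /eqP p'a.
have q'D : evD q' != 0 by apply: contraNneq q'a => /(base_at aD naD) ->.
have q'pb := pb_neq0 q'a.
have qpb : pb q != 0 by rewrite ker -(base_eq0 pl aD naD nAD AD xiB).
have e1 : pb p / pb q = pb p' / pb q'.
  apply/eqP; rewrite (eqr_div _ _ qpb q'pb) -!rmorphM; apply/eqP/pb_eq.
  by apply/eqP; rewrite !rmorphM /= -(eqr_div _ _ q0 q'D) eD.
have [q1 q1a /(_ p' p'a) [r1 er]] := xiU.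
have q1pb := pb_neq0 q1a.
have er' : pb q1 * pb p' = pb r1 * x by have := @pb_eq (q1 * p') (r1 * xi); rewrite !rmorphM; apply.
exists (pb r1 / (pb q1 * pb q')), (r1.@[a 0] / (q1.@[a 0] * q'.@[a 0])); split.
  apply: residueM (residue_pb r1) _; apply: residueV; first by rewrite mulf_neq0.
  by apply: residueM; apply: residue_pb.
by rewrite e1; exact: (frac_extract q'pb q1pb er').
Qed.

Lemma uniformiser_in_pullback : pr_pullback (@maximal_ideal _ _ _ _ D a) x.
Proof.
have [D0 [X1 [X2 [h1 h2 e1 e2]]]] := common_homogenise wD lam1 xi 1.
have X1a : X1.@[a 0] = 0 by rewrite -xia; apply: (e1 _ idfun _ naD).
have X2a : X2.@[a 0] = 1 by rewrite -(meval1 (a 0)); apply: (e2 _ idfun _ naD).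
exists (fun=> D0), X1, X2; split=> //.
- by apply/negP => /(aD.2); rewrite X2a => /eqP; rewrite oner_eq0.
- by exists (fun=> D0), X1, X2; rewrite X1a X2a mul0r oner_neq0.
rewrite (chart_ratio lamF (multihomog_pr_poly h1) (multihomog_pr_poly h2)) -!pullbackE.
by rewrite /pullback (e1 _ _ _ (pullback_normalised lamF)) (e2 _ _ _ (pullback_normalised lamF)) rmorph1 divr1.
Qed.

Lemma algebraic_mult_ramification : algebraic_mult D F a b e.
Proof.
have lr f c : residue_at f c -> local_ring z f by move=> h; apply/local_ring_residue; exists c.
apply: (length_multiples (theta := theta)).
- exact: lr residue0.
- by have := lr _ _ (residue_const 1); rewrite rmorph1.
- by move=> f g /local_ring_residue[c hf] /local_ring_residue[c' hg]; apply: lr (residueD hf hg).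
- by move=> f g /local_ring_residue[c hf] /local_ring_residue[c' hg]; apply: lr (residueM hf hg).
- exact: lr residue_theta.
- exact: theta_neq0.
- case/local_ring_residue => c h; have := residueM residue_theta h.
  rewrite mul0r divff ?theta_neq0 // => h1.
  have := residue_const 1; rewrite rmorph1 => /(residue_uniq h1)/eqP.
  by rewrite eq_sym oner_eq0.
- move=> f /local_ring_residue[c hf]; case: (altP (c =P 0)) => [c0|c0].
    rewrite c0 in hf; have [g [c' [hg fE]]] := residue_div hf.
    by right; exists g => //; apply: lr hg.
  left; split; last exact: lr (residueV c0 hf).
  by apply: contraNneq c0 => f0; rewrite f0 in hf; rewrite (residue_uniq hf residue0).
have u0 : u != 0 by apply: contraNneq x_neq0 => u0; rewrite xE u0 mulr0.
move=> f; split.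
  case=> k [r [s [Or Js ->]]].
  apply: (big_ind (multiples (@local_ring _ _ _ _ F z) theta e)).
  - by exists 0; [apply: lr residue0 | rewrite mulr0].
  - move=> f1 f2 [g1 /local_ring_residue[c1 h1] ->] [g2 /local_ring_residue[c2 h2] ->].
    by exists (g1 + g2); [apply: lr (residueD h1 h2) | rewrite mulrDr].
  - move=> i _; have /local_ring_residue[c hr] := Or i.
    have [g [c' [hg ->]]] := pullback_maximal (Js i).
    exists (u * (r i * g)); first by apply: lr (residueM hu (residueM hr hg)).
    by rewrite xE mulrCA !mulrA.
case=> g /local_ring_residue[c hg] ->.
exists 1%N, (fun=> u^-1 * g), (fun=> x); split.
- by move=> _; apply: lr (residueM (residueV d0 hu) hg).
- by move=> _; apply: uniformiser_in_pullback.
- by rewrite big_ord1 xE [RHS]mulrC -[RHS]mulrA mulVKf.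
Qed.

End Count.

(** * Multiplicities coincide *)

Lemma ev_map_mpoly (N : nat) (L : closedFieldType) (K : comNzRingType) (iota : {rmorphism L -> K})
    (z : 'I_N -> K) (p : {mpoly L[N]}) : (map_mpoly iota p).@[z] = mmap iota z p.
Proof.
by rewrite /map_mpoly ev_morph; apply: eq_ev => [c|i] /=; rewrite ?mevalC ?mevalXU.
Qed.

Theorem theorem2p5 (L : closedFieldType) (p : nat) (hp : p \in [pchar L])
    (n m : nat)
    (D : variety (@pn_block n) L) (F : variety (@pnpm_block n m) L)
    (D_curve : curve D) (D_smooth : smooth D)
    (F_curve : curve F) (F_smooth : smooth F)
    (F_over_D : lies_over D F)
    (F_finite : pr_finite D F) (F_surj : pr_surjective D F)
    (F_sep : pr_separable D F)
    (K : closedFieldType) (iota : {rmorphism L -> K}) (v : valuation K)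
    (hK : nonstandard_model iota v)
    (a : 'rV[L]_n.+1) (b : 'rV[L]_m.+1) (hab : on_variety F (row_mx a b))
    (a' : 'rV[K]_n.+1) (a'_D : on_variety_over iota D a')
    (a'_a : specialises iota v a' a) (a'_gen : ~ rational_over iota a') :
  exists2 e : nat,
    zariski_mult iota v F a' b e & algebraic_mult D F a b e.
Proof.
have pl := val_place hK; set O := val_integral v in pl; set M := val_infinitesimal v in pl.
have aD : on_variety D a.
  split=> [[]|q /F_over_D qF].
    have [i] := hab.1 true; case: (split_ordP i) => j ->; rewrite ?pnpm_r // => _.
    by rewrite row_mxEl; exists j.
  by have := hab.2 _ qF; rewrite /meval ev_pr_row.
have [i0 _ ai0] := aD.1 tt.
pose lam1 (i : 'I_n.+1) : L := (i == i0)%:R / a 0 i0.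
have na : \sum_i lam1 i * a 0 i = 1.
  rewrite (bigD1 i0) //= /lam1 eqxx mul1r mulVf // big1 ?addr0 // => i /negPf ->.
  by rewrite mul0r mul0r.
have [k k0 ka] := a'_a.
pose t := \sum_i iota (lam1 i) * (k * a' 0 i).
have Mt : M (t - iota 1).
  rewrite -na rmorph_sum -sumrB; apply: (pl_id_sum pl) => i _ /=.
  by rewrite rmorphM -mulrBr; apply: (pl_idM pl); [apply: (pl_const pl) | apply: ka].
have [t0 _] := pl_div pl Mt Mt (oner_neq0 L).
pose A : 'rV[K]_n.+1 := (k / t) *: a'.
have kt0 : k / t != 0 by rewrite mulf_neq0 // invr_eq0.
have nA : \sum_i iota (lam1 i) * A 0 i = 1.
  rewrite -(divff t0) {2}/t mulr_suml; apply: eq_bigr => i _; rewrite mxE; ring.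
have AD q : q \in mem_ideal D -> mmap iota (A 0) q = 0.
  move=> qD.
  have := ideal_scale (iota := iota) (z := a' 0) (fun=> k / t) _ qD => <-.
    by apply: eq_ev => // i; rewrite mxE.
  by move=> s sD; rewrite -ev_map_mpoly; apply: a'_D.2.
have Aa i : M (A 0 i - iota (a 0 i)).
  have [_] := pl_div pl (ka i) Mt (oner_neq0 L); rewrite divr1 mxE.
  by congr (M (_ - _)); ring.
have A_gen : exists i, A 0 i != iota (a 0 i).
  apply: Classical_Prop.NNPP => nex; apply: a'_gen; exists a; exists (fun=> k / t) => // i.
  rewrite [LHS]mxE; apply/eqP/negPn/negP => ne; apply: nex; exists i.
  by rewrite mxE eq_sym.
have naD : normalised (@pn_block n) idfun lam1 (a 0) by apply/normalised_pn.
have nAD : normalised (@pn_block n) iota lam1 (A 0) by apply/normalised_pn.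
have [xi [xia xi0 xiU xiB]] := base_uniformiser pl D_curve D_smooth aD naD nAD AD Aa A_gen.
have [lam2 [Phi [nb PhiM PhiC]]] :=
  fibre_chart pl D_curve F_curve F_over_D F_sep hab aD na nA AD Aa xia xi0 xiB.
have [T [Tz TU Tother Tinj]] := fibre_parameter iota A F_curve hab na F_smooth Phi nb.
have [Q Qsep Qr] := theta_algebraic D_curve F_curve F_over_D F_sep hab aD na T nb.
have [P minP] := minimal_exists (ex_intro2 _ _ Q (separable_poly_neq0 Qsep) Qr).
have [s [sE lA us Os sep]] := roots_exist pl D_curve F_curve F_over_D F_sep hab aD na nA AD Aa
  xia xi0 xiB nb PhiM PhiC Tz Tother minP.
have [e [u [d [hu d0 xE le_e]]]] := ramification_le pl D_curve F_curve F_over_D F_sep hab aD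
  na nA AD Aa xia xi0 xiU xiB nb Tz TU minP sE lA Os.
pose s0 := [seq x <- s | infinitesimal M x].
have s0P x : x \in s0 -> x \in s /\ M x.
  by rewrite mem_filter => /andP[/infinitesimalP Mx xs].
have sroot x : (x \in s) = root (map_poly (mmap iota (A 0)) P) x.
  by rewrite sE rootZ // root_prod_XsubC.
have us0 : uniq s0 by apply: filter_uniq.
have size_s0 : size s0 = e.
  apply/eqP; rewrite eqn_leq size_filter le_e andbT -size_filter.
  apply: (infinitesimal_roots_le pl D_curve F_curve F_over_D F_sep hab aD na nA AD Aa
    xia xi0 xiB nb PhiM PhiC Tz TU Tother minP hu d0 xE us0).
    by move=> x /s0P[xs Mx]; rewrite -sroot.
  by move=> x y /s0P[xs _] /s0P[ys _]; apply: sep.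
exists e; last first.
  exact: (algebraic_mult_ramification pl D_curve F_curve F_over_D F_sep hab aD na nA AD
    xia xi0 xiU xiB nb Tz TU hu d0 xE).
have yyE x : exists y : 'rV[K]_m.+1, x \in s0 ->
    [/\ \sum_j iota (lam2 j) * y 0 j = 1, on_fibre iota F A y,
        mmap iota (row_mx A y 0) T = x & forall j, M (y 0 j - iota (b 0 j))].
  case: (boolP (x \in s0)) => [/s0P[xs Mx]|_]; last by exists 0.
  rewrite sroot in xs.
  have [y [ny yF yx]] := root_lift pl D_curve F_curve F_over_D F_sep hab aD na nA AD
    xiB nb minP xs.
  exists y => _; split=> //.
  by apply/(root_reduction pl Aa PhiM PhiC Tz Tother ny yF).2; rewrite yx.
pose yy x := proj1_sig (constructive_indefinite_description _ (yyE x)).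
have yyP x : x \in s0 -> [/\ \sum_j iota (lam2 j) * yy x 0 j = 1, on_fibre iota F A (yy x),
    mmap iota (row_mx A (yy x) 0) T = x & forall j, M (yy x 0 j - iota (b 0 j))].
  by rewrite /yy; case: constructive_indefinite_description.
have norm_neq0 (y : 'rV[K]_m.+1) : \sum_j iota (lam2 j) * y 0 j = 1 -> y != 0.
  move=> ny; apply/eqP => y0; move/eqP: ny; rewrite big1 ?(eq_sym 0) ?oner_eq0 // => j _.
  by rewrite y0 mxE mulr0.
have line_inj (y y' : 'rV[K]_m.+1) : \sum_j iota (lam2 j) * y 0 j = 1 ->
    \sum_j iota (lam2 j) * y' 0 j = 1 -> <<y>>%MS = <<y'>>%MS -> y = y'.
  move=> ny ny' /genmxP/andP[/sub_rVP[c yE] _].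
  suff c1 : c = 1 by rewrite yE c1 scale1r.
  by rewrite -ny yE -[LHS]mulr1 -ny' mulr_sumr; apply: eq_bigr => j _; rewrite mxE; ring.
have to_fibre r (y : 'rV[K]_m.+1) : r != 0 ->
    (forall q, q \in mem_ideal F -> mmap iota (row_mx a' y 0) q = 0) ->
    on_fibre iota F A (r *: y).
  move=> r0 yF q qF; rewrite -[RHS](ideal_scale (fun g : bool => if g then k / t else r) yF qF).
  apply: eq_ev => // i; case: (split_ordP i) => j ->.
    by rewrite pnpm_l !row_mxEl mxE.
  by rewrite pnpm_r !row_mxEr mxE.
exists [seq <<yy x>>%MS | x <- s0]; split; [|by rewrite size_map|].
  rewrite map_inj_in_uniq // => x x' xs xs' e_line.
  have [n1 _ T1 _] := yyP x xs; have [n2 _ T2 _] := yyP x' xs'.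
  by rewrite -T1 -T2 (line_inj _ _ n1 n2 e_line).
move=> l; split.
  case/mapP=> x xs ->; have [ny yF yT yb] := yyP x xs.
  exists (yy x); split=> //; first exact: norm_neq0.
  split.
    by exists 1; rewrite ?oner_neq0 // => j; rewrite mul1r; apply: yb.
  split.
    case.
      have [i _ a'i] := a'_D.1 tt.
      by exists (lshift m.+1 i); rewrite ?pnpm_l ?row_mxEl.
    have [j yj] : exists j, yy x 0 j != 0.
      apply: Classical_Prop.NNPP => nex; case/eqP: (norm_neq0 _ ny); apply/rowP => j.
      by rewrite mxE; apply/eqP/negPn/negP => h; apply: nex; exists j.
    by exists (rshift n.+1 j); rewrite ?pnpm_r ?row_mxEr.
  move=> q qF; rewrite ev_map_mpoly.
  rewrite -[RHS](ideal_scale (fun g : bool => if g then (k / t)^-1 else 1) yF qF).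
  apply: eq_ev => // i; case: (split_ordP i) => j ->.
    by rewrite pnpm_l !row_mxEl mxE mulKf.
  by rewrite pnpm_r !row_mxEr mul1r.
case=> y [y0 [[r r0 yb] yF] ->].
pose t2 := \sum_j iota (lam2 j) * (r * y 0 j).
have Mt2 : M (t2 - iota 1).
  rewrite -nb rmorph_sum -sumrB; apply: (pl_id_sum pl) => j _ /=.
  by rewrite rmorphM -mulrBr; apply: (pl_idM pl); [apply: (pl_const pl) | apply: yb].
have [t20 _] := pl_div pl Mt2 Mt2 (oner_neq0 L).
have rt0 : r / t2 != 0 by rewrite mulf_neq0 // invr_eq0.
pose y1 : 'rV[K]_m.+1 := (r / t2) *: y.
have ny1 : \sum_j iota (lam2 j) * y1 0 j = 1.
  rewrite -(divff t20) {2}/t2 mulr_suml; apply: eq_bigr => j _; rewrite mxE; ring.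
have y1b j : M (y1 0 j - iota (b 0 j)).
  have [_] := pl_div pl (yb j) Mt2 (oner_neq0 L); rewrite divr1 mxE.
  by congr (M (_ - _)); ring.
have y1F : on_fibre iota F A y1.
  by apply: to_fibre rt0 _ => q qF; rewrite -ev_map_mpoly; apply: yF.2.
pose x := mmap iota (row_mx A y1 0) T.
have xs : x \in s0.
  rewrite mem_filter sroot (fibre_is_root hab na nA nb minP ny1 y1F) andbT.
  by apply/infinitesimalP/(root_reduction pl Aa PhiM PhiC Tz Tother ny1 y1F).2.
have [nyx yxF Tyx _] := yyP x xs.
have [c1 in1] := PhiC _ ny1 y1F; have [c2 in2] := PhiC _ nyx yxF.
have e12 : y1 = yy x by apply: (Tinj _ _ in1 in2); rewrite /= Tyx.
apply/mapP; exists x => //; rewrite -e12.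
by apply/esym/eq_genmx; apply: eqmx_scale.
Qed.
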